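(* There exists a uniform constant $\beta>0$ such that for every orientable compact Kähler manifold $(M,g)$ with bisectional curvature bounded in $(0,1]$, the injectivity radius of $(M,g)$ is no less than $\beta\pi$.
   Context: The bisectional curvature is bounded in $(0,1]$ if $0<R(u,\bar u,v,\bar v)\le1$ for all unit vectors $u,v\in T^{1,0}M$ at the same point, where $R$ is the curvature tensor, $R_{i\bar jk\bar l}=-\frac{\partial^2g_{i\bar j}}{\partial z^k\partial\bar z^l}+\sum g^{p\bar q}\frac{\partial g_{i\bar q}}{\partial z^k}\frac{\partial g_{p\bar j}}{\partial\bar z^l}$. For a unit real tangent vector $x$ with complex structure $J$, the corresponding unit vector is $u=\frac1{\sqrt2}(x-\sqrt{-1}Jx)$, and $R(u,\bar u,u,\bar u)$ equals the sectional curvature of the plane spanned by $x,Jx$. *)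

(* Defs.v *)
From HB Require Import structures.
From mathcomp Require Import all_boot all_order all_algebra.
From mathcomp Require Import complex.
From mathcomp Require Import all_classical all_reals all_analysis.

Set Implicit Arguments.
Unset Strict Implicit.
Unset Printing Implicit Defensive.

Import Order.TTheory GRing.Theory Num.Theory.
Import numFieldNormedType.Exports.

Local Open Scope classical_set_scope.
Local Open Scope complex_scope.
Local Open Scope ring_scope.

(** * Smooth maps on open subsets of R^m *)

Section Smooth.
Context {R : realType} {m : nat} {W : normedModType R}.

Fixpoint Ck (k : nat) (U : set 'rV[R]_m) (f : 'rV[R]_m -> W) : Prop :=
  (forall z, U z -> {for z, continuous f}) /\
  (if k is k'.+1 then
     forall v, (forall z, U z -> derivable f z v) /\
               Ck k' U (fun z => 'D_v f z)
   else True).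

(* Only meaningful when U is open. *)
Definition smooth (U : set 'rV[R]_m) (f : 'rV[R]_m -> W) : Prop :=
  forall k, Ck k U f.

End Smooth.

(** * Charts and orientability *)

(* A homeomorphism from an open subset of M onto an open subset of R^m; the
   values of [chart_map] and [chart_inv] elsewhere are irrelevant. *)
Record chart (R : realType) (m : nat) (M : topologicalType) := Chart {
  chart_dom : set M;
  chart_map : M -> 'rV[R]_m;
  chart_inv : 'rV[R]_m -> M;
  chart_img := chart_map @` chart_dom;
  chart_dom_open : open chart_dom;
  chart_img_open : open chart_img;
  chart_mapK : forall p, chart_dom p -> chart_inv (chart_map p) = p;
  chart_map_cont : forall p, chart_dom p -> {for p, continuous chart_map};
  chart_inv_cont : forall z, chart_img z -> {for z, continuous chart_inv}
}.

Section Charts.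
Context {R : realType} {m : nat} {M : topologicalType}.
Implicit Types phi psi : chart R m M.

Definition overlap phi psi : set 'rV[R]_m :=
  chart_img phi `&` chart_inv phi @^-1` chart_dom psi.

Definition transition phi psi : 'rV[R]_m -> 'rV[R]_m :=
  chart_map psi \o chart_inv phi.

Definition covering (A : set (chart R m M)) : Prop :=
  forall p, exists2 phi, A phi & chart_dom phi p.

Definition smooth_transition phi psi : Prop :=
  smooth (overlap phi psi) (transition phi psi).

(* Orientability of the smooth manifold with atlas A. *)
Definition orientable_atlas (A : set (chart R m M)) : Prop :=
  exists O : set (chart R m M),
    [/\ covering O,
        forall phi psi, O phi -> A psi ->
          smooth_transition phi psi /\ smooth_transition psi phi &
        forall phi psi, O phi -> O psi ->
          smooth_transition phi psi /\
          (forall z, overlap phi psi z ->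
             0 < \det (jacobian (transition phi psi) z))].

End Charts.

(** * Complex structure and Kähler metrics *)

Section LocalGeometry.
Context {R : realType} {n : nat}.
Local Notation V := 'rV[R]_(n + n).

(* C^n is R^(n + n) with coordinates (x^1, ..., x^n, y^1, ..., y^n) and
   z^k = x^k + i y^k. *)
Definition stdJ (v : V) : V := row_mx (- rsubmx v) (lsubmx v).

(* Cauchy-Riemann: the differential commutes with multiplication by i. *)
Definition holomorphic (U : set V) (F : V -> V) : Prop :=
  smooth U F /\
  (forall z v, U z -> 'D_(stdJ v) F z = stdJ ('D_v F z)).

(* A Riemannian metric on an open set of R^(n + n) is given by its Gram
   matrices in the coordinate frame. *)
Implicit Types (G : V -> 'M[R]_(n + n)) (z u v w : V).

Definition inner G z u v : R := (u *m G z *m v^T) 0 0.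

Definition riemannian (U : set V) G : Prop :=
  [/\ smooth U G,
      forall z, U z -> (G z)^T = G z &
      forall z v, U z -> v != 0 -> 0 < inner G z v v].

Definition J_invariant (U : set V) G : Prop :=
  forall z u v, U z -> inner G z (stdJ u) (stdJ v) = inner G z u v.

Definition kahler_form G z u v : R := inner G z (stdJ u) v.

(* The exterior derivative of the Kähler form on constant vector fields, whose
   Lie brackets vanish. *)
Definition d_kahler_form G z u v w : R :=
  'D_u (fun x => kahler_form G x v w) z
  + 'D_v (fun x => kahler_form G x w u) z
  + 'D_w (fun x => kahler_form G x u v) z.

(** ** Curvature *)

Definition frame_x (k : 'I_n) : V := delta_mx 0 (lshift n k).
Definition frame_y (k : 'I_n) : V := delta_mx 0 (rshift n k).

(* The complex-bilinear extension of the metric to the complexified tangent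
   space, and the frame d/dz^k = (d/dx^k - i d/dy^k) / 2 and its conjugate. *)
Definition innerC G z (u v : 'rV[R[i]]_(n + n)) : R[i] :=
  (u *m map_mx (real_complex R) (G z) *m v^T) 0 0.

Definition frame_z (k : 'I_n) : 'rV[R[i]]_(n + n) :=
  2^-1 *: (map_mx (real_complex R) (frame_x k)
           - 'i *: map_mx (real_complex R) (frame_y k)).
Definition frame_zbar (k : 'I_n) : 'rV[R[i]]_(n + n) :=
  2^-1 *: (map_mx (real_complex R) (frame_x k)
           + 'i *: map_mx (real_complex R) (frame_y k)).

(* The entry (i, j) is g_{i \bar j}. *)
Definition gC G z : 'M[R[i]]_n := \matrix_(i, j)
  innerC G z (frame_z i) (frame_zbar j).

Definition derC (v : V) (f : V -> R[i]) z : R[i] :=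
  'D_v (fun x => complex.Re (f x)) z +i* 'D_v (fun x => complex.Im (f x)) z.

(* d f / d z^k and d f / d \bar z^k *)
Definition partialz (k : 'I_n) (f : V -> R[i]) z : R[i] :=
  2^-1 * (derC (frame_x k) f z - 'i * derC (frame_y k) f z).
Definition partialzbar (k : 'I_n) (f : V -> R[i]) z : R[i] :=
  2^-1 * (derC (frame_x k) f z + 'i * derC (frame_y k) f z).

(* R_{i \bar j k \bar l}.  As \sum_q g_{i \bar q} g^{p \bar q} = (i == p), the
   coefficient g^{p \bar q} is the entry (q, p) of the inverse matrix. *)
Definition curv G z (i j k l : 'I_n) : R[i] :=
  - partialz k (partialzbar l (fun x => gC G x i j)) z
  + \sum_p \sum_q invmx (gC G z) q p
      * partialz k (fun x => gC G x i q) z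
      * partialzbar l (fun x => gC G x p j) z.

(* R(u, \bar u, v, \bar v) for u = \sum_k u^k d/dz^k and v likewise. *)
Definition bisectional G z (u v : 'rV[R[i]]_n) : R[i] :=
  \sum_i \sum_j \sum_k \sum_l
    curv G z i j k l * u 0 i * (u 0 j)^* * v 0 k * (v 0 l)^*.

(* With this normalization (x - i Jx) / sqrt 2 is a unit vector of T^{1,0}
   exactly when x is a unit real tangent vector. *)
Definition unit10 G z (u : 'rV[R[i]]_n) : Prop :=
  \sum_i \sum_j gC G z i j * u 0 i * (u 0 j)^* = 1.

(** ** Levi-Civita connection *)

(* Christoffel symbols of the first kind: the inner product with w of the
   covariant derivative of v along u, for constant vector fields u, v, w. *)
Definition christoffel G z u v w : R :=
  2^-1 * ('D_u (fun x => inner G x v w) z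
          + 'D_v (fun x => inner G x u w) z
          - 'D_w (fun x => inner G x u v) z).

End LocalGeometry.

(** * Kähler manifolds *)

(* [kmetric phi] is the metric in the coordinates of phi. *)
Record kahlerManifold (R : realType) (n : nat) := KahlerManifold {
  kcarrier :> topologicalType;
  katlas : set (chart R (n + n) kcarrier);
  kmetric : chart R (n + n) kcarrier -> 'rV[R]_(n + n) -> 'M[R]_(n + n);
  khausdorff : hausdorff_space kcarrier;
  ksecond_countable : @second_countable kcarrier;
  kcovering : covering katlas;
  kholomorphic : forall phi psi, katlas phi -> katlas psi ->
    holomorphic (overlap phi psi) (transition phi psi);
  kriemannian : forall phi, katlas phi ->
    riemannian (chart_img phi) (kmetric phi);
  kcompatible : forall phi psi z u v, katlas phi -> katlas psi ->
    overlap phi psi z ->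
    inner (kmetric phi) z u v
    = inner (kmetric psi) (transition phi psi z)
        ('D_u (transition phi psi) z) ('D_v (transition phi psi) z);
  khermitian : forall phi, katlas phi ->
    J_invariant (chart_img phi) (kmetric phi);
  kclosed : forall phi z u v w, katlas phi -> chart_img phi z ->
    d_kahler_form (kmetric phi) z u v w = 0
}.

Arguments katlas {R n} k _.
Arguments kmetric {R n} k _ _.

Section KahlerManifolds.
Context {R : realType} {n : nat} (M : kahlerManifold R n).
Local Notation V := 'rV[R]_(n + n).

Definition orientable : Prop := orientable_atlas (katlas M).

Definition bisectional_in_01 : Prop :=
  forall phi z (u v : 'rV[R[i]]_n), katlas M phi -> chart_img phi z ->
    unit10 (kmetric M phi) z u -> unit10 (kmetric M phi) z v ->
    0 < bisectional (kmetric M phi) z u v <= 1.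

(* The equation in the charts says that the inner product of the covariant
   derivative of c' along c with every w vanishes. *)
Definition geodesic (I : set R) (c : R -> M) : Prop :=
  (forall t, I t -> {for t, continuous c}) /\
  (forall phi t, katlas M phi -> I t -> chart_dom phi (c t) ->
    let x := (chart_map phi \o c : R -> V) in
    [/\ derivable x t 1, derivable (x^`())%classic t 1 &
        forall w,
          inner (kmetric M phi) (x t) ((x^`())%classic^`()%classic t) w
          + christoffel (kmetric M phi) (x t)
              (x^`()%classic t) (x^`()%classic t) w = 0]).

(* exp_p(v) = q, where the chart phi, defined at p, identifies T_p M with V. *)
Definition exp_rel (phi : chart R (n + n) M) (p : M) (v : V) (q : M) : Prop :=
  exists (I : set R) (c : R -> M),
    [/\ open I, `[0, 1] `<=` I, geodesic I c &
        [/\ c 0 = p, ((chart_map phi \o c : R -> V)^`())%classic 0 = v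
          & c 1 = q]].

Definition tangent_ball (phi : chart R (n + n) M) (p : M) (r : R) : set V :=
  [set v | inner (kmetric M phi) (chart_map phi p) v v < r ^+ 2].

(* exp_p is defined on the ball of radius r of T_p M and is a diffeomorphism
   from this ball onto an open subset of M. *)
Definition exp_diffeo (phi : chart R (n + n) M) (p : M) (r : R) : Prop :=
  let B := tangent_ball phi p r in
  exists (E : V -> M) (L : M -> V),
    [/\ forall v, B v -> exp_rel phi p v (E v),
        forall v, B v -> L (E v) = v,
        forall v, B v -> {for v, continuous E},
        open (E @` B) &
        forall psi, katlas M psi ->
          smooth (B `&` E @^-1` chart_dom psi) (chart_map psi \o E) /\
          smooth (chart_img psi `&` chart_inv psi @^-1` (E @` B))
            (L \o chart_inv psi)].

Definition injectivity_radius_at (p : M) : \bar R :=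
  ereal_sup [set r%:E | r in [set r : R | 0 < r /\
    exists phi, [/\ katlas M phi, chart_dom phi p & exp_diffeo phi p r]]].

Definition injectivity_radius : \bar R :=
  ereal_inf (range injectivity_radius_at).

End KahlerManifolds.

(* Main.v *)
Require Import Defs.
From HB Require Import structures.
From mathcomp Require Import all_boot all_order all_algebra.
From mathcomp Require Import complex.
From mathcomp Require Import all_classical all_reals all_analysis.
From mathcomp Require Import perm ring lra.

(* The constant is beta = 1 / (2 pi), that is, the injectivity radius is at least 1/2.
   By polarization, bisectional curvature in (0, 1] gives sectional curvature at most 3/2,
   so geodesics of length at most 1/sqrt 2 have no conjugate points.  Suppose that exp_p is
   not injective on the ball of radius 1/2 for some p.  Among all pairs v != w of tangent
   vectors at the same point (of any p) with exp_p v = exp_p w, one minimizes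
   |v|^2 + |w|^2: the manifold is compact, and since there are no conjugate points the pairs
   cannot degenerate to v = w.  By the first variation formula the two geodesics of
   a minimal pair form a smooth closed geodesic.  Its velocity u turned by the complex
   structure is a parallel field J u along it, and moving the endpoints of both geodesics
   in the direction J u has negative second variation because R(u, Ju, Ju, u) > 0; this
   contradicts minimality.  So exp_p is an injective local diffeomorphism on that ball. *)

Set Implicit Arguments.
Unset Strict Implicit.
Unset Printing Implicit Defensive.

Import Order.TTheory GRing.Theory Num.Theory.
Import numFieldNormedType.Exports.

Local Open Scope classical_set_scope.
Local Open Scope ring_scope.

(** * Smooth maps *)

(** Origin of the numbers: a minimal pair has [|v|^2 + |w|^2 < 1/2], so both squared speeds are
    below 1/2, and the bound 3/2 makes the curvature term of the Jacobi equation at most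
    [3/4 |Y|^2]. In place of a comparison theorem, [(2 t - 1) |Y|^2] is added to [<P, Y>], where Y
    is a Jacobi field on [0, 1] and P its covariant derivative: the derivative gains [2 |Y|^2],
    which is more than enough. The base point of a pair has to be free: moving the far end shows
    that the velocities are opposite there, but only moving the common origin shows this at the
    start. Variations are therefore built by inverting (origin, velocity) -> (origin, endpoint), a
    local diffeomorphism in the absence of conjugate points. Such a variation consists of geodesics,
    so its field is the Jacobi field with boundary values J u and not the parallel field J u itself;
    the same kind of correction term accounts for the difference. Distances never occur, only
    squared speeds of geodesics on [0, 1]; compactness provides completeness by prolonging short
    geodesics uniformly. *)

Lemma continuous_near_le {R : realType} (T : topologicalType) (W : normedModType R)
    (f : T -> W) (z : T) (e : R) :
  {for z, continuous f} -> 0 < e -> \forall y \near z, `|f z - f y| <= e.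
Proof. by move=> /cvgrPdist_le; apply. Qed.

Lemma nbhs_norm_lt {R : realType} (W : normedModType R) (z : W) (A : set W) :
  nbhs z A -> exists2 r : R, 0 < r & forall y, `|y - z| < r -> A y.
Proof.
move=> /nbhs_ballP[r /= r0 h]; exists r => // y yr; apply: h.
by rewrite -ball_normE /= distrC.
Qed.

Lemma norm_lt_nbhs {R : realType} (W : normedModType R) (z : W) (A : set W) (r : R) :
  0 < r -> (forall y, `|y - z| < r -> A y) -> nbhs z A.
Proof.
move=> r0 h; apply/nbhs_ballP; exists r => // y.
by rewrite -ball_normE /= distrC => /h.
Qed.

Section Basics.
Context {R : realType}.

Lemma coord_le_norm p q (A : 'M[R]_(p, q)) i j : `|A i j| <= `|A|.
Proof.
rewrite [leRHS]/Num.Def.normr /= mx_normrE.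
exact: (le_bigmax _ (fun ij => `|A ij.1 ij.2|) (i, j)).
Qed.

Lemma mx_norm_leP p q (A : 'M[R]_(p, q)) (e : R) : 0 <= e ->
  (forall i j, `|A i j| <= e) -> `|A| <= e.
Proof.
move=> e0 h; rewrite [leLHS]/Num.Def.normr /= mx_normrE.
by apply: bigmax_le => // -[i j] _; apply: h.
Qed.

Lemma row_coord_sum m (v : 'rV[R]_m) : v = \sum_i v 0 i *: delta_mx 0 i.
Proof. exact: row_sum_delta. Qed.

Lemma linear_rV_continuous m (W : normedModType R) (L : {linear 'rV[R]_m -> W}) :
  continuous L.
Proof.
move=> z; apply: differentiable_continuous.
have H i : differentiable (fun v : 'rV[R]_m => v 0 i *: L (delta_mx 0 i)) z.
  by apply: differentiableZl; apply: differentiable_coord.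
have := differentiable_sum H; congr (differentiable _ _).
rewrite funeqE => v; rewrite fct_sumE {2}(row_coord_sum v) linear_sum.
by apply: eq_bigr => i _; rewrite linearZ.
Qed.

(** The little-o condition spelled out with epsilons. Continuity of the candidate [L] is automatic
    in finite dimension. *)
Lemma is_diff_eps m (W : normedModType R) (f : 'rV[R]_m -> W)
    (L : {linear 'rV[R]_m -> W}) z :
  (forall e, 0 < e -> \forall h \near (0 : 'rV[R]_m),
     `|f (h + z) - f z - L h| <= e * `|h|) ->
  differentiable f z /\ 'd f z = L :> (_ -> _).
Proof.
move=> H; have Lc := linear_rV_continuous (L := L).
have E : f \o shift z = cst (f z) + (L : _ -> _) +o_ (0 : 'rV[R]_m) id.
  apply/eqaddoP => e /H; apply: filterS => h.
  by rewrite !fctE /= opprD addrA.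
have dE := diff_unique Lc E; split => //.
by apply/diff_locallyP; rewrite dE.
Qed.

Lemma is_derive_line m (W : normedModType R) (f : 'rV[R]_m -> W) (z v : 'rV[R]_m) (s : R) :
  derivable f (s *: v + z) v ->
  is_derive s 1 (fun s : R => f (s *: v + z)) ('D_v f (s *: v + z)).
Proof.
move=> d.
have E : (fun h : R => h^-1 *: (f ((h *: 1 + s) *: v + z) - f (s *: v + z))) =
    (fun h : R => h^-1 *: (f (h *: v + (s *: v + z)) - f (s *: v + z))).
  by apply: funext => h /=; rewrite [h *: 1]mulr1 scalerDl addrA.
by split; rewrite /derivable /derive /= ?E.
Qed.

Lemma mvt_line m (f : 'rV[R]_m -> R) (z v : 'rV[R]_m) :
  (forall s : R, 0 <= s <= 1 -> derivable f (s *: v + z) v) ->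
  exists2 s : R, 0 <= s <= 1 & f (v + z) - f z = 'D_v f (s *: v + z).
Proof.
move=> d.
have D (s : R) : 0 <= s <= 1 ->
    is_derive s 1 (fun s : R => f (s *: v + z)) ('D_v f (s *: v + z)).
  by move=> hs; apply/is_derive_line/d.
case: (@MVT R (fun s => f (s *: v + z)) (fun s => 'D_v f (s *: v + z)) 0 1 ltr01).
- by move=> s; rewrite in_itv /= => /andP[a b]; apply: D; rewrite !ltW.
- apply: derivable_within_continuous => s.
  by rewrite in_itv /= => /D [].
move=> c; rewrite in_itv /= => /andP[a b] E; exists c; first by rewrite !ltW.
by rewrite scale1r scale0r add0r subr0 mulr1 in E.
Qed.

(** Rescaling the increment by [k] proves homogeneity from a single directional derivative. It
    serves where differentiability is still to be proved, as in [differentiable_partial] and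
    [flow_step]. *)
Lemma derivable_scale m (W : normedModType R) (f : 'rV[R]_m -> W) (z v : 'rV[R]_m) (k : R) :
  derivable f z v -> is_derive z (k *: v) f (k *: 'D_v f z).
Proof.
have [->|k0] := eqVneq k 0; first by rewrite !scale0r => _; apply: is_derive0.
move=> H.
have C : (fun h : R => h^-1 *: (f (h *: (k *: v) + z) - f z)) @ 0^' --> k *: 'D_v f z.
  have -> : (fun h : R => h^-1 *: (f (h *: (k *: v) + z) - f z)) =
     (fun h => k *: (h^-1 *: (f (h *: v + z) - f z))) \o ( *%R^~ k).
    apply: funext => h /=; rewrite !scalerA.
    have [->|h0] := eqVneq h 0; first by rewrite !mul0r !scale0r add0r subrr !scaler0.
    by congr (_ *: _); rewrite invfM mulrCA divff // mulr1.
  apply: (@cvg_comp _ _ _ _ _ _ (0^')).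
    move=> A /= [e /= e0 He]; exists (e / `|k|); first by rewrite /= divr_gt0 ?normr_gt0.
    move=> h /=; rewrite sub0r normrN => hk h0; apply: He; last by rewrite /= mulf_neq0.
    by rewrite /= sub0r normrN normrM -ltr_pdivlMr ?normr_gt0.
  exact: cvgZl_tmp.
apply: DeriveDef; first by apply/cvg_ex; eexists; exact: C.
exact/cvg_lim.
Qed.

(* The increment is split along the coordinate axes. *)
Lemma differentiable_partial m (f : 'rV[R]_m -> R) (z : 'rV[R]_m) :
  (forall i, \forall y \near z, derivable f y (delta_mx 0 i)) ->
  (forall i, {for z, continuous (fun y => 'D_(delta_mx 0 i) f y)}) ->
  differentiable f z /\
  forall v, 'd f z v = \sum_i v 0 i * 'D_(delta_mx 0 i) f z.
Proof.
move=> df cf.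
pose L (v : 'rV[R]_m) : R := \sum_i v 0 i * 'D_(delta_mx 0 i) f z.
have Llin : linear L.
  move=> k u v; rewrite /L scaler_sumr -big_split /=; apply: eq_bigr => i _.
  by rewrite !mxE mulrDl -[k *: _]/(k * _) mulrA.
pose LM := GRing.isLinear.Build _ _ _ _ _ Llin.
pose LL : {linear 'rV[R]_m -> R^o} := HB.pack L LM.
suff [] : differentiable f z /\ 'd f z = LL :> (_ -> _).
  by move=> d e; split => // v; rewrite e.
apply: is_diff_eps => e e0.
have e1 : 0 < e / (m.+1)%:R by rewrite divr_gt0.
have /filter_forall H : forall i : 'I_m, \forall y \near z, derivable f y (delta_mx 0 i) /\
    `|'D_(delta_mx 0 i) f z - 'D_(delta_mx 0 i) f y| <= e / (m.+1)%:R.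
  move=> i; apply: filterI; first exact: df.
  by have /cvgrPdist_le := cf i; apply.
have /nbhs_ballP[r /= r0 Hr] := H.
near=> h.
have hr : `|h| < r.
  near: h. exact: (@nbhs0_lt R 'rV[R]_m r r0).
pose hk k : 'rV[R]_m := \row_j (if (j < k)%N then h 0 j else 0).
have E0 : hk 0%N = 0 by apply/rowP => j; rewrite !mxE.
have Em : hk m = h by apply/rowP => j; rewrite !mxE ltn_ord.
have S : f (h + z) - f z = \sum_(i < m) (f (hk i.+1 + z) - f (hk i + z)).
  rewrite -(big_mkord xpredT (fun i => f (hk i.+1 + z) - f (hk i + z))).
  by rewrite telescope_sumr // Em E0 add0r.
rewrite S /L -sumrB.
apply: (@le_trans _ _ (\sum_(i < m) (e / (m.+1)%:R * `|h|))); last first.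
  rewrite sumr_const card_ord -[leLHS]mulr_natr mulrAC ler_wpM2r //.
  by rewrite -mulrA ler_piMr ?(ltW e0) // mulrC ler_pdivrMr // mul1r ler_nat.
apply: le_trans (ler_norm_sum _ _ _) _; apply: ler_sum => i _.
have Ei : hk i.+1 = h 0 i *: delta_mx 0 i + hk i.
  apply/rowP => j; rewrite !mxE eqxx ltnS leq_eqVlt andTb.
  have [/eqP/val_inj->|ne] := boolP (val j == val i).
    by rewrite !eqxx ltnn mulr1 addr0.
  by rewrite (_ : (j == i) = false) ?mulr0 ?add0r //; apply/negbTE.
have inb (s : R) : 0 <= s <= 1 -> `|s *: (h 0 i *: delta_mx 0 i) + hk i| <= `|h|.
  move=> /andP[s0 s1]; apply: mx_norm_leP => // a j; rewrite !mxE (ord1 a) eqxx andTb.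
  have [->|ne] := eqVneq j i.
    rewrite ltnn addr0 mulr1 normrM (ger0_norm s0).
    by apply: le_trans (ler_piMl _ s1) (coord_le_norm _ _ _).
  rewrite !mulr0 add0r; case: ifP => _; rewrite ?normr0 //.
  exact: coord_le_norm.
have Hs (s : R) : 0 <= s <= 1 -> ball z r (s *: (h 0 i *: delta_mx 0 i) + (hk i + z)).
  move=> hs; rewrite -ball_normE /= addrA opprD [_ - z]addrC addrA subrr add0r normrN.
  by apply: le_lt_trans hr; apply: inb.
case: (@mvt_line _ f (hk i + z) (h 0 i *: delta_mx 0 i)).
  by move=> s /Hs /Hr /(_ i) [d _]; have [] := derivable_scale (h 0 i) d.
move=> s /Hs /Hr /(_ i) [d dl]; rewrite addrA -Ei => ->.
have [_ ->] := derivable_scale (h 0 i) d.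
rewrite -[_ *: _]/(_ * _) -mulrBr normrM mulrC distrC.
by apply: ler_pM => //; apply: coord_le_norm.
Unshelve. all: by end_near. Qed.

End Basics.

Lemma near_eq_continuous (T S : topologicalType) (f g : T -> S) (z : T) :
  (\near z, f z = g z) -> {for z, continuous f} -> {for z, continuous g}.
Proof.
move=> e cf; rewrite /prop_for /continuous_at -(nbhs_singleton e).
exact: cvg_trans (near_eq_cvg e) cf.
Qed.

(** * Calculus of C^k maps *)

Section CkTheory.
Context {R : realType} {m : nat}.
Implicit Types (U : set 'rV[R]_m) (k : nat).

Lemma Ck_sub (W : normedModType R) k U U' (f : 'rV[R]_m -> W) :
  U' `<=` U -> Ck k U f -> Ck k U' f.
Proof.
move=> s; elim: k f => [|k IH] f [cf h]; split=> //; try by move=> z /s; apply: cf.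
by move=> v; have [d c] := h v; split; [move=> z /s; apply: d|apply: IH].
Qed.

(** The derivatives in [Ck] are taken in the ambient space, so the predicate makes sense even on a
    single point. This allows smoothness on a large set to be proved with neighbourhoods that depend
    on the point and on [k]. *)
Lemma Ck_pointwise (W : normedModType R) k U (f : 'rV[R]_m -> W) :
  (forall z, U z -> Ck k [set z] f) -> Ck k U f.
Proof.
elim: k f => [|k IH] f h; split=> //.
- by move=> z /h[c _]; apply: c.
- by move=> z /h[c _]; apply: c.
move=> v; split; first by move=> z /h [_ /(_ v)[d _]]; apply: d.
by apply: IH => z /h [_ /(_ v)[_ d]].
Qed.

Lemma Ck_cont (W : normedModType R) k U (f : 'rV[R]_m -> W) z :
  Ck k U f -> U z -> {for z, continuous f}.
Proof. by case: k => [|k] [c _]; apply: c. Qed.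

Lemma Ck_derive (W : normedModType R) k U (f : 'rV[R]_m -> W) v :
  Ck k.+1 U f -> Ck k U (fun y => 'D_v f y).
Proof. by move=> [_ /(_ v)[]]. Qed.

Lemma Ck_derivable (W : normedModType R) k U (f : 'rV[R]_m -> W) v z :
  Ck k.+1 U f -> U z -> derivable f z v.
Proof. by move=> [_ /(_ v)[d _]]; apply: d. Qed.

Lemma CkS (W : normedModType R) k U (f : 'rV[R]_m -> W) : Ck k.+1 U f -> Ck k U f.
Proof.
elim: k f => [|k IH] f [c h]; split=> // v.
by have [d c'] := h v; split => //; apply: IH.
Qed.

Lemma Ck_le (W : normedModType R) k l U (f : 'rV[R]_m -> W) :
  (k <= l)%N -> Ck l U f -> Ck k U f.
Proof.
by move=> /subnK <-; elim: (l - k)%N => // i IH; rewrite addSn => /CkS.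
Qed.

(** Derivatives see a whole neighbourhood; openness of [U] turns equality on [U] into equality near
    each of its points. *)
Lemma Ck_eq (W : normedModType R) k U (f g : 'rV[R]_m -> W) : open U ->
  (forall z, U z -> f z = g z) -> Ck k U f -> Ck k U g.
Proof.
move=> oU; elim: k f g => [|k IH] f g e [c h].
  split=> // z Uz; apply: near_eq_continuous (c _ Uz).
  by apply: filterS (open_nbhs_nbhs (conj oU Uz)) => y /e.
have ne z : U z -> \near z, f z = g z.
  by move=> Uz; apply: filterS (open_nbhs_nbhs (conj oU Uz)) => y /e.
split=> [z Uz|v].
  by apply: near_eq_continuous (c _ Uz); apply: ne.
have [d c'] := h v; split.
  by move=> z Uz; apply: near_eq_derivable (d _ Uz); apply: ne.
by apply: IH c' => z Uz; apply: near_eq_derive; apply: ne.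
Qed.

Lemma Ck_cst (W : normedModType R) k U (a : W) : Ck k U (cst a).
Proof.
elim: k a => [|k IH] a; first by split=> // z _; exact: cst_continuous.
split=> [z _|v]; first exact: cst_continuous.
split; first by move=> z _; apply: derivable_cst.
rewrite (_ : (fun y => _) = cst 0); first exact: IH.
by apply: funext => y; rewrite derive_cst.
Qed.

Lemma Ck_add (W : normedModType R) k U (f g : 'rV[R]_m -> W) : open U ->
  Ck k U f -> Ck k U g -> Ck k U (fun z => f z + g z).
Proof.
move=> oU; elim: k f g => [|k IH] f g [cf hf] [cg hg].
  by split=> // z Uz; apply: continuousD; [apply: cf|apply: cg].
split=> [z Uz|v]; first by apply: continuousD; [apply: cf|apply: cg].
have [df cf'] := hf v; have [dg cg'] := hg v; split.
  by move=> z Uz; apply: derivableD; [apply: df|apply: dg].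
apply: (Ck_eq oU _ (IH _ _ cf' cg')) => z Uz.
by rewrite -deriveD //; [apply: df|apply: dg].
Qed.

Lemma Ck_mul k U (f g : 'rV[R]_m -> R) : open U ->
  Ck k U f -> Ck k U g -> Ck k U (fun z => f z * g z).
Proof.
move=> oU; elim: k f g => [|k IH] f g Cf Cg.
  split=> // z Uz; exact: (continuousM (Ck_cont Cf Uz) (Ck_cont Cg Uz)).
split=> [z Uz|v].
  exact: (continuousM (Ck_cont Cf Uz) (Ck_cont Cg Uz)).
have [_ /(_ v) [df cf']] := Cf; have [_ /(_ v) [dg cg']] := Cg; split.
  by move=> z Uz; apply: derivableM; [apply: df|apply: dg].
apply: (Ck_eq oU _ (Ck_add oU (IH _ _ (CkS Cf) cg') (IH _ _ (CkS Cg) cf'))) => z Uz /=.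
by rewrite (deriveM (df _ Uz) (dg _ Uz)).
Qed.

Lemma Ck_scale k U (a : R) (f : 'rV[R]_m -> R) : open U ->
  Ck k U f -> Ck k U (fun z => a * f z).
Proof. by move=> oU; apply: Ck_mul => //; apply: Ck_cst. Qed.

Lemma Ck_opp k U (f : 'rV[R]_m -> R) : open U ->
  Ck k U f -> Ck k U (fun z => - f z).
Proof.
move=> oU /(Ck_scale (-1) oU); apply: Ck_eq => // z _; exact: mulN1r.
Qed.

Lemma Ck_sum k U I (r : seq I) (P : pred I) (f : I -> 'rV[R]_m -> R) : open U ->
  (forall i, Ck k U (f i)) -> Ck k U (fun z => \sum_(i <- r | P i) f i z).
Proof.
move=> oU h; elim: r => [|i r IH].
  by apply: Ck_eq (Ck_cst k U (0 : R)) => // z _; rewrite big_nil.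
case Pi: (P i).
  by apply: Ck_eq (Ck_add oU (h i) IH) => // z _; rewrite big_cons Pi.
by apply: Ck_eq IH => // z _; rewrite big_cons Pi.
Qed.

Lemma Ck_prod k U I (r : seq I) (P : pred I) (f : I -> 'rV[R]_m -> R) : open U ->
  (forall i, Ck k U (f i)) -> Ck k U (fun z => \prod_(i <- r | P i) f i z).
Proof.
move=> oU h; elim: r => [|i r IH].
  by apply: Ck_eq (Ck_cst k U (1 : R)) => // z _; rewrite big_nil.
case Pi: (P i).
  by apply: Ck_eq (Ck_mul oU (h i) IH) => // z _; rewrite big_cons Pi.
by apply: Ck_eq IH => // z _; rewrite big_cons Pi.
Qed.

Lemma Ck_inv k U (f : 'rV[R]_m -> R) : open U ->
  (forall z, U z -> f z != 0) -> Ck k U f -> Ck k U (fun z => (f z)^-1).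
Proof.
move=> oU f0; elim: k => [|k IH] Cf.
  by split=> // z Uz; exact: (continuousV (f0 _ Uz) (Ck_cont Cf Uz)).
split=> [z Uz|v].
  exact: (continuousV (f0 _ Uz) (Ck_cont Cf Uz)).
have [_ /(_ v) [df cf']] := Cf; split.
  by move=> z Uz; exact: (derivableV (f0 _ Uz) (df _ Uz)).
have Ci := IH (CkS Cf).
apply: Ck_eq (Ck_opp oU (Ck_mul oU (Ck_mul oU Ci Ci) cf')) => // z Uz.
rewrite (deriveV (f0 _ Uz) (df _ Uz)) -[_ *: _]/(_ * _) mulNr.
by rewrite expr2 invfM.
Qed.

Lemma Ck_mxP p q k U (f : 'rV[R]_m -> 'M[R]_(p, q)) : open U ->
  Ck k U f <-> (forall i j, Ck k U (fun z => f z i j)).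
Proof.
move=> oU; elim: k f => [|k IH] f.
  split=> [[c _] i j|h]; (split; last exact: I) => z Uz.
    exact: (@continuous_comp _ _ _ f (fun M : 'M[R]_(p, q) => M i j) z (c z Uz) (@coord_continuous _ _ _ i j (f z))).
  have c i j := Ck_cont (h i j) Uz.
  apply/(@cvgrPdist_le R 'M[R]_(p, q) 'rV[R]_m (nbhs z)) => e e0.
  have /filter_forall H' : forall ij : 'I_p * 'I_q, \forall y \near z, `|f z ij.1 ij.2 - f y ij.1 ij.2| <= e.
    by move=> [i j]; have /cvgrPdist_le/(_ e e0) := c i j.
  near=> y; apply: mx_norm_leP => [|i j]; first exact: ltW.
  rewrite !mxE.
  have : forall ij : 'I_p * 'I_q, `|f z ij.1 ij.2 - f y ij.1 ij.2| <= e by near: y.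
  by move=> /(_ (i, j)).
split=> [[c h] i j|h].
  split=> [z Uz|v].
    exact: (@continuous_comp _ _ _ f (fun M : 'M[R]_(p, q) => M i j) z (c z Uz) (@coord_continuous _ _ _ i j (f z))).
  have [d c'] := h v; split.
    by move=> z Uz; have /derivable_mxP := d z Uz; apply.
  apply: (Ck_eq oU _ (((IH _).1 c') i j)) => z Uz.
  by rewrite (derive_mx (d z Uz)) mxE.
split=> [z Uz|v].
  have /Ck_cont : Ck k U f by apply/IH => i j; apply/CkS.
  exact.
have d z : U z -> derivable f z v.
  by move=> Uz; apply/derivable_mxP => i j; apply: Ck_derivable (h i j) Uz.
split=> //; apply/IH => i j.
apply: Ck_eq (Ck_derive v (h i j)) => // z Uz.
by rewrite (derive_mx (d z Uz)) mxE.
Unshelve. all: by end_near. Qed.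

Lemma Ck1_diff U (f : 'rV[R]_m -> R) z : open U -> Ck 1 U f -> U z ->
  differentiable f z.
Proof.
move=> oU C Uz; have [] // := @differentiable_partial R m f z.
  move=> i; apply: filterS (open_nbhs_nbhs (conj oU Uz)) => y Uy.
  exact: Ck_derivable C Uy.
by move=> i; apply: Ck_cont (Ck_derive _ C) Uz.
Qed.

Lemma differentiable_mxP p q (f : 'rV[R]_m -> 'M[R]_(p, q)) z :
  (forall i j, differentiable (fun z => f z i j) z) -> differentiable f z.
Proof.
move=> d.
pose L (v : 'rV[R]_m) : 'M[R]_(p, q) := \matrix_(i, j) 'd (fun z => f z i j) z v.
have Llin : linear L.
  by move=> k u v; apply/matrixP => i j; rewrite !mxE linearP.
pose LM := GRing.isLinear.Build _ _ _ _ _ Llin.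
pose LL : {linear 'rV[R]_m -> 'M[R]_(p, q)} := HB.pack L LM.
suff [] : differentiable f z /\ 'd f z = LL :> (_ -> _) by [].
apply: is_diff_eps => e e0.
have /filter_forall H : forall ij : 'I_p * 'I_q, \forall h \near (0 : 'rV[R]_m),
   `|f (h + z) ij.1 ij.2 - f z ij.1 ij.2 - 'd (fun z => f z ij.1 ij.2) z h| <= e * `|h|.
  move=> [i j] /=; have /diff_locally/eqaddoP/(_ e e0) := d i j.
  by apply: filterS => h; rewrite !fctE /= opprD addrA.
apply: filterS H => h H; apply: mx_norm_leP => [|i j].
  by rewrite mulr_ge0 // ltW.
by rewrite !mxE; apply: (H (i, j)).
Qed.

Lemma Ck1_diff_mx p q U (f : 'rV[R]_m -> 'M[R]_(p, q)) z : open U -> Ck 1 U f -> U z ->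
  differentiable f z.
Proof.
move=> oU C Uz; apply: differentiable_mxP => i j.
apply: (Ck1_diff oU _ Uz); exact: ((Ck_mxP _ _ oU).1 C).
Qed.

Lemma derive_partial (f : 'rV[R]_m -> R) z v : differentiable f z ->
  'D_v f z = \sum_i v 0 i * 'D_(delta_mx 0 i) f z.
Proof.
move=> d; rewrite deriveE // {1}(row_coord_sum v) linear_sum.
by apply: eq_bigr => i _; rewrite linearZ deriveE.
Qed.

Lemma deriveDl (W : normedModType R) (f : 'rV[R]_m -> W) z u v : differentiable f z ->
  'D_(u + v) f z = 'D_u f z + 'D_v f z.
Proof. by move=> d; rewrite !deriveE // linearD. Qed.

Lemma deriveZl (W : normedModType R) (f : 'rV[R]_m -> W) z (a : R) v : differentiable f z ->
  'D_(a *: v) f z = a *: 'D_v f z.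
Proof. by move=> d; rewrite !deriveE // linearZ. Qed.

End CkTheory.

Lemma is_derive_curve {R : realType} m (W : normedModType R) (f : 'rV[R]_m -> W)
    (c : R -> 'rV[R]_m) (t : R) (dc : 'rV[R]_m) :
  differentiable f (c t) -> is_derive t 1 c dc ->
  is_derive t 1 (f \o c) ('D_dc f (c t)).
Proof.
move=> df [dc1 <-].
have dc2 : differentiable c t by apply/derivable1_diffP.
have dfc : differentiable (f \o c) t by apply: differentiable_comp.
apply: DeriveDef; first by apply/derivable1_diffP.
by rewrite (deriveE _ dfc) diff_comp //= (deriveE _ df) (deriveE _ dc2).
Qed.

Lemma derive_comp_rV {R : realType} m p (W : normedModType R) (f : 'rV[R]_m -> 'rV[R]_p)
    (g : 'rV[R]_p -> W) z v :
  differentiable f z -> differentiable g (f z) ->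
  'D_v (g \o f) z = 'D_('D_v f z) g (f z).
Proof.
move=> df dg; have dgf : differentiable (g \o f) z by apply: differentiable_comp.
rewrite (deriveE v df) (deriveE ('d f z v) dg) (deriveE v dgf).
by have := @diff_comp R _ _ _ f g z df dg => ->.
Qed.

Lemma Ck_comp {R : realType} m p k (U : set 'rV[R]_m) (U' : set 'rV[R]_p)
    (f : 'rV[R]_m -> 'rV[R]_p) (g : 'rV[R]_p -> R) :
  open U -> open U' -> (forall z, U z -> U' (f z)) ->
  Ck k U f -> Ck k U' g -> Ck k U (g \o f).
Proof.
move=> oU oU' s; elim: k g => [|k IH] g Cf Cg.
  split=> // z Uz; apply: continuous_comp; first exact: Ck_cont Cf Uz.
  by apply: Ck_cont Cg _; apply: s.
have Cf1 := Ck_le (ltn0Sn k) Cf; have Cg1 := Ck_le (ltn0Sn k) Cg.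
split=> [z Uz|v].
  apply: continuous_comp; first exact: Ck_cont Cf Uz.
  by apply: Ck_cont Cg _; apply: s.
split=> [z Uz|].
  apply: diff_derivable; apply: differentiable_comp; first exact: Ck1_diff_mx oU Cf1 Uz.
  by exact: Ck1_diff oU' Cg1 (s _ Uz).
(* The chain rule in coordinates: the induction hypothesis applies to the partial derivatives of
   [g], which is why [g] is generalized in the induction. *)
have H : Ck k U (fun z => \sum_i ('D_v f z) 0 i * ((fun y => 'D_(delta_mx 0 i) g y) \o f) z).
  apply: Ck_sum => // i; apply: Ck_mul => //.
    by exact: ((Ck_mxP _ _ oU).1 (Ck_derive v Cf)).
  by apply: IH; [apply: CkS|apply: Ck_derive].
apply: Ck_eq H => // z Uz.
have dg := Ck1_diff oU' Cg1 (s _ Uz).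
by rewrite (derive_comp_rV v (Ck1_diff_mx oU Cf1 Uz) dg) (derive_partial _ dg).
Qed.

Lemma Ck_comp_mx {R : realType} m p k (U : set 'rV[R]_m) (U' : set 'rV[R]_p) a b
    (f : 'rV[R]_m -> 'rV[R]_p) (g : 'rV[R]_p -> 'M[R]_(a, b)) :
  open U -> open U' -> (forall z, U z -> U' (f z)) ->
  Ck k U f -> Ck k U' g -> Ck k U (g \o f).
Proof.
move=> oU oU' s Cf Cg; apply/(Ck_mxP _ _ oU) => i j.
exact: (Ck_comp oU oU' s Cf ((Ck_mxP _ _ oU').1 Cg i j)).
Qed.

Lemma Ck_linear {R : realType} m (W : normedModType R) k (U : set 'rV[R]_m)
    (L : {linear 'rV[R]_m -> W}) : Ck k U L.
Proof.
have Lc := linear_rV_continuous (L := L).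
have d z : differentiable L z by apply: linear_differentiable.
case: k => [|k]; first by split=> // z _; exact: Lc.
split=> [z _|v]; first exact: Lc.
split; first by move=> z _; apply: diff_derivable.
rewrite (_ : (fun y => _) = cst (L v)); first exact: Ck_cst.
by apply: funext => y; rewrite deriveE // diff_lin.
Qed.

Lemma dist_half {R : realType} (W : normedModType R) (a b c : W) (e : R) :
  `|a - c| <= e / 2 -> `|b - c| <= e / 2 -> `|a - b| <= e.
Proof.
rewrite [`|b - c|]distrC => h1 h2; rewrite -(subrK c a) -addrA (splitr e).
by apply: le_trans (ler_normD _ _) _; apply: lerD.
Qed.

(** * Symmetry of second derivatives *)

Section Schwarz.
Context {R : realType} {m : nat}.
Implicit Types (U : set 'rV[R]_m) (z u v w : 'rV[R]_m).

(** The mean value theorem applied twice: to [f (v + x) - f x] in the direction [u], then to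
    ['D_u f] in the direction [v]. *)
Lemma second_difference U (f : 'rV[R]_m -> R) z u v : open U -> Ck 2 U f ->
  (forall y, `|y - z| <= `|u| + `|v| -> U y) ->
  exists2 y, `|y - z| <= `|u| + `|v| &
    f (u + v + z) - f (u + z) - f (v + z) + f z = 'D_v (fun x => 'D_u f x) y.
Proof.
move=> oU C B.
have C1 : Ck 1 U f by apply: CkS.
have in1 (s t : R) : 0 <= s <= 1 -> 0 <= t <= 1 -> `|t *: v + (s *: u + z) - z| <= `|u| + `|v|.
  move=> /andP[s0 s1] /andP[t0 t1]; rewrite addrA addrK addrC.
  apply: le_trans (ler_normD _ _) _; rewrite !normrZ !ger0_norm //.
  by apply: lerD; apply: ler_piMl.
have dv (s : R) : 0 <= s <= 1 -> derivable (fun x => f (v + x)) (s *: u + z) u.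
  move=> hs; apply: diff_derivable.
  have /(Ck1_diff oU C1) d : U (v + (s *: u + z)).
    by apply: B; rewrite -{1}(scale1r v); apply: in1; rewrite ?ler01 ?lexx.
  apply: (@differentiable_comp _ _ _ _ (fun x => v + x) f) => //.
have du (s : R) : 0 <= s <= 1 -> derivable f (s *: u + z) u.
  move=> hs; apply: (Ck_derivable C1 (B _ _)).
  by rewrite -{1}[s *: u + z]add0r -(scale0r v); apply: in1; rewrite ?ler01 ?lexx.
have [s hs Es] := mvt_line (f := fun x => f (v + x) - f x) (z := z) (v := u)
   (fun s hs => derivableB (dv s hs) (du s hs)).
have [t ht Et] := mvt_line (f := fun x => 'D_u f x) (z := s *: u + z) (v := v)
  (fun t ht => Ck_derivable (Ck_derive u C) (B _ (in1 s t hs ht))).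
exists (t *: v + (s *: u + z)); first exact: in1 hs ht.
rewrite -Et; have := Es; rewrite (deriveB (dv s hs) (du s hs)).
have -> : 'D_u (fun x => f (v + x)) (s *: u + z) = 'D_u f (v + (s *: u + z)).
  have E : (fun h : R => h^-1 *: (f (v + (h *: u + (s *: u + z))) - f (v + (s *: u + z)))) =
      (fun h : R => h^-1 *: (f (h *: u + (v + (s *: u + z))) - f (v + (s *: u + z)))).
    by apply: funext => h; rewrite addrCA.
  by rewrite /derive /= E.
by move=> <-; rewrite addrA [v + u]addrC; ring.
Qed.

(** The second difference is symmetric in [u] and [v], so the two mixed derivatives agree at two
    points near [z]; continuity at [z] gives equality up to any [e]. *)
Lemma schwarz U (f : 'rV[R]_m -> R) z u v : open U -> Ck 2 U f -> U z ->
  'D_v (fun x => 'D_u f x) z = 'D_u (fun x => 'D_v f x) z.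
Proof.
move=> oU C Uz; apply/eqP; rewrite -subr_eq0 -normr_le0; apply/ler_addgt0Pr => e e0; rewrite add0r.
have c1 : {for z, continuous (fun x => 'D_v (fun x => 'D_u f x) x)}.
  by apply: Ck_cont (Ck_derive v (Ck_derive u C)) Uz.
have c2 : {for z, continuous (fun x => 'D_u (fun x => 'D_v f x) x)}.
  by apply: Ck_cont (Ck_derive u (Ck_derive v C)) Uz.
have e2 : 0 < e / 2 by rewrite divr_gt0.
have H : nbhs z (U `&` ([set y | `|'D_v (fun x => 'D_u f x) z - 'D_v (fun x => 'D_u f x) y| <= e / 2]
    `&` [set y | `|'D_u (fun x => 'D_v f x) z - 'D_u (fun x => 'D_v f x) y| <= e / 2])).
  apply: filterI; first exact: open_nbhs_nbhs.
  by apply: filterI; [exact: (continuous_near_le c1 e2)|exact: (continuous_near_le c2 e2)].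
have [r r0 {}H] := nbhs_norm_lt H.
(* The summand 1 keeps [d] positive when [u] and [v] both vanish. *)
pose d : R := `|u| + `|v| + 1.
have d0 : 0 < d by rewrite ltr_wpDl // addr_ge0.
have [h h0 hd] : exists2 h : R, 0 < h & `|h *: u| + `|h *: v| < r.
  exists (r / (2 * d)); first by rewrite divr_gt0 // mulr_gt0.
  rewrite [X in X + _]normrZ [X in _ + X]normrZ gtr0_norm ?divr_gt0 ?mulr_gt0 // -mulrDr.
  apply: (@le_lt_trans _ _ (r / (2 * d) * d)).
    by rewrite ler_wpM2l ?lerDl // ltW // divr_gt0 ?mulr_gt0.
  by rewrite invfM mulrA -mulrA mulVf ?gt_eqF // mulr1 ltr_pdivrMr // ltr_pMr // ltr1n.
have B (y : 'rV[R]_m) : `|y - z| <= `|h *: u| + `|h *: v| -> U y.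
  by move=> yr; have [] := H y (le_lt_trans yr hd).
have B' (y : 'rV[R]_m) : `|y - z| <= `|h *: v| + `|h *: u| -> U y.
  by rewrite [X in _ <= X]addrC; apply: B.
have [y hy Ey] := second_difference oU C B.
have [y' hy' Ey'] := second_difference oU C B'.
have sc (a b x : 'rV[R]_m) : U x -> 'D_(h *: a) (fun x => 'D_(h *: b) f x) x =
     h * (h * 'D_a (fun x => 'D_b f x) x).
  move=> Ux.
  have C1 : Ck 1 U f by apply: CkS.
  have d1 := Ck1_diff oU (Ck_derive b C) Ux.
  rewrite (@near_eq_derive _ _ _ _ (fun x => h *: 'D_b f x)).
    by apply: etrans (deriveZ h (diff_derivable d1)) _; rewrite (deriveZl h a d1).
  apply: filterS (open_nbhs_nbhs (conj oU Ux)) => x' Ux'.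
  by rewrite (deriveZl h b (Ck1_diff oU C1 Ux')).
have Ee : 'D_v (fun x => 'D_u f x) y = 'D_u (fun x => 'D_v f x) y'.
  have h1 : h != 0 by rewrite gt_eqF.
  apply: (mulfI h1); apply: (mulfI h1).
  apply: etrans (esym (sc v u y (B y hy))) _; apply: etrans _ (sc u v y' (B' y' hy')).
  by apply: etrans (esym Ey) _; apply: etrans _ Ey'; rewrite [h *: v + h *: u]addrC; ring.
have [_ [a1 _]] := H y (le_lt_trans hy hd).
have hd' : `|h *: v| + `|h *: u| < r by rewrite addrC.
have [_ [_ a2]] := H y' (le_lt_trans hy' hd').
by apply: dist_half a1 _; rewrite Ee; exact: a2.
Qed.

End Schwarz.

(** * The inverse function theorem *)

#[local] Opaque derive.

Section MeanValue.
Context {R : realType}.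

(** In the maximum norm every coordinate is estimated separately, so the scalar mean value theorem
    loses no constant. *)
Lemma mean_value_le m p (f : 'rV[R]_m -> 'rV[R]_p) (U : set 'rV[R]_m) (x y : 'rV[R]_m) (K : R) :
  0 <= K ->
  (forall s : R, 0 <= s <= 1 -> U (s *: (y - x) + x)) ->
  (forall z v, U z -> derivable f z v /\ `|'D_v f z| <= K * `|v|) ->
  `|f y - f x| <= K * `|y - x|.
Proof.
move=> K0 sU df; apply: mx_norm_leP => [|i j]; first by rewrite mulr_ge0.
have d (s : R) : 0 <= s <= 1 -> derivable (fun z => f z i j) (s *: (y - x) + x) (y - x).
  by move=> /sU /(df _ (y - x))[/derivable_mxP dd _]; apply: dd.
have [s hs] := mvt_line d; rewrite subrK !mxE => ->.
have [dd le] := df _ (y - x) (sU s hs).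
apply: le_trans le; apply: le_trans (coord_le_norm _ i j).
by rewrite (derive_mx dd) mxE.
Qed.

Lemma ball_segment m (z x y : 'rV[R]_m) (r s : R) : `|x - z| < r -> `|y - z| < r ->
  0 <= s <= 1 -> `|s *: (y - x) + x - z| < r.
Proof.
move=> hx hy /andP[s0 s1].
have -> : s *: (y - x) + x - z = s *: (y - z) + (1 - s) *: (x - z).
  by apply/rowP => j; rewrite !mxE; ring.
have s1' : 0 <= 1 - s by rewrite subr_ge0.
apply: le_lt_trans (ler_normD _ _) _; rewrite [X in X + _]normrZ [X in _ + X]normrZ !ger0_norm //.
have [->|sn0] := eqVneq s 0; first by rewrite mul0r add0r subr0 mul1r.
have -> : r = s * r + (1 - s) * r by ring.
apply: ltr_leD; first by rewrite ltr_pM2l // lt_neqAle eq_sym sn0.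
by rewrite ler_wpM2l // ltW.
Qed.

Lemma mulmx_bound m p (A : 'M[R]_(m, p)) :
  exists2 K : R, 0 < K & forall v : 'rV[R]_m, `|v *m A| <= K * `|v|.
Proof.
have lA : linear (fun v : 'rV[R]_m => v *m A) by move=> k u v; rewrite mulmxDl scalemxAl.
pose LM := GRing.isLinear.Build _ _ _ _ _ lA.
pose L : {linear 'rV[R]_m -> 'rV[R]_p} := HB.pack (fun v : 'rV[R]_m => v *m A) LM.
exact: (linear_lipschitz (linear_rV_continuous (L := L))).
Qed.

Lemma Ck_mulmx m k (U : set 'rV[R]_m) p q l (f : 'rV[R]_m -> 'M[R]_(p, q)) (g : 'rV[R]_m -> 'M[R]_(q, l)) :
  open U -> Ck k U f -> Ck k U g -> Ck k U (fun z => f z *m g z).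
Proof.
move=> oU /(Ck_mxP _ _ oU) Cf /(Ck_mxP _ _ oU) Cg; apply/(Ck_mxP _ _ oU) => i j.
apply: (Ck_eq oU _ (Ck_sum (index_enum _) xpredT oU (fun s => Ck_mul oU (Cf i s) (Cg s j)))) => z Uz.
by rewrite mxE.
Qed.

Lemma Ck_det m k (U : set 'rV[R]_m) p (f : 'rV[R]_m -> 'M[R]_p) :
  open U -> Ck k U f -> Ck k U (fun z => \det (f z)).
Proof.
move=> oU /(Ck_mxP _ _ oU) Cf.
exact: (Ck_sum (index_enum _) xpredT oU (fun s => Ck_scale ((-1) ^+ odd_perm s) oU
  (Ck_prod (index_enum _) xpredT oU (fun i => Cf i (s i))))).
Qed.

(** Cramer's rule: the entries are cofactors divided by the determinant. *)
Lemma Ck_invmx m k (U : set 'rV[R]_m) p (f : 'rV[R]_m -> 'M[R]_p) : open U ->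
  (forall z, U z -> f z \in unitmx) -> Ck k U f -> Ck k U (fun z => invmx (f z)).
Proof.
move=> oU un Cf; have Cf' := (Ck_mxP _ _ oU).1 Cf; apply/(Ck_mxP _ _ oU) => i j.
have H : Ck k U (fun z => (\det (f z))^-1 * ((-1) ^+ (j + i) * \det (row' j (col' i (f z))))).
  apply: Ck_mul => //.
    by apply: Ck_inv => //; [move=> z /un; rewrite unitmxE unitfE|apply: Ck_det].
  apply: Ck_scale => //; apply: Ck_det => //; apply/(Ck_mxP _ _ oU) => a b.
  by apply: Ck_eq (Cf' (lift j a) (lift i b)) => // z _; rewrite !mxE.
by apply: Ck_eq H => // z Uz; rewrite /invmx un // !mxE.
Qed.

End MeanValue.

(** Completeness joined to the norm on matrices, as the Banach fixed point theorem below
    requires. *)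
HB.instance Definition _ (R : realType) (m n : nat) := Complete.on 'M[R]_(m, n).

Section InverseFunction.
Context {R : realType} {m : nat}.
Local Notation V := 'rV[R]_m.

Definition jac (f : V -> V) (z : V) : 'M[R]_m := \matrix_(i, j) ('D_(delta_mx 0 i) f z) 0 j.

Lemma deriveE_jac (f : V -> V) (z v : V) : differentiable f z -> 'D_v f z = v *m jac f z.
Proof.
move=> d; have -> : 'D_v f z = \sum_i v 0 i *: 'D_(delta_mx 0 i) f z.
  rewrite (deriveE v d) {1}(row_coord_sum v) linear_sum; apply: eq_bigr => i _.
  by rewrite linearZ /= (deriveE _ d).
apply/rowP => j; rewrite summxE mxE; apply: eq_bigr => i _.
by rewrite !mxE.
Qed.

Lemma Ck_jac k (U : set V) (f : V -> V) : open U -> Ck k.+1 U f -> Ck k U (jac f).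
Proof.
move=> oU Cf; apply/(Ck_mxP _ _ oU) => i j.
have /(Ck_mxP _ _ oU)/(_ 0 j) := Ck_derive (delta_mx 0 i) Cf.
by apply: Ck_eq => // z _; rewrite !mxE.
Qed.

(* For [y] near [f z0] the map [x |-> x - (f x - y) A^-1], [A] the Jacobian at [z0], is a contraction. *)
Lemma local_bijection (U : set V) (f : V -> V) (z0 : V) :
  open U -> U z0 -> Ck 1 U f -> (forall v, 'D_v f z0 = 0 -> v = 0) ->
  exists (N : set V) (K : R),
    [/\ open N, N z0, N `<=` U, open (f @` N) &
     [/\ 0 < K, forall x y, N x -> N y -> `|x - y| <= K * `|f x - f y| &
       forall x, N x -> jac f x \in unitmx]].
Proof.
move=> oU Uz0 Cf inj.
have df x : U x -> differentiable f x by move=> Ux; apply: Ck1_diff_mx oU Cf Ux.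
have inj_unit (A : 'M[R]_m) : (forall v : V, v *m A = 0 -> v = 0) -> A \in unitmx.
  by move=> h; rewrite -row_free_unit; apply/row_freeP; apply/row_freeP/inj_row_free.
have Au : jac f z0 \in unitmx.
  by apply: inj_unit => v; rewrite -deriveE_jac; [apply: inj|apply: df].
set A := jac f z0 in Au; set B := invmx A.
have AB : A *m B = 1%:M by apply: mulmxV.
have BA : B *m A = 1%:M by apply: mulVmx.
have [K K0 hK] := mulmx_bound B.
have cJ : {for z0, continuous (jac f)} by apply: Ck_cont (Ck_jac oU Cf) Uz0.
have cf : {for z0, continuous f} by apply: Ck_cont Cf Uz0.
(* Where the Jacobian is within [e] of [A], the derivative of [psi] has norm at most [K m e], hence
   at most 1/2. *)
pose e : R := (2 * (K * m.+1%:R))^-1.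
have e0 : 0 < e by rewrite invr_gt0 !mulr_gt0.
have H : nbhs z0 (U `&` [set x | `|A - jac f x| <= e]).
  by apply: filterI; [exact: open_nbhs_nbhs|exact: (continuous_near_le cJ e0)].
have [r r0 {}H] := nbhs_norm_lt H.
clearbody B A.
pose psi x : V := x - f x *m B.
have dpsi (x v : V) : `|x - z0| < r -> derivable psi x v /\ `|'D_v psi x| <= 2^-1 * `|v|.
  move=> /H[Ux Jx].
  have lB : linear (fun w : V => w *m B) by move=> k u w; rewrite mulmxDl scalemxAl.
  pose LM := GRing.isLinear.Build _ _ _ _ _ lB.
  pose L : {linear V -> V} := HB.pack (fun w : V => w *m B) LM.
  have dL y : differentiable L y by apply: linear_differentiable; apply: linear_rV_continuous.
  have dLf : differentiable (L \o f) x by apply: differentiable_comp; [apply: df|apply: dL].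
  have did : derivable (id : V -> V) x v by apply: derivable_id.
  have dv : 'D_v psi x = v - (v *m jac f x) *m B.
    apply: etrans (deriveB did (diff_derivable dLf)) _; congr (_ - _); first exact: derive_id.
    rewrite (derive_comp_rV v (df x Ux) (dL _)) (deriveE _ (dL _)) -(deriveE_jac v (df x Ux)).
    by have -> := diff_lin (f := L) (f x) (linear_rV_continuous (L := L)).
  split; first exact: (derivableB did (diff_derivable dLf)).
  have -> : 'D_v psi x = (v *m (A - jac f x)) *m B.
    by rewrite dv mulmxBr mulmxBl -(mulmxA v A) AB mulmx1.
  apply: le_trans (hK _) _.
  have : `|v *m (A - jac f x)| <= m.+1%:R * (e * `|v|).
    apply: mx_norm_leP => [|i j]; first by rewrite !mulr_ge0 // ltW.
    rewrite mxE; apply: le_trans (ler_norm_sum _ _ _) _.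
    apply: (@le_trans _ _ (\sum_(k < m) (e * `|v|))); last first.
      rewrite sumr_const card_ord -[leLHS]mulr_natl ler_wpM2r ?ler_nat //.
      by rewrite mulr_ge0 // ltW.
    apply: ler_sum => k _; rewrite normrM mulrC; apply: ler_pM => //.
      by apply: le_trans (coord_le_norm _ _ _) Jx.
    exact: coord_le_norm.
  move=> h; apply: le_trans (ler_wpM2l (ltW K0) h) _.
  suff -> : K * (m.+1%:R * (e * `|v|)) = 2^-1 * `|v| by [].
  have : (0 : R) < m.+1%:R by [].
  rewrite /e; move: (m.+1%:R : R) => M M0; field.
  by rewrite !gt_eqF.
have lpsi (x y : V) : `|x - z0| < r -> `|y - z0| < r -> `|psi y - psi x| <= 2^-1 * `|y - x|.
  move=> hx hy; apply: (@mean_value_le R m m psi [set w | `|w - z0| < r]) => //.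
  by move=> s; apply: ball_segment.
have expand (x y : V) : `|x - z0| < r -> `|y - z0| < r -> `|x - y| <= 2 * K * `|f x - f y|.
  move=> hx hy; have h1 := lpsi y x hy hx.
  have h2 : `|f x *m B - f y *m B| <= K * `|f x - f y| by rewrite -mulmxBl.
  have h3 : `|x - y| <= `|psi x - psi y| + `|f x *m B - f y *m B|.
    have -> : x - y = psi x - psi y + (f x *m B - f y *m B) by apply/rowP => j; rewrite /psi !mxE; ring.
    exact: ler_normD.
  by have := normr_ge0 (f x - f y); lra.
(* A target within [rho] of [f z0] shifts the fixed point map by at most [r / 8]; with contraction
   by 1/2 the closed ball of radius [r / 2] is mapped into itself. *)
pose rho : R := r / (8 * K).
have rho0 : 0 < rho by rewrite divr_gt0 // mulr_gt0.
(* Cutting with the preimage of a ball makes the image of [N] exactly that ball, hence open. *)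
pose N := [set x : V | `|x - z0| < r] `&` f @^-1` [set y | `|y - f z0| < rho].
have surj (y : V) : `|y - f z0| < rho -> exists2 x, `|x - z0| < r & f x = y.
  move=> hy; pose C := [set x : V | `|x - z0| <= r / 2].
  pose phi x : V := psi x + y *m B.
  have CB x : C x -> `|x - z0| < r by rewrite /C /= => h; apply: le_lt_trans h _; lra.
  have z0r : `|z0 - z0| < r by rewrite subrr normr0.
  have phiC : set_fun C C phi.
    move=> x Cx; rewrite /C /=.
    have -> : phi x - z0 = (psi x - psi z0) + (y - f z0) *m B.
      by apply/rowP => j; rewrite /phi /psi mulmxBl !mxE; ring.
    apply: le_trans (ler_normD _ _) _.
    have h1 := lpsi z0 x z0r (CB x Cx); have h2 := hK (y - f z0).
    have h3 : K * `|y - f z0| <= r / 8.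
      apply: le_trans (ler_wpM2l (ltW K0) (ltW hy)) _.
      suff -> : K * rho = r / 8 by [].
      by rewrite /rho; field; rewrite gt_eqF.
    have : `|x - z0| <= r / 2 := Cx.
    by lra.
  pose F : {fun C >-> C} := HB.pack phi (isFun.Build _ _ C C phi phiC).
  have ctr : is_contraction F.
    exists (2^-1)%:nng; split => /=; first by rewrite invf_lt1 // ltr1n.
    move=> [a b] /= [Ca Cb]; have := lpsi b a (CB _ Cb) (CB _ Ca).
    suff -> : psi a - psi b = F a - F b by [].
    by apply/rowP => j; rewrite -[F a]/(psi a + y *m B) -[F b]/(psi b + y *m B) !mxE; ring.
  have cC : closed C.
    have -> : C = closed_ball_ Num.norm z0 (r / 2).
      by apply/seteqP; split => x; rewrite /C /closed_ball_ /= distrC.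
    exact: closed_closed_ball_.
  have C0 : C !=set0 by exists z0; rewrite /C /= subrr normr0 divr_ge0 // ltW.
  have [x Cx Ex] := banach_fixed_point ctr cC C0.
  exists x; first exact: CB.
  have {}Ex : x = x - f x *m B + y *m B by exact: Ex.
  have : (f x - y) *m B = 0.
    by rewrite mulmxBl; apply/eqP; rewrite subr_eq0 -(inj_eq (addrI (x - f x *m B))) subrK -Ex.
  move=> /(congr1 (mulmx^~ A)); rewrite mul0mx -mulmxA BA mulmx1 => /eqP.
  by rewrite subr_eq0 => /eqP.
exists N, (2 * K); split.
- rewrite openE => x [/= x1 x2].
  have Ux := (H _ x1).1.
  have c : {for x, continuous f} by apply: Ck_cont Cf Ux.
  have d0 : 0 < (rho - `|f x - f z0|) / 2 by rewrite divr_gt0 // subr_gt0.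
  have Hx := continuous_near_le c d0.
  have [d1 d10 {}Hx] := nbhs_norm_lt Hx.
  apply: (@norm_lt_nbhs R _ x _ (Num.min d1 (r - `|x - z0|))).
    by rewrite lt_min d10 subr_gt0.
  move=> y; rewrite lt_min => /andP[y1 y2]; split => /=.
    by have := ler_distD x y z0; lra.
  have := Hx _ y1; have := ler_distD (f x) (f y) (f z0); rewrite [`|f y - f x|]distrC.
  by move: (`|f y - f z0|) (`|f x - f z0|) (`|f x - f y|) x2 d0 => a b c' ? ? ? ?; lra.
- by split => /=; rewrite subrr normr0.
- by move=> x [/H[]].
- have -> : f @` N = ball (f z0) rho.
    rewrite -ball_normE; apply/seteqP; split=> [_ [x [/= _ h] <-] /=|y /=]; first by rewrite distrC.
    rewrite distrC => /[dup] hy /surj[x hx fx]; exists x => //; split => //=; by rewrite fx.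
  exact: ball_open.
split; first by rewrite mulr_gt0.
  by move=> x y [x1 _] [y1 _]; apply: expand.
move=> x [/= x1 _]; have [Ux Jx] := H _ x1.
apply: inj_unit => v vJ; have [_] := dpsi x v x1.
have dd := df x Ux.
have E1 : 'D_v psi x = v.
  have lB : linear (fun w : V => w *m B) by move=> k u w; rewrite mulmxDl scalemxAl.
  pose LM := GRing.isLinear.Build _ _ _ _ _ lB.
  pose L : {linear V -> V} := HB.pack (fun w : V => w *m B) LM.
  have dL y : differentiable L y by apply: linear_differentiable; apply: linear_rV_continuous.
  have dLf : differentiable (L \o f) x by apply: differentiable_comp; [apply: dd|apply: dL].
  have did : derivable (id : V -> V) x v by apply: derivable_id.
  apply: etrans (deriveB did (diff_derivable dLf)) _.
  rewrite (derive_comp_rV v dd (dL _)) (deriveE_jac v dd) vJ derive0 subr0.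
  exact: derive_id.
rewrite E1 => h; apply/eqP; rewrite -normr_eq0 eq_le normr_ge0 andbT.
by have := normr_ge0 v; lra.
Qed.

End InverseFunction.

Section InverseFunctionSmooth.
Context {R : realType} {m : nat}.
Local Notation V := 'rV[R]_m.

Lemma differentiable_jac_le (f : V -> V) (z : V) (e : R) : differentiable f z -> 0 < e ->
  exists2 r : R, 0 < r & forall k, `|k| < r -> `|f (k + z) - f z - k *m jac f z| <= e * `|k|.
Proof.
move=> d e0; have /diff_locally/eqaddoP/(_ e e0)/nbhs_norm_lt[r r0 H] := d.
exists r => // k kr; have := H k; rewrite subr0 => /(_ kr).
rewrite !fctE /= opprD addrA -(deriveE k d).
by have -> := deriveE_jac k d.
Qed.

(** The linearization error of [f] at [x0], multiplied by the inverse Jacobian, is the error of [g].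
    The Lipschitz bound for the inverse turns an error small relative to [x - x0] into one small
    relative to the increment of the value. *)
Lemma is_diff_inverse (N : set V) (f g : V -> V) (K : R) (x0 : V) :
  open (f @` N) -> N x0 -> 0 < K ->
  (forall x y, N x -> N y -> `|x - y| <= K * `|f x - f y|) ->
  (forall x, N x -> g (f x) = x) -> differentiable f x0 -> jac f x0 \in unitmx ->
  differentiable g (f x0) /\ forall v, 'D_v g (f x0) = v *m invmx (jac f x0).
Proof.
move=> oN Nx K0 lip gf df Ju; set J := jac f x0 in Ju *; set B := invmx J.
have JB : J *m B = 1%:M by apply: mulmxV.
have lB : linear (fun w : V => w *m B) by move=> k u w; rewrite mulmxDl scalemxAl.
pose LM := GRing.isLinear.Build _ _ _ _ _ lB.
pose L : {linear V -> V} := HB.pack (fun w : V => w *m B) LM.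
have [K1 K10 hK1] := mulmx_bound B.
suff [dg Eg] : differentiable g (f x0) /\ 'd g (f x0) = L :> (_ -> _).
  by split => // v; rewrite (deriveE v dg) Eg.
apply: is_diff_eps => e e0.
have e1 : 0 < e / (K1 * K) by rewrite divr_gt0 // mulr_gt0.
have [r r0 Hr] := differentiable_jac_le df e1.
have fN : nbhs (f x0) (f @` N) by apply: open_nbhs_nbhs; split => //; exists x0.
have [s s0 Hs] := nbhs_norm_lt fN.
apply: (@norm_lt_nbhs R _ 0 _ (Num.min s (r / K))).
  by rewrite lt_min s0 divr_gt0.
move=> h; rewrite subr0 lt_min => /andP[hs hr].
have [|x Nx1 fx] := Hs (h + f x0); first by rewrite addrK.
have hk : `|x - x0| <= K * `|h| by have := lip x x0 Nx1 Nx; rewrite fx addrK.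
have kr : `|x - x0| < r.
  by apply: le_lt_trans hk _; rewrite mulrC -ltr_pdivlMr.
have := Hr _ kr; rewrite subrK fx addrK -/J => Hk.
rewrite -[L h]/(h *m B) -fx (gf x Nx1) (gf x0 Nx).
have -> : x - x0 - h *m B = - ((h - (x - x0) *m J) *m B).
  by rewrite mulmxBl -[_ *m J *m B]mulmxA JB mulmx1 opprB.
rewrite normrN; apply: le_trans (hK1 _) _.
apply: le_trans (ler_wpM2l (ltW K10) Hk) _.
apply: le_trans (_ : K1 * (e / (K1 * K) * (K * `|h|)) <= _).
  by rewrite ler_pM2l // ler_pM2l.
suff -> : K1 * (e / (K1 * K) * (K * `|h|)) = e * `|h| by [].
by field; rewrite !gt_eqF.
Qed.

(** [N] and [g] are chosen before [k], so that one local inverse has every order of smoothness that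
    [f] has. *)
Theorem inverse_function (U : set V) (f : V -> V) (z0 : V) :
  open U -> U z0 -> Ck 1 U f -> (forall v, 'D_v f z0 = 0 -> v = 0) ->
  exists (N : set V) (g : V -> V),
    [/\ open N, N z0, N `<=` U, open (f @` N) &
     (forall x, N x -> g (f x) = x) /\
     forall k, Ck k.+1 U f -> Ck k.+1 (f @` N) g].
Proof.
move=> oU Uz0 Cf inj.
have [N [K [oN Nz NU ofN [K0 lip Ju]]]] := local_bijection oU Uz0 Cf inj.
have finj x y : N x -> N y -> f x = f y -> x = y.
  move=> Nx Ny e; have := lip x y Nx Ny; rewrite e subrr normr0 mulr0 normr_le0.
  by rewrite subr_eq0 => /eqP.
have /choice[g gP] : forall y, exists x, (f @` N) y -> N x /\ f x = y.
  move=> y; have [[x Nx fx]|ny] := pselect ((f @` N) y); first by exists x.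
  by exists z0 => /ny.
have gf x : N x -> g (f x) = x.
  move=> Nx; have [|h1 h2] := gP (f x); first by exists x.
  exact: finj.
exists N, g; split => //; split => // k Ck1.
have D y : (f @` N) y -> differentiable g y /\ forall v, 'D_v g y = v *m invmx (jac f (g y)).
  move=> [x Nx <-]; rewrite gf //.
  by apply: (is_diff_inverse ofN Nx K0 lip gf _ (Ju x Nx)); apply: Ck1_diff_mx oU Cf (NU x Nx).
have C0 : Ck 0 (f @` N) g.
  by split => // y /D[d _]; apply: differentiable_continuous.
have gN y : (f @` N) y -> N (g y) by move=> [x Nx <-]; rewrite gf.
(* Bootstrapping: the derivative of [g] is the inverse matrix of [jac f] composed with [g], so [g]
   gains one order as long as [f] has it. *)
have step i : (i <= k)%N -> Ck i (f @` N) g -> Ck i.+1 (f @` N) g.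
  move=> ik Ci; split=> [y /D[d _]|v]; first exact: differentiable_continuous.
  split=> [y /D[d _]|]; first exact: diff_derivable.
  have CJ : Ck i (f @` N) (jac f \o g).
    have := Ck_sub NU (Ck_le (ik : (i.+1 <= k.+1)%N) Ck1) => CN.
    exact: Ck_comp_mx ofN oN gN Ci (Ck_jac oN CN).
  have CI : Ck i (f @` N) (fun y => invmx ((jac f \o g) y)).
    by apply: Ck_invmx => // y /gN; apply: Ju.
  have := Ck_mulmx ofN (Ck_cst i (f @` N) (v : 'rV[R]_m)) CI.
  by apply: Ck_eq => // y /D[_ E]; rewrite E.
have : forall i, (i <= k.+1)%N -> Ck i (f @` N) g.
  by elim=> [//|i IH] ik; apply: step => //; apply: IH; apply: leqW.
by move/(_ k.+1 (leqnn _)).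
Qed.

End InverseFunctionSmooth.

(** * Flows of smooth vector fields *)

Section CurveTools.
Context {R : realType}.

Lemma antiderivative (g : R -> R) (c : R) : continuous g -> 0 < c ->
  exists2 G : R -> R, G 0 = 0 & forall t, - c < t < c -> is_derive t 1 G (g t).
Proof.
move=> cg c0; pose mu := @lebesgue_measure R.
pose G0 x : R := (\int[mu]_(t in `[- c, x]) g t)%R.
have D t : - c < t < c -> is_derive t 1 G0 (g t).
  move=> /andP[t1 t2].
  have [] := @continuous_FTC1 R g (BLeft (- c)) t c t2 _ _ (cg t).
  - apply: continuous_compact_integrable; first exact: segment_compact.
    by apply: continuous_subspaceT.
  - by rewrite lte_fin.
  by rewrite derive1E => d e; apply: DeriveDef.
exists (fun t => G0 t - G0 0); first by rewrite subrr.
move=> t tc; have := D t tc => Dt.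
have -> : g t = g t - 0 by rewrite subr0.
exact: (is_deriveB Dt (is_derive_cst _ _ _)).
Qed.

Lemma curve_coord p q (c : R -> 'M[R]_(p, q)) (t : R) (dc : 'M[R]_(p, q)) :
  is_derive t 1 c dc <-> forall i j, is_derive t 1 (fun s => c s i j) (dc i j).
Proof.
split=> [[d <-] i j|h].
  apply: DeriveDef; first by have /derivable_mxP := d; apply.
  by rewrite (derive_mx d) mxE.
have d : derivable c t 1 by apply/derivable_mxP => i j; have [] := h i j.
by apply: DeriveDef => //; rewrite (derive_mx d); apply/matrixP => i j; rewrite mxE; have [] := h i j.
Qed.

Lemma curve_mvt p (c dc : R -> 'rV[R]_p) (a b B s t : R) :
  (forall u, a < u < b -> is_derive u 1 c (dc u)) ->
  (forall u, a < u < b -> `|dc u| <= B) ->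
  a < s < b -> a < t < b -> `|c t - c s| <= B * `|t - s|.
Proof.
move=> dcd bd; wlog st : s t / s <= t.
  move=> h hs ht; have [|ts] := leP s t => [/h|]; first exact.
  by rewrite distrC [`|t - s|]distrC; apply: h => //; apply: ltW.
move=> /andP[as_ sb] /andP[a_t tb].
have B0 : 0 <= B by apply: le_trans (normr_ge0 (dc s)) (bd s _); rewrite as_.
apply: mx_norm_leP => [|i j]; first by rewrite mulr_ge0.
have inI u : s <= u <= t -> a < u < b.
  by move=> /andP[u1 u2]; rewrite (lt_le_trans as_ u1) (le_lt_trans u2 tb).
have dd u : s <= u <= t -> is_derive u 1 (fun x => c x i j) (dc u i j).
  by move=> /inI/dcd/curve_coord.
case: (@MVT_segment R (fun x => c x i j) (fun x => dc x i j) s t st).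
- by move=> x; rewrite in_itv /= => /andP[x1 x2]; apply: dd; rewrite !ltW.
- by apply: derivable_within_continuous => x; rewrite in_itv /= => /dd; case.
move=> x xst; rewrite !mxE => ->; rewrite normrM ler_wpM2r //.
apply: le_trans (coord_le_norm _ _ _) (bd x _); apply: inI.
by move: xst; rewrite in_itv.
Qed.

(** The intervals of radius [2 C / 2 ^+ n] about [u n] are nested; the supremum of their left ends
    lies in all of them, which gives the rate together with the limit. *)
Lemma geometric_limit (u : nat -> R) (C : R) :
  (forall n, `|u n.+1 - u n| <= C / 2 ^+ n) ->
  exists l, forall n, `|u n - l| <= 2 * C / 2 ^+ n.
Proof.
move=> h.
pose a n := u n - 2 * C / 2 ^+ n; pose b n := u n + 2 * C / 2 ^+ n.
have p n : (0 : R) < 2 ^+ n by rewrite exprn_gt0.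
have halve n : 2 * C / 2 ^+ n.+1 = C / 2 ^+ n.
  by rewrite exprS invfM; field; rewrite gt_eqF.
have C0 : 0 <= C by have := h 0%N; rewrite expr0 divr1; apply: le_trans.
have Cn n : 0 <= C / 2 ^+ n by rewrite divr_ge0 // ltW.
have ha n : a n <= a n.+1.
  rewrite /a halve; have := h n; rewrite ler_norml => /andP[]; rewrite -mulrA.
  by move: (C / 2 ^+ n) => e; lra.
have hb n : b n.+1 <= b n.
  rewrite /b halve; have := h n; rewrite ler_norml => /andP[]; rewrite -mulrA.
  by move: (C / 2 ^+ n) => e; lra.
have am : {homo a : i j / (i <= j)%N >-> i <= j} by apply: homo_leq le_trans _ => //.
have bm i j : (i <= j)%N -> b j <= b i.
  by elim: j => [|j IH]; rewrite leq_eqVlt => /predU1P[->|] // /IH; apply: le_trans.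
have ab n : a n <= b n.
  by rewrite /a /b -mulrA; have := Cn n; move: (C / 2 ^+ n) => e; lra.
have abm i j : a i <= b j.
  by apply: le_trans (am _ _ (leq_maxl i j)) (le_trans (ab _) (bm _ _ (leq_maxr i j))).
pose S := range a.
have S0 : S !=set0 by exists (a 0%N); exists 0%N.
exists (sup S) => n; rewrite ler_norml.
have h1 : a n <= sup S.
  by apply: sup_upper_bound; [split => //; exists (b 0%N) => _ [i _ <-]|exists n].
have h2 : sup S <= b n by apply: ge_sup => // _ [i _ <-].
by move: h1 h2; rewrite /a /b; move: (2 * C / 2 ^+ n) => e; lra.
Qed.

Lemma halving_bound (x a D : R) : (forall n, x <= a + D / 2 ^+ n) -> x <= a.
Proof.
move=> h; apply/ler_addgt0Pr => e e0.
have [n hn] : exists n : nat, D / 2 ^+ n < e.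
  have [n Dn] : exists n : nat, D / e < n%:R.
    by exists (Num.bound `|D / e|); apply: le_lt_trans (ler_norm _) (archi_boundP (normr_ge0 _)).
  exists n; rewrite ltr_pdivrMr ?exprn_gt0 // mulrC -ltr_pdivrMr //.
  apply: lt_trans Dn _; rewrite -natrX ltr_nat; exact: ltn_expl.
by apply: le_trans (h n) _; rewrite lerD2l ltW.
Qed.

(* A crude Gronwall inequality: on an interval so short that [d K <= 1/2] an a priori bound
   [D] improves to [2 e + D/2], hence to [2 e] after infinitely many iterations. *)
Lemma short_gronwall p (x dx : R -> 'rV[R]_p) (d K e D : R) :
  0 <= K -> 0 <= e -> d * K <= 2^-1 ->
  (forall t, - d < t < d -> is_derive t 1 x (dx t)) ->
  (forall t, - d < t < d -> `|dx t| <= K * `|x t| + e) ->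
  (forall t, - d < t < d -> `|x t| <= D) ->
  forall t, - d < t < d -> `|x t| <= 2 * (`|x 0| + d * e).
Proof.
move=> K0 e0 dK dd bd bD t td; set E := `|x 0| + d * e.
have d0 : 0 < d by lra.
have E0 : 0 <= E by rewrite addr_ge0 // mulr_ge0 // ltW.
have D0 : 0 <= D by apply: le_trans (normr_ge0 _) (bD _ td).
apply: (@halving_bound _ _ D) => n; elim: n t td => [|n IH] t td.
  by rewrite expr0 divr1; apply: le_trans (bD _ td) _; rewrite lerDr mulr_ge0.
have z0 : - d < 0 < d by lra.
have b2 u : - d < u < d -> `|dx u| <= K * (2 * E + D / 2 ^+ n) + e.
  by move=> ud; apply: le_trans (bd _ ud) _; rewrite lerD2r ler_wpM2l // IH.
have := curve_mvt dd b2 z0 td; rewrite subr0 => h.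
have td' : `|t| <= d by rewrite ler_norml; lra.
have : `|x t| <= `|x 0| + `|x t - x 0| by rewrite -{1}(subrK (x 0) (x t)) addrC ler_normD.
move=> /le_trans; apply.
have Q0 : 0 <= 2 * E + D / 2 ^+ n.
  by rewrite addr_ge0 ?mulr_ge0 ?divr_ge0 // exprn_ge0.
have h2 : `|x t - x 0| <= 2^-1 * (2 * E + D / 2 ^+ n) + d * e.
  apply: le_trans h _; apply: le_trans (_ : _ <= (K * (2 * E + D / 2 ^+ n) + e) * d) _.
    by rewrite ler_wpM2l // addr_ge0 // mulr_ge0.
  rewrite mulrDl [e * d]mulrC lerD2r mulrAC [K * d]mulrC.
  exact: ler_wpM2r.
have -> : D / 2 ^+ n.+1 = 2^-1 * (D / 2 ^+ n).
  by rewrite exprS invfM mulrCA.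
rewrite /E in h2 *; move: (D / 2 ^+ n) h2 => q; lra.
Qed.

(** Near every [t1], whether or not [P t1] is known, truth of [P] at one time spreads to all nearby
    times in both directions. So [P] defines an open and closed subset of a connected interval.
    Uniqueness of geodesics, constancy of their speed and smooth dependence on initial data are all
    propagated in this way. *)
Lemma interval_induction (a b s0 : R) (P : R -> Prop) :
  (forall t1, a < t1 < b -> exists2 e : R, 0 < e & forall t t',
     a < t < b -> a < t' < b -> `|t - t1| < e -> `|t' - t1| < e -> P t' -> P t) ->
  a < s0 < b -> P s0 -> forall t, a < t < b -> P t.
Proof.
move=> H s0I Ps0 t tI; apply: contrapT => nPt.
have cI : connected `]a, b[%classic by apply/connected_intervalP; apply: interval_is_interval.
pose B := `]a, b[%classic `&` P.
have BI : B = `]a, b[%classic.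
  apply: cI.
  - by exists s0; split => //; rewrite /= in_itv.
  - exists (\bigcup_(t1 in B) [set t | exists2 e : R, `|t - t1| < e &
        forall t, a < t < b -> `|t - t1| < e -> P t]).
      apply: bigcup_open => t1 [_ _]; rewrite openE => u [e ue he].
      apply: (@norm_lt_nbhs R _ u _ (e - `|u - t1|)); first by rewrite subr_gt0.
      by move=> y hy; exists e => //; have := ler_distD u y t1; lra.
    apply/seteqP; split=> u.
      move=> [uI Pu]; split => //; exists u => //.
      have uI' : a < u < b by move: uI; rewrite /= in_itv.
      have [e e0 he] := H u uI'; exists e; first by rewrite subrr normr0.
      by move=> y yI ye; apply: (he y u) => //; rewrite subrr normr0.
    move=> [uI [t1 _ [e ue he]]]; split => //; exact: he.
  exists (~` \bigcup_(t1 in `]a, b[%classic `&` ~` P) [set t | exists2 e : R, `|t - t1| < e &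
        forall t, a < t < b -> `|t - t1| < e -> ~ P t]).
    rewrite closedC; apply: bigcup_open => t1 _; rewrite openE => u [e ue he].
    apply: (@norm_lt_nbhs R _ u _ (e - `|u - t1|)); first by rewrite subr_gt0.
    by move=> y hy; exists e => //; have := ler_distD u y t1; lra.
  apply/seteqP; split=> u.
    move=> [uI Pu]; split => // -[t1 [_ _] [e ue he]]; exact: (he u).
  move=> [uI hu]; split => //; apply: contrapT => nPu; apply: hu; exists u => //.
  have uI' : a < u < b by move: uI; rewrite /= in_itv.
  have [e e0 he] := H u uI'; exists e; first by rewrite subrr normr0.
  by move=> y yI ye Py; apply: nPu; apply: (he u y) => //; rewrite subrr normr0.
have : `]a, b[%classic t by rewrite /= in_itv.
by rewrite -BI => -[].
Qed.

End CurveTools.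

Section Bounds.
Context {R : realType}.

Lemma derive_row_sum m (W : normedModType R) (f : 'rV[R]_m -> W) (z v : 'rV[R]_m) : differentiable f z ->
  'D_v f z = \sum_i v 0 i *: 'D_(delta_mx 0 i) f z.
Proof.
move=> d; rewrite (deriveE v d) {1}(row_coord_sum v) linear_sum; apply: eq_bigr => i _.
by rewrite linearZ /= (deriveE _ d).
Qed.

Lemma mulmx_le m p (v : 'rV[R]_m) (A : 'M[R]_(m, p)) : `|v *m A| <= m%:R * (`|A| * `|v|).
Proof.
apply: mx_norm_leP => [|i j]; first by rewrite !mulr_ge0.
rewrite mxE; apply: le_trans (ler_norm_sum _ _ _) _.
apply: (@le_trans _ _ (\sum_(k < m) (`|A| * `|v|))).
  by apply: ler_sum => k _; rewrite normrM mulrC; apply: ler_pM => //; apply: coord_le_norm.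
by rewrite sumr_const card_ord -[leLHS]mulr_natl.
Qed.

Lemma local_derive_bound m p (U : set 'rV[R]_m) (f : 'rV[R]_m -> 'rV[R]_p) (z0 : 'rV[R]_m) :
  open U -> U z0 -> Ck 1 U f ->
  exists r K : R, [/\ 0 < r, 0 < K & forall x, `|x - z0| < r ->
    U x /\ forall v, `|'D_v f x| <= K * `|v|].
Proof.
move=> oU Uz0 Cf.
pose K : R := 1 + \sum_(i < m) (`|'D_(delta_mx 0 i) f z0| + 1).
have /filter_forall H : forall i : 'I_m, \forall x \near z0,
    `|'D_(delta_mx 0 i) f z0 - 'D_(delta_mx 0 i) f x| <= 1.
  move=> i; apply: (@continuous_near_le R _ _ (fun x => 'D_(delta_mx 0 i) f x)) => //.
  exact: Ck_cont (Ck_derive (delta_mx 0 i) Cf) Uz0.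
have H2 : nbhs z0 (U `&` [set x | forall i : 'I_m, `|'D_(delta_mx 0 i) f z0 - 'D_(delta_mx 0 i) f x| <= 1]).
  by apply: filterI; [exact: open_nbhs_nbhs|exact: H].
have [r r0 Hr] := nbhs_norm_lt H2.
exists r, K; split => //; first by rewrite ltr_wpDr // sumr_ge0 // => i _; rewrite addr_ge0.
move=> x /Hr[Ux hx]; split => // v.
rewrite (derive_row_sum v (Ck1_diff_mx oU Cf Ux)).
apply: le_trans (ler_norm_sum _ _ _) _.
apply: (@le_trans _ _ (\sum_(i < m) (`|'D_(delta_mx 0 i) f z0| + 1) * `|v|)); last first.
  by rewrite -mulr_suml ler_wpM2r // lerDr.
apply: ler_sum => i _; rewrite normrZ mulrC; apply: ler_pM => //; last exact: coord_le_norm.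
have := hx i; set a := 'D__ _ _; set b := 'D__ _ _ => h.
by rewrite -(subrK a b) addrC; apply: le_trans (ler_normD _ _) _; rewrite lerD2l distrC.
Qed.

Lemma lipschitz_ball m p (f : 'rV[R]_m -> 'rV[R]_p) (z0 : 'rV[R]_m) (r K : R) : 0 <= K ->
  (forall x v, `|x - z0| < r -> derivable f x v /\ `|'D_v f x| <= K * `|v|) ->
  forall x y, `|x - z0| < r -> `|y - z0| < r -> `|f x - f y| <= K * `|x - y|.
Proof.
move=> K0 h x y hx hy.
by apply: (@mean_value_le R m p f [set w | `|w - z0| < r]) => // s; apply: ball_segment.
Qed.

(** The derivative of [F] is Lipschitz near [z0]; the mean value inequality for [F] minus its linear
    part at [y] then gives the quadratic remainder. A single [K] serves all the bounds, which keeps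
    the flow estimates simple. *)
Lemma local_taylor m (U : set 'rV[R]_m) (F : 'rV[R]_m -> 'rV[R]_m) (z0 : 'rV[R]_m) :
  open U -> U z0 -> Ck 2 U F ->
  exists r K : R, [/\ 0 < r, 0 < K &
    (forall x, `|x - z0| < r -> U x /\ forall v, `|'D_v F x| <= K * `|v|) /\
    (forall x y, `|x - z0| < r -> `|y - z0| < r -> `|F x - F y| <= K * `|x - y| /\
       `|F x - F y - 'D_(x - y) F y| <= K * `|x - y| ^+ 2)].
Proof.
move=> oU Uz0 C2; have C1 : Ck 1 U F by apply: CkS.
have [r1 [K1 [r10 K10 H1]]] := local_derive_bound oU Uz0 C1.
(* The Jacobian is flattened because the Lipschitz estimate is stated for values in row vectors. *)
pose J z := mxvec (jac F z).
have CJ : Ck 1 U J.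
  have := (Ck_mxP _ _ oU).1 (Ck_jac oU C2) => h; apply/(Ck_mxP _ _ oU) => i k.
  rewrite (ord1 i); case/mxvec_indexP: k => a b.
  by apply: Ck_eq (h a b) => // z _; rewrite /J mxvecE.
have [r2 [K2 [r20 K20 H2]]] := local_derive_bound oU Uz0 CJ.
pose r := Num.min r1 r2; pose K := K1 + m%:R * K2.
have lt1 x : `|x - z0| < r -> `|x - z0| < r1 by move=> h; apply: lt_le_trans h _; rewrite ge_min lexx.
have lt2 x : `|x - z0| < r -> `|x - z0| < r2 by move=> h; apply: lt_le_trans h _; rewrite ge_min lexx orbT.
have K'0 : 0 <= m%:R * K2 by rewrite mulr_ge0 // ltW.
have J2 x y : `|x - z0| < r -> `|y - z0| < r -> `|jac F x - jac F y| <= K2 * `|x - y|.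
  move=> /lt2 hx /lt2 hy.
  have h : `|J x - J y| <= K2 * `|x - y|.
    apply: (lipschitz_ball (ltW K20) _ hx hy) => w v /H2[Uw hw]; split => //.
    exact: Ck_derivable CJ Uw.
  apply: le_trans h; apply: mx_norm_leP => // i j.
  apply: le_trans (coord_le_norm _ 0 (mxvec_index i j)).
  by rewrite /J -linearB mxvecE.
exists r, K; split; [by rewrite lt_min r10|by rewrite ltr_wpDr|split].
  move=> x /lt1/H1[Ux hx]; split => // v; apply: le_trans (hx v) _.
  by rewrite ler_wpM2r // lerDl.
move=> x y hx hy; split.
  apply: (@le_trans _ _ (K1 * `|x - y|)); last by rewrite ler_wpM2r // lerDl.
  apply: (lipschitz_ball (ltW K10) _ (lt1 _ hx) (lt1 _ hy)) => w v /H1[Uw hw]; split => //.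
  exact: Ck_derivable C1 Uw.
have Uy := (H1 y (lt1 _ hy)).1.
have lB : linear (fun w : 'rV[R]_m => w *m jac F y) by move=> k u w; rewrite mulmxDl scalemxAl.
pose LM := GRing.isLinear.Build _ _ _ _ _ lB.
pose L : {linear 'rV[R]_m -> 'rV[R]_m} := HB.pack (fun w : 'rV[R]_m => w *m jac F y) LM.
have dL w : differentiable L w by apply: linear_differentiable; apply: linear_rV_continuous.
pose G w := F w - L w.
have -> : F x - F y - 'D_(x - y) F y = G x - G y.
  rewrite (deriveE_jac _ (Ck1_diff_mx oU C1 Uy)) /G -[L x]/(x *m jac F y) -[L y]/(y *m jac F y).
  by rewrite mulmxBl !opprB addrACA [- F y + _]addrC -!addrA; congr (_ + _); rewrite addrCA.
rewrite expr2 mulrA.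
apply: (@le_trans _ _ (m%:R * K2 * `|x - y| * `|x - y|)); last first.
  by rewrite ler_wpM2r // ler_wpM2r // lerDr ltW.
apply: (@mean_value_le R m m G [set w | `|w - z0| < r /\ `|w - y| <= `|x - y|]).
- by rewrite mulr_ge0.
- move=> s /= hs; split; first exact: ball_segment.
  by rewrite addrK normrZ; move: hs => /andP[s0 s1]; rewrite ger0_norm // ler_piMl.
move=> w v /= [hw wy]; have [Uw _] := H1 w (lt1 _ hw).
have dF : derivable F w v by apply: Ck_derivable C1 Uw.
have dL' : derivable L w v by apply: diff_derivable.
split; first exact: derivableB.
have -> : 'D_v G w = v *m (jac F w - jac F y).
  rewrite mulmxBr -(deriveE_jac v (Ck1_diff_mx oU C1 Uw)).
  apply: etrans (deriveB dF dL') _; congr (_ - _).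
  by rewrite (deriveE v (dL w)); have -> := diff_lin (f := L) w (linear_rV_continuous (L := L)).
apply: le_trans (mulmx_le _ _) _; rewrite -!mulrA ler_wpM2l // mulrA ler_wpM2r //.
apply: le_trans (J2 _ _ hw hy) _; by rewrite ler_wpM2l // ltW.
Qed.

Lemma lipschitz_continuous (g : R -> R) (L : R) :
  (forall s t, `|g s - g t| <= L * `|s - t|) -> continuous g.
Proof.
move=> h t; apply/cvgrPdist_le => e e0.
have L0 : 0 <= L by have := h 1 0; rewrite subr0 normr1 mulr1; apply: le_trans.
apply: (@norm_lt_nbhs R R^o t _ (e / (L + 1))).
  by rewrite divr_gt0 // ltr_wpDl.
move=> s; rewrite ltr_pdivlMr ?ltr_wpDl // => hs; apply: le_trans (h _ _) _.
rewrite distrC; apply: le_trans (ltW hs); rewrite mulrC ler_wpM2l //.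
by rewrite lerDl.
Qed.

End Bounds.

(** * Picard iteration *)

Section Picard.
Context {R : realType} {m : nat}.
Local Notation V := 'rV[R]_m.

(** Freezing the time outside [-d, d] makes the integrand of the Picard operator continuous on the
    whole line, so its primitive is differentiable on an open interval that contains [-d, d]. *)
Let clamp (d t : R) : R := Num.max (- d) (Num.min d t).

Let clamp_in d t : 0 <= d -> - d <= clamp d t <= d.
Proof. by move=> d0; rewrite /clamp /Num.max /Num.min; case: (ltP d t) => h; case: ltP => h'; lra. Qed.

Let clamp_id d t : - d <= t <= d -> clamp d t = t.
Proof.
move=> /andP[a b]; rewrite /clamp /Num.max /Num.min; case: (ltP d t) => h; case: ltP => h' //; lra.
Qed.

Let clamp_lip d s t : 0 <= d -> `|clamp d s - clamp d t| <= `|s - t|.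
Proof.
move=> d0; rewrite ler_norml; have h1 := ler_norm (s - t); have := ler_norm (t - s).
rewrite distrC => h2; rewrite /clamp /Num.max /Num.min.
by case: (ltP d s) => ?; case: ltP => ?; case: (ltP d t) => ?; case: ltP => ?; lra.
Qed.

(** The Picard operator preserves the [good] curves, which are [M]-Lipschitz and stay within [r / 4]
    of [y], and it halves their distances. The bound on [d * K] is exported because [short_gronwall]
    needs it on the same interval. *)
Lemma picard (F : V -> V) (z0 : V) (r K : R) : 0 < r -> 0 < K ->
  (forall x y, `|x - z0| < r -> `|y - z0| < r -> `|F x - F y| <= K * `|x - y|) ->
  exists2 d : R, 0 < d & d * K <= 2^-1 /\ forall y, `|y - z0| < r / 2 ->
    exists x : R -> V, x 0 = y /\ forall t, - d < t < d ->
      `|x t - z0| < r /\ is_derive t 1 x (F (x t)).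
Proof.
move=> r0 K0 lip.
pose M := `|F z0| + K * r + 1.
have M0 : 0 < M by rewrite ltr_wpDl // addr_ge0 // mulr_ge0 // ltW.
have FM x : `|x - z0| < r -> `|F x| <= M.
  move=> hx; rewrite -(subrK (F z0) (F x)) addrC; apply: le_trans (ler_normD _ _) _.
  rewrite /M -addrA lerD2l; apply: (@le_trans _ _ (K * `|x - z0|)).
    by apply: lip => //; rewrite subrr normr0.
  by apply: le_trans (ler_wpM2l (ltW K0) (ltW hx)) _; rewrite lerDl.
(* [M d <= r / 4] keeps the curves near [y]; [K d <= 1/2] makes the operator a contraction. *)
pose d := Num.min (r / (4 * M)) (2 * K)^-1.
have d0 : 0 < d by rewrite lt_min divr_gt0 ?invr_gt0 ?mulr_gt0.
have dK : d * K <= 2^-1.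
  apply: (@le_trans _ _ ((2 * K)^-1 * K)); first by rewrite ler_pM2r // ge_min lexx orbT.
  by rewrite invfM -mulrA mulVf ?gt_eqF // mulr1.
have dM : M * d <= r / 4.
  apply: (@le_trans _ _ (M * (r / (4 * M)))); first by rewrite ler_pM2l // ge_min lexx.
  by rewrite le_eqVlt; apply/orP; left; apply/eqP; field; rewrite gt_eqF.
exists d => //; split => // y hy.
pose good (x : R -> V) := (forall s t, - d <= s <= d -> - d <= t <= d -> `|x s - x t| <= M * `|s - t|) /\
   (forall s, - d <= s <= d -> `|x s - y| <= r / 4).
have near x s : good x -> - d <= s <= d -> `|x s - z0| < r.
  by move=> [_ h] /h hs; have := ler_distD y (x s) z0; lra.
(* The Picard operator is totalized by choice and has content on [good] curves only. *)
have TE x : exists Tx : R -> V, good x -> [/\ good Tx, Tx 0 = y &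
    forall t, - (2 * d) < t < 2 * d -> is_derive t 1 Tx (F (x (clamp d t)))].
  have [gx|] := pselect (good x); last by move=> ng; exists x => /ng.
  have inc t : - d <= clamp d t <= d by apply: clamp_in; apply: ltW.
  have cg j : continuous (fun t => F (x (clamp d t)) 0 j).
    apply: (@lipschitz_continuous _ _ (K * M)) => s t.
    have -> : F (x (clamp d s)) 0 j - F (x (clamp d t)) 0 j = (F (x (clamp d s)) - F (x (clamp d t))) 0 j.
      by rewrite !mxE.
    apply: le_trans (coord_le_norm _ _ _) _.
    apply: le_trans (lip _ _ (near _ _ gx (inc s)) (near _ _ gx (inc t))) _.
    rewrite -mulrA ler_wpM2l ?(ltW K0) //; apply: le_trans (gx.1 _ _ (inc s) (inc t)) _.
    by rewrite ler_wpM2l ?(ltW M0) // clamp_lip // ltW.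
  have d20 : 0 < 2 * d by rewrite mulr_gt0.
  have /choice[G GP] : forall j, exists G : R -> R, G 0 = 0 /\ forall t, - (2 * d) < t < 2 * d ->
      is_derive t 1 G (F (x (clamp d t)) 0 j).
    by move=> j; have [G g0 gd] := antiderivative (cg j) d20; exists G.
  pose Tx t : V := \row_j (y 0 j + G j t).
  have Td t : - (2 * d) < t < 2 * d -> is_derive t 1 Tx (F (x (clamp d t))).
    move=> ht; apply/curve_coord => i j; rewrite (ord1 i).
    have -> : (fun s => Tx s 0 j) = (fun s => cst (y 0 j) s + G j s) by apply: funext => s; rewrite mxE.
    have -> : F (x (clamp d t)) 0 j = 0 + F (x (clamp d t)) 0 j by rewrite add0r.
    exact: (is_deriveD (is_derive_cst _ _ _) ((GP j).2 _ ht)).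
  have T0 : Tx 0 = y by apply/rowP => j; rewrite mxE (GP j).1 addr0.
  have Tl s t : - d <= s <= d -> - d <= t <= d -> `|Tx s - Tx t| <= M * `|s - t|.
    move=> hs ht; apply: (curve_mvt Td); [|lra|lra].
    by move=> u _; apply: FM; apply: near.
  exists Tx => _; split => //; split => // s hs.
  rewrite -T0; apply: le_trans (Tl _ _ hs _) _; first by lra.
  rewrite subr0; apply: le_trans dM; rewrite ler_wpM2l ?(ltW M0) //.
  by rewrite ler_norml.
have [T TP] := choice TE.
have contr x x' D : good x -> good x' -> (forall s, - d <= s <= d -> `|x s - x' s| <= D) ->
    forall s, - d <= s <= d -> `|T x s - T x' s| <= 2^-1 * D.
  move=> gx gx' hD s hs; have [_ T0 Td] := TP _ gx; have [_ T0' Td'] := TP _ gx'.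
  have D0 : 0 <= D by apply: le_trans (hD s hs).
  have inc t : - d <= clamp d t <= d by apply: clamp_in; apply: ltW.
  have dd u : - (2 * d) < u < 2 * d ->
     is_derive u 1 (T x - T x') (F (x (clamp d u)) - F (x' (clamp d u))).
    by move=> hu; exact: (is_deriveB (Td u hu) (Td' u hu)).
  have bd u : - (2 * d) < u < 2 * d -> `|F (x (clamp d u)) - F (x' (clamp d u))| <= K * D.
    move=> _; apply: le_trans (lip _ _ (near _ _ gx (inc u)) (near _ _ gx' (inc u))) _.
    by rewrite ler_wpM2l ?(ltW K0) // hD.
  have i0 : - (2 * d) < 0 < 2 * d by lra.
  have is' : - (2 * d) < s < 2 * d by lra.
  have := curve_mvt dd bd i0 is'; rewrite !fctE /= T0 T0' subrr !subr0 => h.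
  apply: le_trans h _; rewrite mulrAC ler_wpM2r //.
  apply: le_trans dK; rewrite mulrC ler_wpM2r ?(ltW K0) //.
  by rewrite ler_norml.
pose X n := iter n T (cst y).
have gX n : good (X n).
  elim: n => [|n IH]; last by have [] := TP _ IH.
  split=> [s t _ _|s _]; rewrite /= subrr normr0; last by rewrite divr_ge0 // ltW.
  by rewrite mulr_ge0 // ltW.
have step n s : - d <= s <= d -> `|X n.+1 s - X n s| <= r / 2 ^+ n.
  elim: n s => [|n IH] s hs.
    by have := (gX 1%N).2 _ hs; rewrite expr0 divr1 /=; lra.
  have -> : r / 2 ^+ n.+1 = 2^-1 * (r / 2 ^+ n) by rewrite exprS invfM mulrCA.
  exact: (contr _ _ _ (gX n.+1) (gX n) IH).
have /choice[x xP] : forall t, exists l : V, - d <= t <= d -> forall n, `|X n t - l| <= 2 * r / 2 ^+ n.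
  move=> t; have [ht|] := pselect (- d <= t <= d); last by move=> nt; exists 0 => /nt.
  have /choice[l lP] : forall j, exists l, forall n, `|X n t 0 j - l| <= 2 * r / 2 ^+ n.
    move=> j; apply: geometric_limit => n; apply: le_trans (step n t ht).
    by apply: le_trans (coord_le_norm _ 0 j); rewrite !mxE.
  exists (\row_j l j) => _ n; apply: mx_norm_leP => [|i j].
    by rewrite divr_ge0 ?mulr_ge0 ?exprn_ge0 // ltW.
  by rewrite (ord1 i) !mxE.
have gx : good x.
  split=> [s t hs ht|s hs].
    apply: (@halving_bound _ _ _ (4 * r)) => n.
    have h1 := (gX n).1 s t hs ht; have h2 := xP s hs n; have h3 := xP t ht n.
    have -> : 4 * r / 2 ^+ n = 2 * r / 2 ^+ n + 2 * r / 2 ^+ n by ring.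
    have := ler_distD (X n s) (x s) (x t); have := ler_distD (X n t) (X n s) (x t).
    by rewrite [`|x s - X n s|]distrC; lra.
  apply: (@halving_bound _ _ _ (2 * r)) => n.
  have h1 := (gX n).2 s hs; have h2 := xP s hs n.
  by have := ler_distD (X n s) (x s) y; rewrite [`|x s - X n s|]distrC; lra.
have [gT T0 Td] := TP _ gx.
have Tx t : - d <= t <= d -> T x t = x t.
  move=> ht; apply/eqP; rewrite -subr_eq0 -normr_le0; apply: (@halving_bound _ _ _ (4 * r)) => n.
  have h1 := contr _ _ _ (gX n) gx (fun s hs => xP s hs n) t ht.
  have h2 := xP t ht n.+1.
  have e1 : 2 * r / 2 ^+ n.+1 = r / 2 ^+ n by rewrite exprS invfM; field; rewrite gt_eqF // exprn_gt0.
  rewrite e1 in h2; rewrite -!mulrA in h1 *.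
  have : `|T x t - x t| <= `|X n.+1 t - T x t| + `|X n.+1 t - x t|.
    by rewrite [`|X n.+1 t - T x t|]distrC; apply: ler_distD.
  rewrite add0r; have : 0 <= r / 2 ^+ n by rewrite divr_ge0 ?exprn_ge0 // ltW.
  rewrite -[X n.+1 t]/(T (X n) t); move: (r / 2 ^+ n) h1 h2 => q; lra.
exists (T x); split => // t td; have td' : - d <= t <= d by lra.
split; first by rewrite Tx //; apply: near.
rewrite Tx // -{2}(clamp_id td'); apply: Td; lra.
Qed.

End Picard.

Section RowMx.
Context {R : realType}.

Lemma norm_lsubmx p q (w : 'rV[R]_(p + q)) : `|lsubmx w| <= `|w|.
Proof. by apply: mx_norm_leP => // i j; rewrite mxE; apply: coord_le_norm. Qed.

Lemma norm_rsubmx p q (w : 'rV[R]_(p + q)) : `|rsubmx w| <= `|w|.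
Proof. by apply: mx_norm_leP => // i j; rewrite mxE; apply: coord_le_norm. Qed.

Lemma norm_row_mx_lt p q (a : 'rV[R]_p) (b : 'rV[R]_q) (e : R) :
  `|a| < e -> `|b| < e -> `|row_mx a b| < e.
Proof.
move=> ha hb; apply: (@le_lt_trans _ _ (Num.max `|a| `|b|)); last by rewrite gt_max ha hb.
apply: mx_norm_leP => [|i j]; first by rewrite le_max normr_ge0.
rewrite le_max; case: (split_ordP j) => k ->.
  by rewrite row_mxEl coord_le_norm.
by rewrite row_mxEr coord_le_norm orbT.
Qed.

Lemma row_mxB p q (a b : 'rV[R]_p) (c d : 'rV[R]_q) : row_mx a c - row_mx b d = row_mx (a - b) (c - d).
Proof. by rewrite opp_row_mx add_row_mx. Qed.

Lemma Ck_row_mx m p q k (U : set 'rV[R]_m) (f : 'rV[R]_m -> 'rV[R]_p) (g : 'rV[R]_m -> 'rV[R]_q) :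
  open U -> Ck k U f -> Ck k U g -> Ck k U (fun z => row_mx (f z) (g z)).
Proof.
move=> oU /(Ck_mxP _ _ oU) Cf /(Ck_mxP _ _ oU) Cg; apply/(Ck_mxP _ _ oU) => i j.
case: (split_ordP j) => a ->.
  by apply: Ck_eq (Cf i a) => // z _; rewrite row_mxEl.
by apply: Ck_eq (Cg i a) => // z _; rewrite row_mxEr.
Qed.

Lemma Ck_id m k (U : set 'rV[R]_m) : Ck k U (id : 'rV[R]_m -> 'rV[R]_m).
Proof.
pose L : {linear 'rV[R]_m -> 'rV[R]_m} := idfun.
exact: (Ck_linear k U L).
Qed.

Lemma Ck_lsubmx m p q k (U : set 'rV[R]_m) (f : 'rV[R]_m -> 'rV[R]_(p + q)) : open U ->
  Ck k U f -> Ck k U (fun z => lsubmx (f z)).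
Proof.
move=> oU /(Ck_mxP _ _ oU) Cf; apply/(Ck_mxP _ _ oU) => i j.
by apply: Ck_eq (Cf i (lshift q j)) => // z _; rewrite mxE.
Qed.

Lemma Ck_rsubmx m p q k (U : set 'rV[R]_m) (f : 'rV[R]_m -> 'rV[R]_(p + q)) : open U ->
  Ck k U f -> Ck k U (fun z => rsubmx (f z)).
Proof.
move=> oU /(Ck_mxP _ _ oU) Cf; apply/(Ck_mxP _ _ oU) => i j.
by apply: Ck_eq (Cf i (rshift p j)) => // z _; rewrite mxE.
Qed.

Lemma Ck_scalemx m p q k (U : set 'rV[R]_m) (c : R) (f : 'rV[R]_m -> 'M[R]_(p, q)) : open U ->
  Ck k U f -> Ck k U (fun z => c *: f z).
Proof.
move=> oU /(Ck_mxP _ _ oU) Cf; apply/(Ck_mxP _ _ oU) => i j.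
by apply: Ck_eq (Ck_scale c oU (Cf i j)) => // z _; rewrite mxE.
Qed.

Lemma is_derive_lsubmx p q (c : R -> 'rV[R]_(p + q)) (t : R) dc :
  is_derive t 1 c dc -> is_derive t 1 (fun s => lsubmx (c s)) (lsubmx dc).
Proof.
move=> /curve_coord h; apply/curve_coord => i j; rewrite mxE.
by have := h i (lshift q j); congr (is_derive _ _ _ _); apply: funext => s; rewrite mxE.
Qed.

Lemma is_derive_rsubmx p q (c : R -> 'rV[R]_(p + q)) (t : R) dc :
  is_derive t 1 c dc -> is_derive t 1 (fun s => rsubmx (c s)) (rsubmx dc).
Proof.
move=> /curve_coord h; apply/curve_coord => i j; rewrite mxE.
by have := h i (rshift p j); congr (is_derive _ _ _ _); apply: funext => s; rewrite mxE.
Qed.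

Lemma is_derive_row_mx p q (a : R -> 'rV[R]_p) (b : R -> 'rV[R]_q) (t : R) da db :
  is_derive t 1 a da -> is_derive t 1 b db ->
  is_derive t 1 (fun s => row_mx (a s) (b s)) (row_mx da db).
Proof.
move=> /curve_coord ha /curve_coord hb; apply/curve_coord => i j.
case: (split_ordP j) => k ->.
  by have := ha i k; rewrite row_mxEl; congr (is_derive _ _ _ _); apply: funext => s; rewrite row_mxEl.
by have := hb i k; rewrite row_mxEr; congr (is_derive _ _ _ _); apply: funext => s; rewrite row_mxEr.
Qed.

Lemma is_derive_quadratic m (f : R -> 'rV[R]_m) (w : 'rV[R]_m) (C h0 : R) : 0 < h0 ->
  (forall h : R, `|h| < h0 -> `|f h - f 0 - h *: w| <= C * h ^+ 2) -> is_derive (0 : R) 1 f w.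
Proof.
move=> h00 H.
have C0 : 0 <= C.
  have := H (h0 / 2); rewrite gtr0_norm ?divr_gt0 // => /(_ _) h.
  have : h0 / 2 < h0 by lra.
  move=> /h /(le_trans (normr_ge0 _)); rewrite pmulr_lge0 // exprn_gt0 // divr_gt0 //.
have L : (fun h : R => h^-1 *: (f (h *: 1 + 0) - f 0)) @ 0^' --> w.
  apply/cvgrPdist_le => e e0.
  have m0 : 0 < Num.min h0 (e / (C + 1)) by rewrite lt_min h00 divr_gt0 // ltr_wpDl.
  exists (Num.min h0 (e / (C + 1))) => //= h /=; rewrite sub0r normrN lt_min => /andP[h1 h2] hn.
  rewrite [h *: 1]mulr1 addr0.
  have -> : w - h^-1 *: (f h - f 0) = - (h^-1 *: (f h - f 0 - h *: w)).
    by rewrite [in RHS]scalerBr scalerA mulVf // scale1r opprB.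
  rewrite normrN normrZ normfV mulrC ler_pdivrMr ?normr_gt0 //.
  apply: le_trans (H h h1) _; rewrite -(real_normK (num_real h)).
  rewrite (expr2 `|h|) mulrA ler_wpM2r //.
  have : `|h| * (C + 1) <= e by rewrite -ler_pdivlMr ?ltW // ltr_wpDl.
  by rewrite mulrDr mulr1 mulrC; have := normr_ge0 h; lra.
apply: DeriveDef; first by apply/cvg_ex; exists w.
Transparent derive.
exact: cvg_lim.
Opaque derive.
Qed.

Lemma is_derive_from_line m (W : normedModType R) (f : 'rV[R]_m -> W) (z v : 'rV[R]_m) (w : W) :
  is_derive (0 : R) 1 (fun h : R => f (h *: v + z)) w -> is_derive z v f w.
Proof.
move=> [d e]; have d' : derivable f z v by apply/derivable1P.
apply: DeriveDef => //; rewrite -e.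
have := @is_derive_line R m W f z v 0; rewrite scale0r add0r => /(_ d')[_ ->].
by [].
Qed.

End RowMx.

Lemma ball_diameter {R : realType} (W : normedModType R) (a b z : W) (r : R) :
  `|a - z| < r -> `|b - z| < r -> `|a - b| <= 2 * r.
Proof. by have := ler_distD z a b; rewrite [`|z - b|]distrC; lra. Qed.

(** * Dependence of a flow on its initial value *)

Section FlowDerivative.
Context {R : realType} {m : nat}.
Local Notation V := 'rV[R]_m.

(** The error [x h - x 0 - h *: W] starts at 0 and satisfies the linearized equation up to a Taylor
    remainder of order [h ^+ 2]; the Gronwall bound makes it of order [h ^+ 2], so [W] is the
    derivative in [h]. *)
Lemma flow_derivative (U : set V) (F : V -> V) (z0 : V) (r K d h0 B : R) (x : R -> R -> V) (W : R -> V) (v : V) :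
  open U -> Ck 1 U F -> 0 < K -> d * K <= 2^-1 -> 0 < h0 -> 0 < r ->
  (forall x, `|x - z0| < r -> U x /\ forall v, `|'D_v F x| <= K * `|v|) ->
  (forall x y, `|x - z0| < r -> `|y - z0| < r -> `|F x - F y| <= K * `|x - y| /\
       `|F x - F y - 'D_(x - y) F y| <= K * `|x - y| ^+ 2) ->
  (forall h, `|h| < h0 -> x h 0 = h *: v + x 0 0 /\ forall t, - d < t < d ->
     `|x h t - z0| < r /\ is_derive t 1 (x h) (F (x h t))) ->
  W 0 = v -> (forall t, - d < t < d -> `|W t| <= B /\ is_derive t 1 W ('D_(W t) F (x 0 t))) ->
  forall t, - d < t < d -> is_derive (0 : R) 1 (fun h => x h t) (W t).
Proof.
move=> oU CF K0 dK h00 r0 b1 b2 hx W0 hW t td.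
have d0 : 0 < d by lra.
have z0' : `|0 : R| < h0 by rewrite normr0.
apply: (@is_derive_quadratic R m _ _ (2 * (d * (K * (2 * `|v|) ^+ 2))) h0) => // h hh.
have [x0 xt] := hx h hh; have [_ x0t] := hx 0 z0'.
(* The first order estimate, needed to see that the Taylor remainder is quadratic in [h]. *)
have E1 s : - d < s < d -> `|x h s - x 0 s| <= 2 * `|v| * `|h|.
  move=> sd.
  have := @short_gronwall R m (x h - x 0) (fun s => F (x h s) - F (x 0 s)) d K 0 (2 * r) (ltW K0) (lexx _) dK _ _ _ s sd.
  rewrite !fctE /= x0 addrK normrZ mulr0 addr0 => H; rewrite -mulrA [`|v| * _]mulrC; apply: H.
  - by move=> u ud; exact: (is_deriveB (xt u ud).2 (x0t u ud).2).
  - by move=> u ud; rewrite addr0; apply: (b2 _ _ (xt u ud).1 (x0t u ud).1).1.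
  by move=> u ud; exact: ball_diameter (xt u ud).1 (x0t u ud).1.
have := @short_gronwall R m (fun s => x h s - x 0 s - h *: W s)
  (fun s => F (x h s) - F (x 0 s) - h *: 'D_(W s) F (x 0 s)) d K (K * (2 * `|v| * `|h|) ^+ 2)
  (2 * r + `|h| * B) (ltW K0) _ dK _ _ _ t td.
rewrite /= x0 addrK W0 subrr normr0 add0r => H.
apply: le_trans (H _ _ _ _) _.
- by rewrite mulr_ge0 ?exprn_ge0 ?mulr_ge0 // ltW.
- move=> u ud; apply: (is_deriveB (is_deriveB (xt u ud).2 (x0t u ud).2)).
  by have := is_deriveZ (V := R^o) h (hW u ud).2.
- move=> u ud; have dF := Ck1_diff_mx oU CF (b1 _ (x0t u ud).1).1.
  have -> : F (x h u) - F (x 0 u) - h *: 'D_(W u) F (x 0 u) =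
     'D_(x h u - x 0 u - h *: W u) F (x 0 u) + (F (x h u) - F (x 0 u) - 'D_(x h u - x 0 u) F (x 0 u)).
    rewrite (deriveDl _ _ dF) -[- (h *: W u)]scaleNr (deriveZl _ _ dF) scaleNr.
    by rewrite [in RHS]addrC addrA subrK.
  apply: le_trans (ler_normD _ _) _; apply: lerD; first exact: (b1 _ (x0t u ud).1).2.
  apply: le_trans (b2 _ _ (xt u ud).1 (x0t u ud).1).2 _.
  by rewrite ler_pM2l // ler_pXn2r ?nnegrE ?mulr_ge0 // E1.
- move=> u ud; apply: le_trans (ler_normB _ _) _; apply: lerD.
    exact: ball_diameter (xt u ud).1 (x0t u ud).1.
  by rewrite normrZ ler_wpM2l //; apply: (hW u ud).1.
by rewrite !exprMn real_normK ?num_real // !mulrA.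
Qed.

Lemma short_uniqueness (F : V -> V) (z0 : V) (r K d : R) (x y : R -> V) :
  0 < K -> d * K <= 2^-1 ->
  (forall x y, `|x - z0| < r -> `|y - z0| < r -> `|F x - F y| <= K * `|x - y|) ->
  (forall t, - d < t < d -> `|x t - z0| < r /\ is_derive t 1 x (F (x t))) ->
  (forall t, - d < t < d -> `|y t - z0| < r /\ is_derive t 1 y (F (y t))) ->
  forall t, - d < t < d -> `|x t - y t| <= 2 * `|x 0 - y 0|.
Proof.
move=> K0 dK lip hx hy t td.
have := @short_gronwall R m (x - y) (fun s => F (x s) - F (y s)) d K 0 (2 * r) (ltW K0) (lexx _) dK _ _ _ t td.
rewrite !fctE /= mulr0 addr0; apply.
- by move=> u ud; exact: (is_deriveB (hx u ud).2 (hy u ud).2).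
- by move=> u ud; rewrite addr0; apply: lip; [exact: (hx u ud).1|exact: (hy u ud).1].
by move=> u ud; exact: ball_diameter (hx u ud).1 (hy u ud).1.
Qed.

End FlowDerivative.

Section LocalFlow.
Context {R : realType}.

(** Regularity is required in the initial value only, separately for each fixed time. *)
Definition flow_on m (F : 'rV[R]_m -> 'rV[R]_m) (U : set 'rV[R]_m) (k : nat) (z0 : 'rV[R]_m)
    (rho d : R) (Phi : R -> 'rV[R]_m -> 'rV[R]_m) :=
  [/\ 0 < rho, 0 < d, (forall y, `|y - z0| < rho -> Phi 0 y = y),
   (forall y t, `|y - z0| < rho -> - d < t < d ->
     U (Phi t y) /\ is_derive t 1 (fun s => Phi s y) (F (Phi t y))) &
   (forall t, - d < t < d -> Ck k [set y | `|y - z0| < rho] (Phi t))].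

(** The variational equation along the flow; for the geodesic field it becomes the Jacobi
    equation. *)
Definition linearized_flow m (F : 'rV[R]_m -> 'rV[R]_m) (z0 : 'rV[R]_m)
    (rho d : R) (Phi : R -> 'rV[R]_m -> 'rV[R]_m) :=
  forall y t v, `|y - z0| < rho -> - d < t < d ->
    is_derive t 1 (fun s => 'D_v (Phi s) y) ('D_('D_v (Phi t) y) F (Phi t y)).

Definition smooth_field m (U : set 'rV[R]_m) (F : 'rV[R]_m -> 'rV[R]_m) := open U /\ forall k, Ck k U F.

Lemma open_norm_lt m (z0 : 'rV[R]_m) (r : R) : open [set y | `|y - z0| < r].
Proof.
rewrite openE => u /= ur; apply: (@norm_lt_nbhs R _ u _ (r - `|u - z0|)); first by rewrite subr_gt0.
by move=> y hy /=; have := ler_distD u y z0; lra.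
Qed.

Lemma flow0 m (U : set 'rV[R]_m) F z0 : smooth_field U F -> U z0 ->
  exists rho d Phi, flow_on F U 0 z0 rho d Phi.
Proof.
move=> [oU CF] Uz0.
have [r [K [r0 K0 [b1 b2]]]] := local_taylor oU Uz0 (CF 2%N).
have lip x y : `|x - z0| < r -> `|y - z0| < r -> `|F x - F y| <= K * `|x - y|.
  by move=> hx hy; apply: (b2 _ _ hx hy).1.
have [d d0 [dK H]] := picard r0 K0 lip.
have /choice[X XP] : forall y, exists x : R -> 'rV[R]_m, `|y - z0| < r / 2 ->
    x 0 = y /\ forall t, - d < t < d -> `|x t - z0| < r /\ is_derive t 1 x (F (x t)).
  move=> y; have [hy|] := pselect (`|y - z0| < r / 2); last by move=> ny; exists (fun=> 0) => /ny.
  by have [x xP] := H y hy; exists x.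
exists (r / 2), d, (fun t y => X y t); split => //; first by rewrite divr_gt0.
- by move=> y /XP[].
- by move=> y t /XP[_ h] /h[h1 h2]; split => //; apply: (b1 _ h1).1.
move=> t td; split => // y /= hy.
have L x : `|x - z0| < r / 2 -> `|X y t - X x t| <= 2 * `|y - x|.
  move=> hx; have [x0 xt] := XP _ hx; have [y0 yt] := XP _ hy.
  by rewrite -{2}y0 -{2}x0; apply: short_uniqueness K0 dK lip yt xt t td.
apply/(@cvgrPdist_le R 'rV[R]_m 'rV[R]_m (nbhs y)) => e e0.
apply: (@norm_lt_nbhs R _ y _ (Num.min (e / 2) (r / 2 - `|y - z0|))).
  by rewrite lt_min divr_gt0 // subr_gt0.
move=> x; rewrite lt_min => /andP[h1 h2].
have hx : `|x - z0| < r / 2 by have := ler_distD y x z0; lra.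
by have := L x hx; rewrite [`|y - x|]distrC; lra.
Qed.

(** The first prolongation of [F]. For a vector field, its flow carries the flow of [F] together
    with the linearization; for a transition map, it is the induced change of coordinates of tangent
    vectors. *)
Definition extended_field m (F : 'rV[R]_m -> 'rV[R]_m) (w : 'rV[R]_(m + m)) : 'rV[R]_(m + m) :=
  row_mx (F (lsubmx w)) ('D_(rsubmx w) F (lsubmx w)).

Lemma open_lsubmx p q (U : set 'rV[R]_p) : open U -> open [set w : 'rV[R]_(p + q) | U (lsubmx w)].
Proof.
move=> oU; apply: (@open_comp _ _ (lsubmx : 'rV[R]_(p + q) -> _) U) => // w _.
by apply: Ck_cont (Ck_lsubmx (p := p) openT (Ck_id 0 _)) _.
Qed.

Lemma extended_fieldl m (F : 'rV[R]_m -> 'rV[R]_m) (w : 'rV[R]_(m + m)) :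
  lsubmx (extended_field F w) = F (lsubmx w).
Proof. exact: row_mxKl. Qed.

Lemma extended_fieldr m (F : 'rV[R]_m -> 'rV[R]_m) (w : 'rV[R]_(m + m)) :
  rsubmx (extended_field F w) = 'D_(rsubmx w) F (lsubmx w).
Proof. exact: row_mxKr. Qed.

Lemma extended_smooth m (U : set 'rV[R]_m) F : smooth_field U F ->
  forall k, Ck k [set w : 'rV[R]_(m + m) | U (lsubmx w)] (extended_field F).
Proof.
move=> [oU CF] k; have oW := open_lsubmx (q := m) oU.
have Cl := Ck_lsubmx (p := m) oW (Ck_id k _).
have Cr := Ck_rsubmx (p := m) oW (Ck_id k _).
apply: Ck_row_mx => //; first exact: (Ck_comp_mx oW oU _ Cl (CF k)).
apply/(Ck_mxP _ _ oW) => i j.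
have C i' : Ck k [set w : 'rV[R]_(m + m) | U (lsubmx w)]
    (fun w => (rsubmx w) 0 i' * ('D_(delta_mx 0 i') F (lsubmx w)) i j).
  apply: Ck_mul => //; first exact: ((Ck_mxP _ _ oW).1 Cr).
  have CD := (Ck_mxP _ _ oU).1 (Ck_derive (delta_mx 0 i') (CF k.+1)) i j.
  exact: (Ck_comp oW oU _ Cl CD).
apply: Ck_eq (Ck_sum (index_enum _) xpredT oW C) => // w /= Uw.
rewrite (derive_row_sum _ (Ck1_diff_mx oU (CF 1%N) Uw)) summxE.
by apply: eq_bigr => i' _; rewrite [RHS]mxE.
Qed.

(** The derivative of the flow of [F] in the direction [v] is the second half of the flow of the
    prolonged field starting at [(y, v)]. As that flow is C^k by assumption, the flow of [F] is
    C^(k+1). *)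
Lemma flow_step m (U : set 'rV[R]_m) F z0 k : smooth_field U F -> U z0 ->
  (forall (W : set 'rV[R]_(m + m)) G w0, smooth_field W G -> W w0 ->
     exists rho d Phi, flow_on G W k w0 rho d Phi) ->
  exists rho d Phi, flow_on F U k.+1 z0 rho d Phi /\ linearized_flow F z0 rho d Phi.
Proof.
move=> sF Uz0 IH; have [oU CF] := sF.
have [r [K [r0 K0 [b1 b2]]]] := local_taylor oU Uz0 (CF 2%N).
have lip x y : `|x - z0| < r -> `|y - z0| < r -> `|F x - F y| <= K * `|x - y|.
  by move=> hx hy; apply: (b2 _ _ hx hy).1.
(* The domain is cut down to a bounded set: this provides the a priori bounds on both halves that
   the Gronwall estimates need. *)
pose W := [set w : 'rV[R]_(m + m) | (`|lsubmx w - z0| < r /\ U (lsubmx w)) /\ `|w - row_mx z0 0| < r + `|z0| + 1].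
have oW : open W.
  apply: openI; last exact: open_norm_lt.
  apply: (@open_lsubmx _ _ [set x | `|x - z0| < r /\ U x]).
  by apply: openI => //; apply: open_norm_lt.
have sG : smooth_field W (extended_field F).
  split => // l; apply: Ck_sub (extended_smooth sF l).
  by move=> w [[_ ?] _].
have W0 : W (row_mx z0 0).
  by rewrite /W /= row_mxKl !subrr !normr0; do !split => //; rewrite ltr_wpDl // addr_ge0 // ltW.
have [rho [d' [Psi [rho0 d'0 P0 Pt PC]]]] := IH W _ _ sG W0.
pose d := Num.min d' (2 * K)^-1.
have d0 : 0 < d by rewrite lt_min d'0 invr_gt0 mulr_gt0.
have dK : d * K <= 2^-1.
  apply: (@le_trans _ _ ((2 * K)^-1 * K)); first by rewrite ler_pM2r // ge_min lexx orbT.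
  by rewrite invfM -mulrA mulVf ?gt_eqF // mulr1.
have dd' t : - d < t < d -> - d' < t < d'.
  have : d <= d' by rewrite ge_min lexx.
  lra.
have near2 (y v : 'rV[R]_m) : `|y - z0| < rho -> `|v| < rho -> `|row_mx y v - row_mx z0 0| < rho.
  by move=> hy hv; rewrite row_mxB subr0; apply: norm_row_mx_lt.
pose Phi t y : 'rV[R]_m := lsubmx (Psi t (row_mx y 0)).
have sol (y v : 'rV[R]_m) t : `|y - z0| < rho -> `|v| < rho -> - d < t < d ->
    [/\ W (Psi t (row_mx y v)),
     is_derive t 1 (fun s => lsubmx (Psi s (row_mx y v))) (F (lsubmx (Psi t (row_mx y v)))) &
     is_derive t 1 (fun s => rsubmx (Psi s (row_mx y v)))
        ('D_(rsubmx (Psi t (row_mx y v))) F (lsubmx (Psi t (row_mx y v))))].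
  move=> hy hv td; have [h1 h2] := Pt _ _ (near2 _ _ hy hv) (dd' _ td).
  split => //.
    by have := is_derive_lsubmx h2; rewrite /extended_field row_mxKl.
  by have := is_derive_rsubmx h2; rewrite /extended_field row_mxKr.
have n0 : `|0 : 'rV[R]_m| < rho by rewrite normr0.
(* The base curve does not depend on the tangent vector carried along. *)
have uniq (y v : 'rV[R]_m) t : `|y - z0| < rho -> `|v| < rho -> - d < t < d ->
    lsubmx (Psi t (row_mx y v)) = Phi t y.
  move=> hy hv td; apply/eqP; rewrite -subr_eq0 -normr_le0.
  have e0 : 2 * `|lsubmx (Psi 0 (row_mx y v)) - Phi 0 y| = 0.
    by rewrite /Phi !P0 ?near2 // !row_mxKl subrr normr0 mulr0.
  rewrite -e0.
  apply: (@short_uniqueness R m F z0 r K d (fun s => lsubmx (Psi s (row_mx y v))) (fun s => Phi s y) K0 dK lip) => // u ud.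
    by have [[[? _] _] ? _] := sol y v u hy hv ud.
  by have [[[? _] _] ? _] := sol y 0 u hy n0 ud.
have deriv (y v : 'rV[R]_m) t : `|y - z0| < rho -> `|v| < rho -> - d < t < d ->
    is_derive y v (Phi t) (rsubmx (Psi t (row_mx y v))).
  move=> hy hv td; apply: is_derive_from_line.
  pose h0 := (rho - `|y - z0|) / (`|v| + 1).
  have h00 : 0 < h0 by rewrite divr_gt0 ?subr_gt0 // ltr_wpDl.
  have hin h : `|h| < h0 -> `|h *: v + y - z0| < rho.
    move=> h1; have : `|h| * (`|v| + 1) < rho - `|y - z0| by rewrite -ltr_pdivlMr // ltr_wpDl.
    rewrite mulrDr mulr1 => hh; rewrite -addrA.
    apply: le_lt_trans (ler_normD _ _) _; rewrite normrZ.
    by have := normr_ge0 h; lra.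
  apply: (@flow_derivative R m U F z0 r K d h0 (r + `|z0| + 1) (fun h s => Phi s (h *: v + y))
     (fun s => rsubmx (Psi s (row_mx y v))) v oU (CF 1%N)) => //.
  - move=> h /hin hh; split; first by rewrite scale0r add0r /Phi !P0 ?near2 // !row_mxKl.
    by move=> s sd; have [[[? _] _] ? _] := sol _ 0 s hh n0 sd.
  - by rewrite P0 ?near2 // row_mxKr.
  move=> s sd; have [[_ h1] _ h2] := sol y v s hy hv sd; split; last first.
    by rewrite scale0r add0r -(uniq y v s hy hv sd).
  apply: le_trans _ (ltW h1); rewrite -[X in `|X|](_ : rsubmx (Psi s (row_mx y v) - row_mx z0 0) = _).
    exact: norm_rsubmx.
  by rewrite linearB /= row_mxKr subr0.
(* The prolonged flow is available for short [v] only; other directions are scaled into that range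
   and the derivative is scaled back. *)
pose c (v : 'rV[R]_m) := (`|v| + 1) / rho.
have c0 v : 0 < c v by rewrite divr_gt0 // ltr_wpDl.
have cv v : `|(c v)^-1 *: v| < rho.
  rewrite normrZ gtr0_norm ?invr_gt0 // /c invf_div mulrC mulrA ltr_pdivrMr ?ltr_wpDl //.
  by rewrite mulrC ltr_pM2l // ltrDl.
have D (y v : 'rV[R]_m) t : `|y - z0| < rho -> - d < t < d ->
    is_derive y v (Phi t) (c v *: rsubmx (Psi t (row_mx y ((c v)^-1 *: v)))).
  move=> hy td; have [d1 e1] := deriv y _ t hy (cv v) td.
  have E : c v *: ((c v)^-1 *: v) = v.
    by rewrite scalerA divff ?scale1r // gt_eqF.
  by have := derivable_scale (c v) d1; rewrite E e1.
pose N := [set y : 'rV[R]_m | `|y - z0| < rho].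
have oN : open N by apply: open_norm_lt.
have CPsi (v : 'rV[R]_m) t : `|v| < rho -> - d < t < d ->
    Ck k N (fun y => Psi t (row_mx y v)).
  move=> hv td.
  have C1 : Ck k N (fun y => row_mx y v) by apply: Ck_row_mx => //; [apply: Ck_id|apply: Ck_cst].
  have sub (y : 'rV[R]_m) : N y -> [set w | `|w - row_mx z0 0| < rho] (row_mx y v) by move=> hy; apply: near2.
  have oB : open [set w : 'rV[R]_(m + m) | `|w - row_mx z0 0| < rho] by apply: open_norm_lt.
  exact: (Ck_comp_mx oN oB sub C1 (PC _ (dd' _ td))).
have F0 y : `|y - z0| < rho -> Phi 0 y = y.
  by move=> hy; rewrite /Phi P0 ?near2 // row_mxKl.
have Ft y t : `|y - z0| < rho -> - d < t < d ->
    U (Phi t y) /\ is_derive t 1 (fun s => Phi s y) (F (Phi t y)).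
  move=> hy td; have [[[_ h1] _] h2 _] := sol y 0 t hy n0 td.
  exact: (conj h1 h2).
have FC t : - d < t < d -> Ck k.+1 N (Phi t).
  move=> td; split.
    by move=> y hy; exact: (Ck_cont (Ck_lsubmx (p := m) oN (CPsi 0 t n0 td)) hy).
  move=> v; split; first by move=> y hy; have [] := D y v t hy td.
  apply: (Ck_eq oN _ (Ck_scalemx (c v) oN (Ck_rsubmx (p := m) oN (CPsi _ t (cv v) td)))).
  by move=> y hy; have [_ ->] := D y v t hy td.
exists rho, d, Phi; split; first exact: And5 rho0 d0 F0 Ft FC.
move=> y t v hy td.
have [[[_ h1] _] _ h2] := sol y _ t hy (cv v) td.
have [_ ->] := D y v t hy td.
have Ut : U (Phi t y) by rewrite -(uniq y _ t hy (cv v) td).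
rewrite (deriveZl _ _ (Ck1_diff_mx oU (CF 1%N) Ut)) -(uniq y _ t hy (cv v) td).
have dt : 0 < Num.min (t + d) (d - t) by rewrite lt_min; lra.
have nr : \forall s \near t, (c v \*: (fun s => rsubmx (Psi s (row_mx y ((c v)^-1 *: v))))) s = 'D_v (Phi s) y.
  apply: (@norm_lt_nbhs R R^o t _ _ dt) => s; rewrite lt_min => /andP[s1 s2].
  have sd : - d < s < d by move: s1 s2; rewrite !ltr_norml => /andP[a b] /andP[a' b']; lra.
  by have [_ ->] := D y v s hy sd.
exact: (near_eq_is_derive nr (is_deriveZ (c v) h2)).
Qed.

(** Each order of smoothness doubles the dimension, so the induction on [k] ranges over all [m]. One
    further [flow_step] supplies the variational equation. *)
Theorem local_flow m (U : set 'rV[R]_m) F z0 k : smooth_field U F -> U z0 ->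
  exists rho d Phi, flow_on F U k z0 rho d Phi /\ linearized_flow F z0 rho d Phi.
Proof.
have W : forall k m (U : set 'rV[R]_m) F z0, smooth_field U F -> U z0 ->
   exists rho d Phi, flow_on F U k z0 rho d Phi.
  elim=> [|{}k IH] {}m {}U {}F {}z0; first exact: flow0.
  move=> sF Uz0; have [rho [d [Phi [h _]]]] := flow_step sF Uz0 (@IH _).
  by exists rho, d, Phi.
move=> sF Uz0; have [rho [d [Phi [[h1 h2 h3 h4 h5] h]]]] := flow_step sF Uz0 (@W k _).
by exists rho, d, Phi; split => //; split => // t /h5; apply: CkS.
Qed.

End LocalFlow.

(** * Levi-Civita connection and curvature *)

Section MatrixDerivative.
Context {R : realType} {V : normedModType R}.

Lemma is_derive_ext (W : normedModType R) (f g : V -> W) (x v : V) (df dg : W) :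
  is_derive x v f df -> (forall y, f y = g y) -> df = dg -> is_derive x v g dg.
Proof. by move=> h e <-; have <- : f = g by apply: funext. Qed.

Lemma is_derive_mxP p q (c : V -> 'M[R]_(p, q)) (t v : V) (dc : 'M[R]_(p, q)) :
  is_derive t v c dc <-> forall i j, is_derive t v (fun s => c s i j) (dc i j).
Proof.
split=> [[d <-] i j|h].
  apply: DeriveDef; first by have /derivable_mxP := d; apply.
  by rewrite (derive_mx d) mxE.
have d : derivable c t v by apply/derivable_mxP => i j; have [] := h i j.
by apply: DeriveDef => //; rewrite (derive_mx d); apply/matrixP => i j; rewrite mxE; have [] := h i j.
Qed.

Lemma is_derive_mulmx p q r (A : V -> 'M[R]_(p, q)) (B : V -> 'M[R]_(q, r)) (t v : V) dA dB :
  is_derive t v A dA -> is_derive t v B dB ->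
  is_derive t v (fun s => A s *m B s) (dA *m B t + A t *m dB).
Proof.
move=> /is_derive_mxP hA /is_derive_mxP hB; apply/is_derive_mxP => i j.
apply: is_derive_ext (is_derive_sum (fun k => is_deriveM (hA i k) (hB k j))) _ _.
  by move=> y; rewrite fct_sumE mxE.
rewrite !mxE -big_split /=; apply: eq_bigr => k _.
by rewrite -[_ *: dB k j]/(A t i k * dB k j) -[_ *: dA i k]/(B t k j * dA i k) addrC [B _ _ _ * _]mulrC.
Qed.

Lemma is_derive_trmx p q (A : V -> 'M[R]_(p, q)) (t v : V) dA :
  is_derive t v A dA -> is_derive t v (fun s => (A s)^T) dA^T.
Proof.
move=> /is_derive_mxP hA; apply/is_derive_mxP => i j.
by apply: is_derive_ext (hA j i) _ _ => [y|]; rewrite mxE.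
Qed.

Lemma is_derive_mxD p q (A B : V -> 'M[R]_(p, q)) (t v : V) dA dB :
  is_derive t v A dA -> is_derive t v B dB -> is_derive t v (fun s => A s + B s) (dA + dB).
Proof. by move=> hA hB; apply: is_derive_ext (is_deriveD hA hB) _ _. Qed.

End MatrixDerivative.

HB.lock Definition bf {R : realType} {N : nat} (A : 'M[R]_N) (v w : 'rV[R]_N) : R :=
  (v *m A *m w^T) 0 0.

Section BilinearForm.
Context {R : realType} {N : nat}.
Implicit Types (A B : 'M[R]_N) (u v w : 'rV[R]_N).

Lemma bfDl A u v w : bf A (u + v) w = bf A u w + bf A v w.
Proof. by rewrite bf.unlock !mulmxDl mxE. Qed.
Lemma bfZl A (k : R) v w : bf A (k *: v) w = k * bf A v w.
Proof. by rewrite bf.unlock -!scalemxAl mxE. Qed.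
Lemma bfNl A v w : bf A (- v) w = - bf A v w.
Proof. by rewrite -scaleN1r bfZl mulN1r. Qed.
Lemma bfBl A u v w : bf A (u - v) w = bf A u w - bf A v w.
Proof. by rewrite bfDl bfNl. Qed.
Lemma bf0l A w : bf A 0 w = 0.
Proof. by rewrite bf.unlock !mul0mx mxE. Qed.
Lemma bf_sym A v w : A^T = A -> bf A v w = bf A w v.
Proof.
move=> h; rewrite bf.unlock -[in LHS](trmxK (v *m A *m w^T)) [LHS]mxE.
by rewrite !trmx_mul trmxK h mulmxA.
Qed.
Lemma bfDr A u v w : bf A w (u + v) = bf A w u + bf A w v.
Proof. by rewrite bf.unlock linearD mulmxDr mxE. Qed.
Lemma bfZr A (k : R) v w : bf A w (k *: v) = k * bf A w v.
Proof. by rewrite bf.unlock linearZ /= -scalemxAr mxE. Qed.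
Lemma bfNr A v w : bf A w (- v) = - bf A w v.
Proof. by rewrite -scaleN1r bfZr mulN1r. Qed.
Lemma bfBr A u v w : bf A w (u - v) = bf A w u - bf A w v.
Proof. by rewrite bfDr bfNr. Qed.
Lemma bf0r A w : bf A w 0 = 0.
Proof. by rewrite bf.unlock linear0 mulmx0 mxE. Qed.

Lemma bfDA (A B : 'M[R]_N) v w : bf (A + B) v w = bf A v w + bf B v w.
Proof. by rewrite bf.unlock mulmxDr mulmxDl mxE. Qed.
Lemma bfZA (k : R) (A : 'M[R]_N) v w : bf (k *: A) v w = k * bf A v w.
Proof. by rewrite bf.unlock -scalemxAr -scalemxAl mxE. Qed.
Lemma bf_mulmxV A (r : 'rV[R]_N) w : A \in unitmx -> bf A (r *m invmx A) w = (r *m w^T) 0 0.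
Proof. by move=> uA; rewrite bf.unlock mulmxKV. Qed.

Lemma bf_ker A v w : v *m A = 0 -> bf A v w = 0.
Proof. by move=> h; rewrite bf.unlock h mul0mx mxE. Qed.

Lemma is_derive_bf {V : normedModType R} (A : V -> 'M[R]_N) (f g : V -> 'rV[R]_N) (t v : V) dA df dg :
  is_derive t v A dA -> is_derive t v f df -> is_derive t v g dg ->
  is_derive t v (fun s => bf (A s) (f s) (g s))
    (bf dA (f t) (g t) + bf (A t) df (g t) + bf (A t) (f t) dg).
Proof.
move=> hA hf hg.
have /is_derive_mxP/(_ 0 0) := is_derive_mulmx (is_derive_mulmx hf hA) (is_derive_trmx hg).
rewrite bf.unlock => h; apply: is_derive_ext h _ _ => //.
by rewrite mulmxDl [LHS]mxE [X in X + _]mxE [X in X + _]addrC.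
Qed.

Lemma Ck_bf m k (U : set 'rV[R]_m) (A : 'rV[R]_m -> 'M[R]_N) (f g : 'rV[R]_m -> 'rV[R]_N) : open U ->
  Ck k U A -> Ck k U f -> Ck k U g -> Ck k U (fun z => bf (A z) (f z) (g z)).
Proof.
move=> oU CA Cf Cg.
have Cgt : Ck k U (fun z => (g z)^T).
  apply/(Ck_mxP _ _ oU) => i j; have := (Ck_mxP _ _ oU).1 Cg j i.
  by apply: Ck_eq => // z _; rewrite mxE.
rewrite bf.unlock; exact: ((Ck_mxP _ _ oU).1 (Ck_mulmx oU (Ck_mulmx oU Cf CA) Cgt) 0 0).
Qed.

End BilinearForm.

Lemma inner_bf {R : realType} n (G : 'rV[R]_(n + n) -> 'M[R]_(n + n)) z u v : inner G z u v = bf (G z) u v.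
Proof. by rewrite bf.unlock. Qed.

(* [bf] and [Dmx] are locked: unification unfolds matrix products and derivatives far too eagerly. *)
HB.lock Definition Dmx {R : realType} {m p q} (a : 'rV[R]_m) (f : 'rV[R]_m -> 'M[R]_(p, q)) (z : 'rV[R]_m) : 'M[R]_(p, q) :=
  'D_a f z.

Lemma DmxE {R : realType} m p q (a : 'rV[R]_m) (f : 'rV[R]_m -> 'M[R]_(p, q)) z : 'D_a f z = Dmx a f z.
Proof. by rewrite Dmx.unlock. Qed.

Lemma DmxDl {R : realType} m p q (u v : 'rV[R]_m) (f : 'rV[R]_m -> 'M[R]_(p, q)) z : differentiable f z ->
  Dmx (u + v) f z = Dmx u f z + Dmx v f z.
Proof. by rewrite Dmx.unlock => d; apply: deriveDl. Qed.

Lemma DmxZl {R : realType} m p q (k : R) (v : 'rV[R]_m) (f : 'rV[R]_m -> 'M[R]_(p, q)) z : differentiable f z ->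
  Dmx (k *: v) f z = k *: Dmx v f z.
Proof. by rewrite Dmx.unlock => d; apply: deriveZl. Qed.

Section ChartGeometry.
Context {R : realType} {n : nat}.
Local Notation N := (n + n)%N.
Local Notation V := 'rV[R]_(n + n).
Context (U : set V) (G : V -> 'M[R]_(n + n)) (oU : open U) (riem : riemannian U G).
Implicit Types (z a b u v w x y : V).

Lemma metric_Ck k : Ck k U G. Proof. by have [h _ _] := riem; apply: h. Qed.
Lemma metric_sym z : U z -> (G z)^T = G z. Proof. by have [_ h _] := riem; apply: h. Qed.
Lemma metric_pos z v : U z -> v != 0 -> 0 < bf (G z) v v.
Proof. by have [_ _ h] := riem; rewrite -inner_bf; apply: h. Qed.

Lemma metric_eq0 z v : U z -> (forall w, bf (G z) v w = 0) -> v = 0.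
Proof.
move=> Uz h; apply: contrapT => /eqP v0.
by have := metric_pos Uz v0; rewrite h ltxx.
Qed.

Lemma metric_inj z v w : U z -> (forall x, bf (G z) v x = bf (G z) w x) -> v = w.
Proof.
move=> Uz h; apply/eqP; rewrite -subr_eq0; apply/eqP; apply: (metric_eq0 Uz) => x.
by rewrite bfBl h subrr.
Qed.

Lemma metric_ge0 z v : U z -> 0 <= bf (G z) v v.
Proof.
by move=> Uz; have [->|v0] := eqVneq v 0; [rewrite bf0l|rewrite ltW // metric_pos].
Qed.

Lemma metric_unit z : U z -> G z \in unitmx.
Proof.
move=> Uz; rewrite -row_free_unit; apply/inj_row_free => v h.
by apply: (metric_eq0 Uz) => w; apply: bf_ker.
Qed.

Lemma is_derive_metric z a : U z -> is_derive z a G (Dmx a G z).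
Proof. move=> Uz; rewrite -DmxE; apply: derivableP; apply: Ck_derivable (metric_Ck 1) Uz. Qed.

Lemma derive_inner z a v w : U z -> 'D_a (fun x => inner G x v w) z = bf (Dmx a G z) v w.
Proof.
move=> Uz; have -> : (fun x => inner G x v w) = (fun x => bf (G x) v w) by apply: funext => x; rewrite inner_bf.
have := is_derive_bf (is_derive_metric a Uz) (is_derive_cst v z a) (is_derive_cst w z a).
by move=> [_ ->]; rewrite (bf0l _ w) (bf0r _ v) !addr0.
Qed.

Lemma dmetric_sym z a : U z -> (Dmx a G z)^T = Dmx a G z.
Proof.
move=> Uz; have [_ <-] := is_derive_trmx (is_derive_metric a Uz); rewrite -DmxE.
apply: near_eq_derive; apply: filterS (open_nbhs_nbhs (conj oU Uz)) => x Ux.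
exact: metric_sym.
Qed.

Lemma metric_diff z : U z -> differentiable G z.
Proof. by move=> Uz; apply: Ck1_diff_mx oU (metric_Ck 1) Uz. Qed.

Definition chr z u v w : R :=
  2^-1 * (bf (Dmx u G z) v w + bf (Dmx v G z) u w - bf (Dmx w G z) u v).

Lemma christoffelE z u v w : U z -> christoffel G z u v w = chr z u v w.
Proof. by move=> Uz; rewrite /christoffel !derive_inner. Qed.

(** The covariant derivative along [u] of the constant field [v]: the first-kind symbols [chr] with
    the last index raised. *)
Definition Gam z u v : V := (\row_k chr z u v (delta_mx 0 k)) *m invmx (G z).

Lemma chr_linear3 z u v w : U z -> chr z u v w = \sum_k w 0 k * chr z u v (delta_mx 0 k).
Proof.
move=> Uz; have dG := metric_diff Uz.
have add w1 w2 : chr z u v (w1 + w2) = chr z u v w1 + chr z u v w2.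
  by rewrite /chr (DmxDl w1 w2 dG) bfDA !(bfDr _ w1 w2); ring.
have sc (k : R) w1 : chr z u v (k *: w1) = k * chr z u v w1.
  by rewrite /chr (DmxZl k w1 dG) bfZA !(bfZr _ k w1); ring.
have c0 : chr z u v 0 = 0 by have := sc 0 0; rewrite scale0r mul0r.
rewrite {1}(row_coord_sum w) (big_morph (chr z u v) add c0).
by apply: eq_bigr => k _; rewrite sc.
Qed.

Lemma GamE z u v w : U z -> bf (G z) (Gam z u v) w = chr z u v w.
Proof.
move=> Uz; rewrite /Gam bf_mulmxV ?metric_unit // (chr_linear3 u v w Uz) mxE.
by apply: eq_bigr => k _; rewrite !mxE mulrC.
Qed.

Lemma Gam_sym z u v : U z -> Gam z u v = Gam z v u.
Proof.
move=> Uz; apply: (metric_inj Uz) => w; rewrite !GamE // /chr.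
by rewrite (bf_sym u v (dmetric_sym w Uz)); ring.
Qed.

Lemma GamDl z u u' v : U z -> Gam z (u + u') v = Gam z u v + Gam z u' v.
Proof.
move=> Uz; have dG := metric_diff Uz; apply: (metric_inj Uz) => w.
by rewrite (bfDl _ (Gam z u v)) !GamE // /chr (DmxDl u u' dG) bfDA !(bfDl _ u u'); ring.
Qed.

Lemma GamZl z (k : R) u v : U z -> Gam z (k *: u) v = k *: Gam z u v.
Proof.
move=> Uz; have dG := metric_diff Uz; apply: (metric_inj Uz) => w.
by rewrite (bfZl _ k (Gam z u v)) !GamE // /chr (DmxZl k u dG) bfZA !(bfZl _ k u); ring.
Qed.

Lemma GamDr z u v v' : U z -> Gam z u (v + v') = Gam z u v + Gam z u v'.
Proof. by move=> Uz; rewrite !(Gam_sym u) // GamDl. Qed.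

Lemma GamZr z (k : R) u v : U z -> Gam z u (k *: v) = k *: Gam z u v.
Proof. by move=> Uz; rewrite !(Gam_sym u) // GamZl. Qed.

Lemma metric_compat z a v w : U z ->
  bf (Dmx a G z) v w = bf (G z) (Gam z a v) w + bf (G z) v (Gam z a w).
Proof.
move=> Uz; rewrite (bf_sym v _ (metric_sym Uz)) !GamE // /chr.
by rewrite (bf_sym w v (dmetric_sym a Uz)); lra.
Qed.

Lemma Gam_Ck k u v : Ck k U (fun z => Gam z u v).
Proof.
apply: Ck_mulmx => //; last first.
  by apply: Ck_invmx => //; [exact: metric_unit|exact: metric_Ck].
apply/(Ck_mxP _ _ oU) => i j.
have C a b c : Ck k U (fun z => bf (Dmx a G z) b c).
  have CD : Ck k U (fun z => Dmx a G z) by rewrite Dmx.unlock; exact: Ck_derive (metric_Ck k.+1).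
  exact: (Ck_bf oU CD (Ck_cst k U b) (Ck_cst k U c)).
apply: Ck_eq (Ck_scale (2^-1) oU (Ck_add oU (Ck_add oU (C u v (delta_mx 0 j)) (C v u (delta_mx 0 j)))
  (Ck_opp oU (C (delta_mx 0 j) u v)))) => // z _.
by rewrite mxE.
Qed.

Lemma is_derive_Gam z a u v : U z -> is_derive z a (fun x => Gam x u v) (Dmx a (fun x => Gam x u v) z).
Proof. move=> Uz; rewrite -DmxE; apply: derivableP; apply: Ck_derivable (Gam_Ck 1 u v) Uz. Qed.

(** The product rule for the Levi-Civita connection along a map [c]. The parameter space is
    arbitrary so that it covers curves, coordinate fields and the tangent coordinates alike. *)
Lemma covariant_product (D : normedModType R) (c : D -> V) (f g : D -> V) (t e : D) (dc df dg : V) :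
  U (c t) -> is_derive t e (G \o c) (Dmx dc G (c t)) -> is_derive t e f df -> is_derive t e g dg ->
  is_derive t e (fun s => bf (G (c s)) (f s) (g s))
    (bf (G (c t)) (df + Gam (c t) dc (f t)) (g t) + bf (G (c t)) (f t) (dg + Gam (c t) dc (g t))).
Proof.
move=> Uz hG hf hg; apply: is_derive_ext (is_derive_bf hG hf hg) _ _ => //=.
by rewrite metric_compat // (bfDl _ df) (bfDr _ dg); ring.
Qed.

(** The commutator of covariant derivatives on constant fields, whose brackets vanish. With this
    sign, [R4 z x y y x] is the sectional curvature when [x] and [y] are orthonormal. *)
Definition Rm z x y w : V :=
  Dmx x (fun p => Gam p y w) z - Dmx y (fun p => Gam p x w) z
  + Gam z x (Gam z y w) - Gam z y (Gam z x w).

Definition R4 z x y w v : R := bf (G z) (Rm z x y w) v.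

Lemma R4E z x y w v : R4 z x y w v = bf (G z) (Rm z x y w) v.
Proof. by []. Qed.

Lemma near_derive_eq (W : normedModType R) (f g : V -> W) z a : U z ->
  (forall p, U p -> f p = g p) -> 'D_a f z = 'D_a g z.
Proof.
by move=> Uz h; apply: near_eq_derive; apply: filterS (open_nbhs_nbhs (conj oU Uz)) => p; apply: h.
Qed.

Lemma Rm_skew z x y w : Rm z y x w = - Rm z x y w.
Proof. by apply/rowP => j; rewrite !mxE; ring. Qed.

Lemma Rm_bianchi z x y w : U z -> Rm z x y w + Rm z y w x + Rm z w x y = 0.
Proof.
move=> Uz; rewrite /Rm.
have E a b c : Dmx a (fun p => Gam p b c) z = Dmx a (fun p => Gam p c b) z.
  by rewrite -!DmxE; apply: near_derive_eq => // p; apply: Gam_sym.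
rewrite (E x w y) (E y x w) (E w y x) (Gam_sym w x Uz) (Gam_sym w y Uz) (Gam_sym y x Uz).
by apply/rowP => j; rewrite !mxE; ring.
Qed.

Lemma derive_dmetric z x y v w : U z ->
  'D_x (fun p => bf (Dmx y G p) w v) z =
    bf (G z) (Dmx x (fun p => Gam p y w) z + Gam z x (Gam z y w)) v + bf (G z) (Gam z y w) (Gam z x v)
  + (bf (G z) (Gam z x w) (Gam z y v) + bf (G z) w (Dmx x (fun p => Gam p y v) z + Gam z x (Gam z y v))).
Proof.
move=> Uz.
have hG : is_derive z x (G \o id) (Dmx x G (id z)) by exact: is_derive_metric.
have H1 := covariant_product Uz hG (is_derive_Gam x y w Uz) (is_derive_cst v z x).
have H2 := covariant_product Uz hG (is_derive_cst w z x) (is_derive_Gam x y v Uz).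
rewrite (near_derive_eq (g := (fun p => bf (G p) (Gam p y w) v + bf (G p) w (Gam p y v)))) //; last first.
  by move=> p Up; apply: metric_compat.
by have [_ ->] := is_deriveD H1 H2; rewrite !add0r.
Qed.

Lemma dmetric_schwarz z x y v w : U z ->
  'D_x (fun p => bf (Dmx y G p) w v) z = 'D_y (fun p => bf (Dmx x G p) w v) z.
Proof.
move=> Uz; have C : Ck 2 U (fun p => bf (G p) w v).
  exact: (Ck_bf oU (metric_Ck 2) (Ck_cst 2 U w) (Ck_cst 2 U v)).
have E a b : 'D_a (fun p => bf (Dmx b G p) w v) z = 'D_a (fun p => 'D_b (fun q => bf (G q) w v) p) z.
  by apply: near_derive_eq => // p Up; rewrite -derive_inner //; congr derive; apply: funext => q; rewrite inner_bf.
by rewrite !E (schwarz y x oU C Uz).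
Qed.

(** Second derivatives of the metric commute. Written out through the connection, their difference
    leaves exactly the symmetric part of the curvature in the last two slots. *)
Lemma R4_skew34 z x y w v : U z -> R4 z x y v w = - R4 z x y w v.
Proof.
move=> Uz; have := dmetric_schwarz x y v w Uz; rewrite !derive_dmetric // /R4 /Rm.
rewrite (bf_sym w (Dmx x _ _ + _) (metric_sym Uz)) (bf_sym w (Dmx y _ _ + _) (metric_sym Uz)).
by rewrite !bfBl !bfDl !bfNl; lra.
Qed.

Lemma R4_skew12 z x y w v : R4 z y x w v = - R4 z x y w v.
Proof. by rewrite /R4 Rm_skew bfNl. Qed.

Lemma R4_bianchi z x y w v : U z -> R4 z x y w v + R4 z y w x v + R4 z w x y v = 0.
Proof. by move=> Uz; rewrite /R4 -bfDl -bfDl Rm_bianchi // bf0l. Qed.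

(** The octahedron argument: four Bianchi identities combined by means of the two skew symmetries,
    whose instances are listed for linear arithmetic. *)
Lemma R4_pair z x y w v : U z -> R4 z x y w v = R4 z w v x y.
Proof.
move=> Uz.
have b1 := R4_bianchi x y w v Uz; have b2 := R4_bianchi y w v x Uz.
have b3 := R4_bianchi w v x y Uz; have b4 := R4_bianchi v x y w Uz.
have s a b c d := R4_skew34 a b c d Uz; have s' a b c d := R4_skew12 z a b c d.
have := s x y v w; have := s y w x v; have := s w x y v; have := s y w v x.
have := s w v x y; have := s v x y w; have := s v y w x; have := s w v y x.
have := s' v y w x; have := s' x v w y; have := s x v w y; have := s' w v x y.
have := s' x w v y; have := s x w v y; have := s w x v y; have := s' y v x w; have := s y v x w; have := s v y x w; have := s' y w x v; have := s' w x y v; have := s v x w y; have := s' v x y w; have := s' v x w y.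
lra.
Qed.

End ChartGeometry.

(** * Kähler curvature *)

Section KahlerChart.
Context {R : realType} {n : nat}.
Local Notation V := 'rV[R]_(n + n).
Context (U : set V) (G : V -> 'M[R]_(n + n)) (oU : open U) (riem : riemannian U G).
Context (hJ : J_invariant U G) (hK : forall z u v w, U z -> d_kahler_form G z u v w = 0).
Implicit Types (z a b u v w x y : V).
Local Notation J := (@stdJ R n).
Local Notation Gam := (Gam G).
Local Notation R4 := (R4 G).

Lemma stdJ_lshift v i k : J v i (lshift n k) = - v i (rshift n k).
Proof. by rewrite (ord1 i) row_mxEl !mxE. Qed.
Lemma stdJ_rshift v i k : J v i (rshift n k) = v i (lshift n k).
Proof. by rewrite (ord1 i) row_mxEr mxE. Qed.

Lemma stdJD u v : J (u + v) = J u + J v.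
Proof.
apply/rowP => j; case: (split_ordP j) => k ->; rewrite [RHS]mxE.
  by rewrite !stdJ_lshift [in LHS]mxE opprD.
by rewrite !stdJ_rshift [in LHS]mxE.
Qed.
Lemma stdJZ (k : R) v : J (k *: v) = k *: J v.
Proof.
apply/rowP => j; case: (split_ordP j) => i ->; rewrite [RHS]mxE.
  by rewrite !stdJ_lshift [in LHS]mxE mulrN.
by rewrite !stdJ_rshift [in LHS]mxE.
Qed.
Lemma stdJN v : J (- v) = - J v.
Proof. by rewrite -scaleN1r stdJZ scaleN1r. Qed.
Lemma stdJB u v : J (u - v) = J u - J v.
Proof. by rewrite stdJD stdJN. Qed.
Lemma stdJK v : J (J v) = - v.
Proof.
by apply/rowP => j; case: (split_ordP j) => i ->; rewrite [RHS]mxE ?stdJ_lshift ?stdJ_rshift ?stdJ_lshift.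
Qed.
Lemma stdJ0 : J 0 = 0. Proof. by have := stdJZ 0 0; rewrite !scale0r. Qed.

Lemma is_derive_stdJ (D : normedModType R) (f : D -> V) (t e : D) (df : V) :
  is_derive t e f df -> is_derive t e (fun s => J (f s)) (J df).
Proof.
move=> /is_derive_mxP h; apply/is_derive_mxP => i j; case: (split_ordP j) => k ->.
  by apply: is_derive_ext (is_deriveN (h i (rshift n k))) _ _ => [s|]; rewrite stdJ_lshift.
by apply: is_derive_ext (h i (lshift n k)) _ _ => [s|]; rewrite stdJ_rshift.
Qed.

Lemma metric_J z v w : U z -> bf (G z) (J v) (J w) = bf (G z) v w.
Proof. by move=> Uz; rewrite -!inner_bf hJ. Qed.

Lemma metric_Jl z v w : U z -> bf (G z) (J v) w = - bf (G z) v (J w).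
Proof. by move=> Uz; rewrite -(metric_J v (J w) Uz) stdJK bfNr opprK. Qed.

Lemma dmetric_J z a v w : U z -> bf (Dmx a G z) (J v) (J w) = bf (Dmx a G z) v w.
Proof.
move=> Uz; rewrite -!(derive_inner riem) //.
by apply: near_derive_eq Uz _ => // p Up; rewrite !inner_bf metric_J.
Qed.

Lemma dmetric_Jl z a v w : U z -> bf (Dmx a G z) (J v) w = - bf (Dmx a G z) v (J w).
Proof. by move=> Uz; rewrite -(dmetric_J a v (J w) Uz) stdJK bfNr opprK. Qed.

Lemma dkahler0 z u v w : U z ->
  bf (Dmx u G z) (J v) w + bf (Dmx v G z) (J w) u + bf (Dmx w G z) (J u) v = 0.
Proof.
by move=> Uz; have := hK u v w Uz; rewrite /d_kahler_form /kahler_form !(derive_inner riem).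
Qed.

(* The Levi-Civita connection is complex linear because the Kähler form is closed. *)
Lemma Gam_J z u v : U z -> Gam z u (J v) = J (Gam z u v).
Proof.
move=> Uz; apply: (metric_inj riem Uz) => w.
rewrite metric_Jl // !(GamE oU riem) // /chr.
have := dkahler0 (J v) (J w) u Uz; rewrite !stdJK !bfNl.
have := dkahler0 v w u Uz.
have s a b c := bf_sym b c (dmetric_sym oU riem a Uz).
have := s v (J w) u; have := dmetric_Jl w u v Uz; have := s (J v) w u.
have := dmetric_J (J w) u v Uz; have := dmetric_Jl u v w Uz.
lra.
Qed.

Lemma Gam_Jl z u v : U z -> Gam z (J u) v = J (Gam z u v).
Proof. by move=> Uz; rewrite (Gam_sym oU riem _ _ Uz) Gam_J // (Gam_sym oU riem u v Uz). Qed.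

Lemma dGam_J z x u v : U z ->
  Dmx x (fun p => Gam p u (J v)) z = J (Dmx x (fun p => Gam p u v) z).
Proof.
move=> Uz; have [_ <-] := is_derive_stdJ (is_derive_Gam oU riem x u v Uz); rewrite -DmxE.
by apply: (near_derive_eq oU) Uz _ => p; exact: Gam_J.
Qed.

Lemma dGam_Jl z x u v : U z ->
  Dmx x (fun p => Gam p (J u) v) z = J (Dmx x (fun p => Gam p u v) z).
Proof.
move=> Uz; have [_ <-] := is_derive_stdJ (is_derive_Gam oU riem x u v Uz); rewrite -DmxE.
by apply: (near_derive_eq oU) Uz _ => p; exact: Gam_Jl.
Qed.

Lemma Rm_J z x y w : U z -> Rm G z x y (J w) = J (Rm G z x y w).
Proof. by move=> Uz; rewrite /Rm !dGam_J // !Gam_J // !(stdJB, stdJD). Qed.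

Lemma R4_J z x y w v : U z -> R4 z x y (J w) (J v) = R4 z x y w v.
Proof. by move=> Uz; rewrite !R4E Rm_J // metric_J. Qed.

Lemma R4_Jl z x y w v : U z -> R4 z (J x) (J y) w v = R4 z x y w v.
Proof. by move=> Uz; rewrite (R4_pair oU riem _ _ w v Uz) R4_J // (R4_pair oU riem w v x y Uz). Qed.

(** The bisectional curvature of the complex lines of [x] and [y] in real terms; [Bis z x x] is the
    holomorphic sectional curvature of a unit [x]. *)
Definition Bis z x y : R := R4 z y (J y) (J x) x.

(** Complex linearity of the connection removes all but the derivatives of the metric along [y] and
    [J y]. This is the shape that the coordinate formula of [curv] takes after contraction. *)
Lemma BisE z x y : U z ->
  Bis z x y = - 2^-1 * ('D_y (fun p => bf (Dmx y G p) x x) z + 'D_(J y) (fun p => bf (Dmx (J y) G p) x x) z)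
    + 2 * bf (G z) (Gam z y x) (Gam z y x).
Proof.
move=> Uz; rewrite !(derive_dmetric oU riem) // /Bis !R4E Rm_J // /Rm.
rewrite !Gam_Jl // !Gam_J // !dGam_Jl // !stdJK metric_J //.
rewrite (bf_sym x _ (metric_sym riem Uz)) [bf _ x (J _ + _)](bf_sym _ _ (metric_sym riem Uz)).
rewrite !(stdJD, stdJN, stdJK) !(bfDl, bfNl).
lra.
Qed.

Lemma R4Dr z x y w v v' : R4 z x y w (v + v') = R4 z x y w v + R4 z x y w v'.
Proof. by rewrite !R4E bfDr. Qed.
Lemma R4Zr z x y w (k : R) v : R4 z x y w (k *: v) = k * R4 z x y w v.
Proof. by rewrite !R4E bfZr. Qed.

Lemma R4D3 z x y w w' v : U z -> R4 z x y (w + w') v = R4 z x y w v + R4 z x y w' v.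
Proof. by move=> Uz; rewrite !(R4_skew34 oU riem x y v _ Uz) R4Dr opprD. Qed.
Lemma R4Z3 z x y w (k : R) v : U z -> R4 z x y (k *: w) v = k * R4 z x y w v.
Proof. by move=> Uz; rewrite !(R4_skew34 oU riem x y v _ Uz) R4Zr mulrN. Qed.
Lemma R4D2 z x y y' w v : U z -> R4 z x (y + y') w v = R4 z x y w v + R4 z x y' w v.
Proof. by move=> Uz; rewrite !(R4_pair oU riem x _ w v Uz) R4Dr. Qed.
Lemma R4Z2 z x y w (k : R) v : U z -> R4 z x (k *: y) w v = k * R4 z x y w v.
Proof. by move=> Uz; rewrite !(R4_pair oU riem x _ w v Uz) R4Zr. Qed.
Lemma R4D1 z x x' y w v : U z -> R4 z (x + x') y w v = R4 z x y w v + R4 z x' y w v.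
Proof. by move=> Uz; rewrite !(R4_pair oU riem _ y w v Uz) R4D3. Qed.
Lemma R4Z1 z x y w (k : R) v : U z -> R4 z (k *: x) y w v = k * R4 z x y w v.
Proof. by move=> Uz; rewrite !(R4_pair oU riem _ y w v Uz) R4Z3. Qed.

Lemma BisZ z (k l : R) x y : U z -> Bis z (k *: x) (l *: y) = k ^+ 2 * l ^+ 2 * Bis z x y.
Proof. by move=> Uz; rewrite /Bis !stdJZ R4Z1 // R4Z2 // R4Z3 // R4Zr; ring. Qed.

(** By the Bianchi identity, [Bis z x y] is R(x, y, y, x) + R(x, Jy, Jy, x); the last three terms on
    the right add up to twice the difference of these two curvatures, so that only the first one
    survives. *)
Lemma sectional_polarization z x y : U z ->
  4 * R4 z x y y x = 2 * Bis z x y + Bis z (x + y) (x - y) - Bis z x x - Bis z y y.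
Proof.
move=> Uz; rewrite /Bis !stdJB !stdJD.
have N1 a b c d : R4 z (- a) b c d = - R4 z a b c d by rewrite -scaleN1r R4Z1 // mulN1r.
have N2 a b c d : R4 z a (- b) c d = - R4 z a b c d by rewrite -scaleN1r R4Z2 // mulN1r.
rewrite !(R4D1, R4D2, R4D3, R4Dr, N1, N2) //.
have j a b c d := R4_J a b c d Uz; have jl a b c d := R4_Jl a b c d Uz.
have p a b c d := R4_pair oU riem a b c d Uz.
have s a b c d := R4_skew34 oU riem a b c d Uz; have s' a b c d := R4_skew12 G z a b c d.
have e1 c d : R4 z y (J x) c d = R4 z x (J y) c d.
  by rewrite -(jl y (J x)) stdJK N2 s' opprK.
have e2 a b : R4 z a b (J x) y = R4 z a b (J y) x.
  by rewrite (s a b y (J x)) (p a b y (J x)) e1 -(p a b x (J y)) (s a b x (J y)).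
rewrite !e1 !e2 (p x (J y) (J x) x) (p x (J y) (J y) y).
have b := R4_bianchi oU riem y (J y) (J x) x Uz.
have b1 : R4 z (J y) (J x) y x = - R4 z x y y x by rewrite jl s'.
have b2 : R4 z (J x) y (J y) x = - R4 z x (J y) (J y) x.
  by rewrite -(jl (J x) y) stdJK N1.
rewrite b1 b2 in b.
have c1 : R4 z (J x) x x (J y) = R4 z x (J x) (J y) x by rewrite s s' opprK.
have c2 : R4 z (J y) y x (J y) = R4 z y (J y) (J y) x by rewrite s s' opprK.
have c3 : R4 z x (J x) (J y) y = R4 z y (J y) (J x) x by rewrite p s s' opprK.
by rewrite c1 c2 c3; clear -b; lra.
Qed.

Section Bounds.
Context (hB : forall z x y, U z -> bf (G z) x x = 1 -> bf (G z) y y = 1 -> 0 < Bis z x y <= 1).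

Lemma normalize z x : U z -> x != 0 ->
  exists k e, [/\ x = k *: e, bf (G z) e e = 1, 0 < k & k ^+ 2 = bf (G z) x x].
Proof.
move=> Uz x0; have px := metric_pos riem Uz x0.
exists (Num.sqrt (bf (G z) x x)), ((Num.sqrt (bf (G z) x x))^-1 *: x).
have k0 : 0 < Num.sqrt (bf (G z) x x) by rewrite sqrtr_gt0.
have k2 : Num.sqrt (bf (G z) x x) ^+ 2 = bf (G z) x x by rewrite sqr_sqrtr // ltW.
split => //; first by rewrite scalerA divff ?scale1r // gt_eqF.
rewrite bfZl bfZr -{3}k2; move: (Num.sqrt _) k0 => k k0; field; by rewrite gt_eqF.
Qed.

Lemma Bis_gt0 z x y : U z -> x != 0 -> y != 0 -> 0 < Bis z x y.
Proof.
move=> Uz /(normalize Uz)[k [e [-> e1 k0 _]]] /(normalize Uz)[l [f [-> f1 l0 _]]].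
rewrite BisZ // mulr_gt0 ?mulr_gt0 ?exprn_gt0 //.
by have /andP[] := hB Uz e1 f1.
Qed.

Lemma Bis0 z x y : U z -> (x == 0) || (y == 0) -> Bis z x y = 0.
Proof.
move=> Uz /orP[]/eqP->.
  by have := BisZ 0 1 0 y Uz; rewrite scale0r scale1r => ->; rewrite expr0n !mul0r.
by have := BisZ 1 0 x 0 Uz; rewrite scale0r scale1r => ->; rewrite expr0n mulr0 !mul0r.
Qed.

Lemma Bis_bounds z x y : U z -> 0 <= Bis z x y <= bf (G z) x x * bf (G z) y y.
Proof.
move=> Uz; have [xy0|] := boolP ((x == 0) || (y == 0)).
  rewrite Bis0 // lexx mulr_ge0 //; exact: (metric_ge0 riem).
rewrite negb_or => /andP[x0 y0]; rewrite ltW ?Bis_gt0 //=.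
have [k [e [-> e1 k0 <-]]] := normalize Uz x0; have [l [f [-> f1 l0 <-]]] := normalize Uz y0.
have p0 : 0 <= k ^+ 2 * l ^+ 2 by apply: mulr_ge0; apply: sqr_ge0.
by have /andP[_ h] := hB Uz e1 f1; rewrite BisZ // ler_piMr.
Qed.

(** For unit [e], [f] with inner product [c], polarization bounds 4 R(e, f, f, e) by
    [2 + (2 + 2 c) (2 - 2 c) <= 6], the holomorphic curvatures being nonnegative. This is the origin
    of 3/2. *)
Lemma sectional_bound z x y : U z -> 2 * R4 z x y y x <= 3 * (bf (G z) x x * bf (G z) y y).
Proof.
move=> Uz; have [->|x0] := eqVneq x 0.
  by have := R4Zr z 0 y y 0 0; rewrite scale0r mul0r => ->; rewrite bf0l mul0r !mulr0.
have [->|y0] := eqVneq y 0.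
  have := R4Z2 x 0 0 0 x Uz; rewrite scale0r mul0r => ->; by rewrite bf0l !mulr0.
have [k [e [-> e1 k0 <-]]] := normalize Uz x0; have [l [f [-> f1 l0 <-]]] := normalize Uz y0.
rewrite R4Z1 // R4Z2 // R4Z3 // R4Zr.
have : 4 * R4 z e f f e <= 6.
  rewrite sectional_polarization //.
  have /andP[_ b1] := Bis_bounds e f Uz; have /andP[_ b2] := Bis_bounds (e + f) (e - f) Uz.
  have /andP[b3 _] := Bis_bounds e e Uz; have /andP[b4 _] := Bis_bounds f f Uz.
  rewrite e1 f1 in b1; move: b2.
  rewrite !bfDl !bfDr !bfNl !bfNr e1 f1 (bf_sym f e (metric_sym riem Uz)).
  move: (bf _ e f) (Bis z _ _) b1 b3 b4 => c B; nra.
have : 0 <= k ^+ 2 * l ^+ 2 by apply: mulr_ge0; apply: sqr_ge0.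
rewrite !expr2; move: (R4 z e f f e) => r; nra.
Qed.

End Bounds.
End KahlerChart.

(** * From complex to real bisectional curvature *)

Section ComplexCurvature.
Context {R : realType} {n : nat}.
Local Notation V := 'rV[R]_(n + n).
Local Notation J := (@stdJ R n).
Local Notation C := R[i].
Implicit Types (a b x y v w z : V) (A B : 'M[R]_(n + n)).

Lemma complex_ext (p q : C) : complex.Re p = complex.Re q -> complex.Im p = complex.Im q -> p = q.
Proof. by case: p => a b; case: q => c d /= -> ->. Qed.

(** The coefficients of (x - i J x) / 2 in the frame d/dz^k. This vector has Hermitian norm 1 when
    the real norm of [x] is the square root of 2. *)
Definition cx x : 'rV[C]_n := \row_k Complex (x 0 (lshift n k)) (x 0 (rshift n k)).
Definition frame (k : 'I_n) : V := frame_x k.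

Lemma frame_yJ (k : 'I_n) : frame_y k = J (frame k).
Proof.
apply/rowP => j; case: (split_ordP j) => i ->.
  rewrite stdJ_lshift /frame /frame_x /frame_y [LHS]mxE [in RHS]mxE eq_lrshift eq_rlshift.
  by rewrite !andbF oppr0.
by rewrite stdJ_rshift /frame /frame_x /frame_y [LHS]mxE [RHS]mxE eq_rshift eq_lshift.
Qed.

Lemma vec_frames x : x = \sum_k (x 0 (lshift n k) *: frame k + x 0 (rshift n k) *: J (frame k)).
Proof.
rewrite {1}(row_coord_sum x) big_split_ord /= -big_split /=; apply: eq_bigr => k _.
by rewrite -frame_yJ.
Qed.

Definition rlin (F : V -> C) := (forall a b, F (a + b) = F a + F b) /\
  (forall (c : R) a, F (c *: a) = Complex c 0 * F a).

Lemma rlin_sum F x : rlin F ->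
  F x = \sum_k (Complex (x 0 (lshift n k)) 0 * F (frame k) + Complex (x 0 (rshift n k)) 0 * F (J (frame k))).
Proof.
move=> [hformDA hformZA]; have h0 : F 0 = 0 by have := hformZA 0 0; rewrite scale0r => ->; rewrite mul0r.
rewrite {1}(vec_frames x) (big_morph F hformDA h0); apply: eq_bigr => k _.
by rewrite hformDA !hformZA.
Qed.

(** Contracting with [cx x] evaluates a complex linear form at the real vector [x]. All index sums
    in the bisectional curvature are collapsed by this lemma and its antilinear companion. *)
Lemma clinear_sum F x : rlin F -> (forall a, F (J a) = 'i * F a) ->
  \sum_k cx x 0 k * F (frame k) = F x.
Proof.
move=> hF hJ; rewrite (rlin_sum x hF); apply: eq_bigr => k _.
rewrite hJ mxE; case: (F (frame k)) => p q; apply: complex_ext => /=; ring.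
Qed.

Lemma antilinear_sum F x : rlin F -> (forall a, F (J a) = - 'i * F a) ->
  \sum_k (cx x 0 k)^* * F (frame k) = F x.
Proof.
move=> hF hJ; rewrite (rlin_sum x hF); apply: eq_bigr => k _.
rewrite hJ mxE; case: (F (frame k)) => p q; apply: complex_ext => /=; ring.
Qed.

Definition herm A := A^T = A /\ forall v w, bf A (J v) (J w) = bf A v w.

(** The Hermitian form of a J-invariant symmetric [A], linear in [a] and antilinear in [b]. The
    factor 1/2 makes its values on [frame] equal to [gC]. *)
Definition hform A a b : C := Complex (2^-1 * bf A a b) (2^-1 * bf A a (J b)).

Lemma herm_Jl A v w : herm A -> bf A (J v) w = - bf A v (J w).
Proof. by move=> [_ hA]; rewrite -(hA v (J w)) stdJK bfNr opprK. Qed.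

Lemma hform_J1 A a b : herm A -> hform A (J a) b = 'i * hform A a b.
Proof.
move=> hA; apply: complex_ext => /=; first by rewrite herm_Jl //; ring.
by rewrite hA.2; ring.
Qed.
Lemma hform_J2 A a b : herm A -> hform A a (J b) = - 'i * hform A a b.
Proof. by move=> hA; apply: complex_ext => /=; rewrite ?stdJK ?bfNr; ring. Qed.
Lemma hform_sym A a b : herm A -> hform A b a = (hform A a b)^*.
Proof.
move=> hA; apply: complex_ext => /=; first by rewrite (bf_sym b a hA.1).
by rewrite (bf_sym b _ hA.1) herm_Jl //; ring.
Qed.
Lemma hform_rlin1 A b : rlin (fun a => hform A a b).
Proof.
split=> [a a'|c a]; apply: complex_ext => /=; rewrite ?bfDl ?bfZl; ring.
Qed.
Lemma hform_rlin2 A a : rlin (fun b => hform A a b).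
Proof.
split=> [b b'|c b]; apply: complex_ext => /=; rewrite ?stdJD ?stdJZ ?bfDr ?bfZr; ring.
Qed.
Lemma hformDA A B a b : hform (A + B) a b = hform A a b + hform B a b.
Proof. by apply: complex_ext => /=; rewrite !bfDA; ring. Qed.
Lemma hformZA (c : R) A a b : hform (c *: A) a b = Complex c 0 * hform A a b.
Proof. by apply: complex_ext => /=; rewrite !bfZA; ring. Qed.

Lemma hform_sum1 A x b : herm A -> \sum_k cx x 0 k * hform A (frame k) b = hform A x b.
Proof. by move=> hA; apply: (@clinear_sum (fun a => hform A a b)); [apply: hform_rlin1|move=> a; apply: hform_J1]. Qed.
Lemma hform_sum2 A a x : herm A -> \sum_k (cx x 0 k)^* * hform A a (frame k) = hform A a x.
Proof. by move=> hA; apply: (@antilinear_sum (fun b => hform A a b)); [apply: hform_rlin2|move=> b; apply: hform_J2]. Qed.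

Lemma innerC_real (G : V -> 'M[R]_(n + n)) z v w :
  innerC G z (map_mx (real_complex R) v) (map_mx (real_complex R) w) = Complex (bf (G z) v w) 0.
Proof. by rewrite bf.unlock /innerC map_trmx -!map_mxM mxE. Qed.

Lemma innerC_Dl G z (u u' w : 'rV[C]_(n + n)) : innerC G z (u + u') w = innerC G z u w + innerC G z u' w.
Proof. by rewrite /innerC !mulmxDl mxE. Qed.
Lemma innerC_Zl G z (c : C) (u w : 'rV[C]_(n + n)) : innerC G z (c *: u) w = c * innerC G z u w.
Proof. by rewrite /innerC -!scalemxAl mxE. Qed.
Lemma innerC_Dr G z (u u' w : 'rV[C]_(n + n)) : innerC G z w (u + u') = innerC G z w u + innerC G z w u'.
Proof. by rewrite /innerC linearD mulmxDr mxE. Qed.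
Lemma innerC_Zr G z (c : C) (u w : 'rV[C]_(n + n)) : innerC G z w (c *: u) = c * innerC G z w u.
Proof. by rewrite /innerC linearZ /= -scalemxAr mxE. Qed.

Lemma half_complex : (2^-1 : C) = Complex 2^-1 0.
Proof. by apply: complex_ext => /=; field. Qed.

Lemma gC_hform G z i j : herm (G z) -> gC G z i j = hform (G z) (frame i) (frame j).
Proof.
move=> hG; rewrite mxE /frame_z /frame_zbar !frame_yJ innerC_Zl innerC_Zr.
rewrite -scaleNr !innerC_Dl !innerC_Dr !innerC_Zl !innerC_Zr !innerC_real half_complex.
rewrite hG.2 (herm_Jl _ _ hG).
apply: complex_ext => /=; lra.
Qed.

Lemma unit10_hform G z x : herm (G z) -> bf (G z) x x = 2 -> unit10 G z (cx x).
Proof.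
move=> hG x2; rewrite /unit10.
have -> : \sum_i \sum_j gC G z i j * cx x 0 i * (cx x 0 j)^* = hform (G z) x x.
  rewrite -(hform_sum1 x x hG); apply: eq_bigr => i _.
  rewrite -(hform_sum2 (frame i) x hG) mulr_sumr; apply: eq_bigr => j _.
  by rewrite gC_hform //; ring.
apply: complex_ext => /=; first by rewrite x2 mulVf.
have := herm_Jl x x hG; rewrite (bf_sym (J x) x hG.1) => e.
have : bf (G z) x (J x) = 0 by lra.
by move=> ->; rewrite mulr0.
Qed.

Definition is_derC z v (f : V -> C) (w : C) :=
  is_derive z v (fun p => complex.Re (f p)) (complex.Re w) /\
  is_derive z v (fun p => complex.Im (f p)) (complex.Im w).

Lemma derCE z v f (w : C) : is_derC z v f w -> derC v f z = w.
Proof. by move=> [[_ e1] [_ e2]]; apply: complex_ext; rewrite /= ?e1 ?e2. Qed.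

Lemma is_derC_near z v f g (w : C) : (\near z, f z = g z) -> is_derC z v f w -> is_derC z v g w.
Proof.
move=> e [d1 d2]; split; [apply: near_eq_is_derive d1|apply: near_eq_is_derive d2];
  by apply: filterS e => p ->.
Qed.

Lemma is_derC_D z v f g (w w' : C) : is_derC z v f w -> is_derC z v g w' ->
  is_derC z v (fun p => f p + g p) (w + w').
Proof.
move=> [d1 d2] [e1 e2]; split.
  apply: is_derive_ext (is_deriveD d1 e1) _ _ => [p|] /=; last by case: (w) (w') => ? ? [].
  by rewrite -[LHS]/(_ + _); case: (f p) (g p) => ? ? [].
apply: is_derive_ext (is_deriveD d2 e2) _ _ => [p|] /=; last by case: (w) (w') => ? ? [].
by rewrite -[LHS]/(_ + _); case: (f p) (g p) => ? ? [].
Qed.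

Lemma is_derC_Z z v f (c w : C) : is_derC z v f w -> is_derC z v (fun p => c * f p) (c * w).
Proof.
move=> [d1 d2]; case: c => c1 c2; split.
  apply: is_derive_ext (is_deriveB (is_deriveZ c1 d1) (is_deriveZ c2 d2)) _ _ => [p|] /=; last by case: (w).
  by rewrite -[LHS]/(c1 * _ - c2 * _); case: (f p).
apply: is_derive_ext (is_deriveD (is_deriveZ c1 d2) (is_deriveZ c2 d1)) _ _ => [p|] /=; last by case: (w).
by rewrite -[LHS]/(c1 * _ + c2 * _); case: (f p).
Qed.

Lemma is_derC_hform z v (M : V -> 'M[R]_(n + n)) dM a b : is_derive z v M dM ->
  is_derC z v (fun p => hform (M p) a b) (hform dM a b).
Proof.
move=> hM; have H w : is_derive z v (fun p => 2^-1 * bf (M p) a w) (2^-1 * bf dM a w).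
  have := is_deriveZ 2^-1 (is_derive_bf hM (is_derive_cst a z v) (is_derive_cst w z v)).
  by move=> d; apply: is_derive_ext d _ _ => //; rewrite bf0l bf0r !addr0.
by split; [exact: (H b)|exact: (H (J b))].
Qed.

End ComplexCurvature.

Section ComplexToReal.
Context {R : realType} {n : nat}.
Local Notation V := 'rV[R]_(n + n).
Context (U : set V) (G : V -> 'M[R]_(n + n)) (oU : open U) (riem : riemannian U G).
Context (hJ : J_invariant U G) (hK : forall z u v w, U z -> d_kahler_form G z u v w = 0).
Local Notation J := (@stdJ R n).
Local Notation C := R[i].
Implicit Types (a b x y v w z : V).

Lemma herm_metric z : U z -> herm (G z).
Proof. by move=> Uz; split; [exact: (metric_sym riem)|move=> v w; exact: (metric_J hJ)]. Qed.

Lemma herm_dmetric z a : U z -> herm (Dmx a G z).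
Proof. by move=> Uz; split; [exact: (dmetric_sym oU riem)|move=> v w; exact: (dmetric_J oU riem hJ)]. Qed.

Lemma is_derive_dmetric z a b : U z -> is_derive z a (Dmx b G) (Dmx a (Dmx b G) z).
Proof.
move=> Uz; have C2 : Ck 1 U (Dmx b G).
  by rewrite Dmx.unlock; exact: (Ck_derive b (metric_Ck riem 2)).
by rewrite -DmxE; apply: derivableP; apply: Ck_derivable C2 Uz.
Qed.

Lemma bf_ddmetric z a b v w : U z ->
  bf (Dmx a (Dmx b G) z) v w = 'D_a (fun p => bf (Dmx b G p) v w) z.
Proof.
move=> Uz; have [_ ->] := is_derive_bf (is_derive_dmetric a b Uz) (is_derive_cst v z a) (is_derive_cst w z a).
by rewrite bf0l bf0r !addr0.
Qed.

Lemma herm_ddmetric z a b : U z -> herm (Dmx a (Dmx b G) z).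
Proof.
move=> Uz; split.
  have [_ <-] := is_derive_trmx (is_derive_dmetric a b Uz); rewrite -DmxE.
  by apply: (near_derive_eq oU) Uz _ => p Up; exact: (dmetric_sym oU riem).
move=> v w; rewrite !bf_ddmetric //.
by apply: (near_derive_eq oU) Uz _ => p Up; exact: (dmetric_J oU riem hJ).
Qed.

Lemma near_hform z i j : U z -> \forall p \near z, hform (G p) (frame i) (frame j) = gC G p i j.
Proof.
move=> Uz; apply: filterS (open_nbhs_nbhs (conj oU Uz)) => p Up.
by rewrite gC_hform //; apply: herm_metric.
Qed.

Lemma derC_gC z v i j : U z -> derC v (fun p => gC G p i j) z = hform (Dmx v G z) (frame i) (frame j).
Proof.
move=> Uz; apply: derCE; apply: is_derC_near (near_hform i j Uz) _.
exact: (is_derC_hform (frame i) (frame j) (is_derive_metric riem v Uz)).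
Qed.

Lemma partialz_gC z k i j : U z -> partialz k (fun p => gC G p i j) z =
  2^-1 * (hform (Dmx (frame k) G z) (frame i) (frame j) - 'i * hform (Dmx (J (frame k)) G z) (frame i) (frame j)).
Proof. by move=> Uz; rewrite /partialz frame_yJ !derC_gC. Qed.

Lemma partialzbar_gC z k i j : U z -> partialzbar k (fun p => gC G p i j) z =
  2^-1 * (hform (Dmx (frame k) G z) (frame i) (frame j) + 'i * hform (Dmx (J (frame k)) G z) (frame i) (frame j)).
Proof. by move=> Uz; rewrite /partialzbar frame_yJ !derC_gC. Qed.

(** The derivative along [a] of the antiholomorphic derivative in the direction [b] of the Hermitian
    metric. *)
Let P2 z a b v w : C := 2^-1 * (hform (Dmx a (Dmx b G) z) v w + 'i * hform (Dmx a (Dmx (J b) G) z) v w).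

Lemma partialz2_gC z k l i j : U z ->
  partialz k (partialzbar l (fun p => gC G p i j)) z =
    2^-1 * (P2 z (frame k) (frame l) (frame i) (frame j) - 'i * P2 z (J (frame k)) (frame l) (frame i) (frame j)).
Proof.
move=> Uz; have D a : derC a (partialzbar l (fun p => gC G p i j)) z = P2 z a (frame l) (frame i) (frame j).
  apply: derCE; apply: (@is_derC_near _ _ _ _ (fun p => 2^-1 * (hform (Dmx (frame l) G p) (frame i) (frame j)
     + 'i * hform (Dmx (J (frame l)) G p) (frame i) (frame j)))).
    by apply: filterS (open_nbhs_nbhs (conj oU Uz)) => p Up; rewrite partialzbar_gC.
  apply: is_derC_Z; apply: is_derC_D; last apply: is_derC_Z.
    exact: (is_derC_hform _ _ (is_derive_dmetric a (frame l) Uz)).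
  exact: (is_derC_hform _ _ (is_derive_dmetric a (J (frame l)) Uz)).
by rewrite /partialz frame_yJ !D.
Qed.

Lemma rlin_comb (F F' : V -> C) (c d : C) : rlin F -> rlin F' -> rlin (fun a => c * (F a + d * F' a)).
Proof.
move=> [fD fZ] [gD gZ]; split=> [a b|k a]; rewrite ?fD ?gD ?fZ ?gZ; first by ring.
by move: (Complex k 0) => q; ring.
Qed.

Lemma rlin_J (F : V -> C) : rlin F -> rlin (fun a => F (J a)).
Proof. by move=> [fD fZ]; split=> [a b|k a]; rewrite ?stdJD ?stdJZ ?fD ?fZ. Qed.

Lemma rlin_N (F : V -> C) a : rlin F -> F (- a) = - F a.
Proof. by move=> [_ fZ]; rewrite -scaleN1r fZ; case: (F a) => p q; apply: complex_ext => /=; ring. Qed.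

(* [F - i F J] is complex linear and [F + i F J] is antilinear. *)
Lemma holo_J (F : V -> C) a : rlin F ->
  2^-1 * (F (J a) - 'i * F (J (J a))) = 'i * (2^-1 * (F a - 'i * F (J a))).
Proof.
move=> hF; rewrite stdJK rlin_N // half_complex.
by case: (F a) (F (J a)) => [p q] [r s]; apply: complex_ext => /=; ring.
Qed.

Lemma antiholo_J (F : V -> C) a : rlin F ->
  2^-1 * (F (J a) + 'i * F (J (J a))) = - 'i * (2^-1 * (F a + 'i * F (J a))).
Proof.
move=> hF; rewrite stdJK rlin_N // half_complex.
by case: (F a) (F (J a)) => [p q] [r s]; apply: complex_ext => /=; ring.
Qed.

Lemma holo_sum (F : V -> C) x : rlin F ->
  \sum_k cx x 0 k * (2^-1 * (F (frame k) - 'i * F (J (frame k)))) = 2^-1 * (F x - 'i * F (J x)).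
Proof.
move=> hF; apply: (@clinear_sum _ _ (fun a => 2^-1 * (F a - 'i * F (J a)))).
  have := rlin_comb 2^-1 (- 'i) hF (rlin_J hF).
  by move=> [h1 h2]; split=> [a b|k a]; have := h1; have := h2; rewrite -!mulNr.
by move=> a; apply: holo_J.
Qed.

Lemma antiholo_sum (F : V -> C) x : rlin F ->
  \sum_k (cx x 0 k)^* * (2^-1 * (F (frame k) + 'i * F (J (frame k)))) = 2^-1 * (F x + 'i * F (J x)).
Proof.
move=> hF; apply: (@antilinear_sum _ _ (fun a => 2^-1 * (F a + 'i * F (J a)))).
  exact: (rlin_comb 2^-1 'i hF (rlin_J hF)).
by move=> a; apply: antiholo_J.
Qed.

Lemma rlin_dhform z v w : U z -> rlin (fun a => hform (Dmx a G z) v w).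
Proof.
move=> Uz; have d := metric_diff oU riem Uz.
by split=> [a b|k a]; rewrite ?(DmxDl _ _ d) ?(DmxZl _ _ d) ?hformDA ?hformZA.
Qed.

Lemma rlin_ddh1 z b v w : U z -> rlin (fun a => hform (Dmx a (Dmx b G) z) v w).
Proof.
move=> Uz; have d : differentiable (Dmx b G) z.
  have C2 : Ck 1 U (Dmx b G) by rewrite Dmx.unlock; exact: (Ck_derive b (metric_Ck riem 2)).
  exact: Ck1_diff_mx oU C2 Uz.
by split=> [a a'|k a]; rewrite ?(DmxDl _ _ d) ?(DmxZl _ _ d) ?hformDA ?hformZA.
Qed.

Lemma rlin_ddh2 z a v w : U z -> rlin (fun b => hform (Dmx a (Dmx b G) z) v w).
Proof.
move=> Uz; split=> [b b'|k b].
  rewrite -hformDA; congr hform; have [_ <-] := is_derive_mxD (is_derive_dmetric a b Uz) (is_derive_dmetric a b' Uz).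
  rewrite -DmxE; apply: (near_derive_eq oU) Uz _ => p Up.
  by rewrite (DmxDl _ _ (metric_diff oU riem Up)).
rewrite -hformZA; congr hform; have [_ <-] := is_deriveZ k (is_derive_dmetric a b Uz).
rewrite -DmxE; apply: (near_derive_eq oU) Uz _ => p Up.
by rewrite (DmxZl _ _ (metric_diff oU riem Up)).
Qed.

(** Holomorphic derivatives of the Hermitian metric are given by the Levi-Civita connection alone:
    on a Kähler manifold it is also the Chern connection. *)
Lemma metric_dhform z x y w : U z ->
  2^-1 * (hform (Dmx y G z) x w - 'i * hform (Dmx (J y) G z) x w) = hform (G z) (Gam G z y x) w.
Proof.
move=> Uz.
have c a b c := metric_compat oU riem a b c Uz.
have j a b := Gam_J oU riem hJ hK a b Uz; have jl a b := Gam_Jl oU riem hJ hK a b Uz.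
have m a b := metric_J hJ a b Uz; have ml a b := metric_Jl hJ a b Uz.
rewrite half_complex; apply: complex_ext => /=; rewrite !(c, jl, j, ml, stdJK, stdJN, bfNr, bfNl); lra.
Qed.

Lemma exchange4 (f : 'I_n -> 'I_n -> 'I_n -> 'I_n -> 'I_n -> C) :
  \sum_i \sum_j \sum_k \sum_l \sum_p f i j k l p = \sum_p \sum_i \sum_j \sum_k \sum_l f i j k l p.
Proof.
transitivity (\sum_i \sum_j \sum_k \sum_p \sum_l f i j k l p).
  by do 3!(apply: eq_bigr => ? _); apply: exchange_big.
transitivity (\sum_i \sum_j \sum_p \sum_k \sum_l f i j k l p).
  by do 2!(apply: eq_bigr => ? _); apply: exchange_big.
transitivity (\sum_i \sum_p \sum_j \sum_k \sum_l f i j k l p).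
  by apply: eq_bigr => ? _; apply: exchange_big.
exact: exchange_big.
Qed.

Lemma sum4_factor (c : 'I_n -> 'I_n -> C) (A B : 'I_n -> 'I_n -> 'I_n -> C) (u u' v v' : 'I_n -> C) :
  \sum_i \sum_j \sum_k \sum_l (\sum_p \sum_q c q p * A k i q * B l p j) * u i * u' j * v k * v' l =
  \sum_p \sum_q c q p * (\sum_i \sum_k A k i q * u i * v k) * (\sum_j \sum_l B l p j * u' j * v' l).
Proof.
transitivity (\sum_i \sum_j \sum_k \sum_l \sum_p \sum_q
   c q p * (A k i q * u i * v k) * (B l p j * u' j * v' l)).
  do 4!(apply: eq_bigr => ? _); rewrite !mulr_suml; apply: eq_bigr => p _.
  by rewrite !mulr_suml; apply: eq_bigr => q _; ring.
rewrite exchange4; apply: eq_bigr => p _; rewrite exchange4; apply: eq_bigr => q _.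
rewrite -[RHS]mulrA mulr_suml mulr_sumr; apply: eq_bigr => i _.
rewrite mulr_sumr mulr_sumr; apply: eq_bigr => j _.
rewrite mulr_suml mulr_sumr; apply: eq_bigr => k _.
rewrite mulr_sumr mulr_sumr; apply: eq_bigr => l _.
by ring.
Qed.

Lemma herm_xJx (A : 'M[R]_(n + n)) x : herm A -> bf A x (J x) = 0.
Proof. by move=> hA; have := herm_Jl x x hA; rewrite (bf_sym (J x) x hA.1); lra. Qed.

(** The four sums collapse one at a time, two by complex linearity and two by antilinearity. In the
    real part the derivatives mixing [y] and [J y] drop out, since the Hermitian forms are real on
    the diagonal. *)
Lemma curvature_first z x y : U z ->
  complex.Re (\sum_i \sum_j \sum_k \sum_l partialz k (partialzbar l (fun p => gC G p i j)) z
    * cx x 0 i * (cx x 0 j)^* * cx y 0 k * (cx y 0 l)^*)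
  = 8^-1 * ('D_y (fun p => bf (Dmx y G p) x x) z + 'D_(J y) (fun p => bf (Dmx (J y) G p) x x) z).
Proof.
move=> Uz; pose E v w := 2^-1 * (P2 z y y v w - 'i * P2 z (J y) y v w).
have hz a b := herm_ddmetric a b Uz.
have -> : \sum_i \sum_j \sum_k \sum_l partialz k (partialzbar l (fun p => gC G p i j)) z
    * cx x 0 i * (cx x 0 j)^* * cx y 0 k * (cx y 0 l)^* = E x x.
  transitivity (\sum_i cx x 0 i * (\sum_j (cx x 0 j)^* * E (frame i) (frame j))).
    apply: eq_bigr => i _; rewrite mulr_sumr; apply: eq_bigr => j _; rewrite mulrA.
    have rP : rlin (fun a => P2 z a y (frame i) (frame j)).
      exact: (rlin_comb 2^-1 'i (rlin_ddh1 y (frame i) (frame j) Uz) (rlin_ddh1 (J y) (frame i) (frame j) Uz)).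
    have -> : E (frame i) (frame j) = \sum_k cx y 0 k *
        (2^-1 * (P2 z (frame k) y (frame i) (frame j) - 'i * P2 z (J (frame k)) y (frame i) (frame j))).
      exact: esym (holo_sum y rP).
    rewrite mulr_sumr; apply: eq_bigr => k _.
    have Qs a : P2 z a y (frame i) (frame j) = \sum_l (cx y 0 l)^* * P2 z a (frame l) (frame i) (frame j).
      exact: esym (antiholo_sum y (rlin_ddh2 a (frame i) (frame j) Uz)).
    rewrite !Qs [X in _ - X]mulr_sumr -sumrB !mulr_sumr; apply: eq_bigr => l _.
    by rewrite partialz2_gC //; ring.
  have s2 v : \sum_j (cx x 0 j)^* * E v (frame j) = E v x.
    have t a b := hform_sum2 v x (hz a b).
    rewrite /E /P2 -!t; rewrite !mulr_sumr -!big_split /= !mulr_sumr -sumrB mulr_sumr.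
    by apply: eq_bigr => j _; ring.
  under eq_bigr do rewrite s2.
  have t a b := hform_sum1 x x (hz a b).
  rewrite /E /P2 -!t; rewrite !mulr_sumr -!big_split /= !mulr_sumr -sumrB mulr_sumr.
  by apply: eq_bigr => j _; ring.
rewrite /E /P2 half_complex -!bf_ddmetric //=.
by rewrite !(herm_xJx x (hz _ _)); field.
Qed.

(** Both first derivatives contract to the Hermitian pairing with [Gam G z y x]; the inverse matrix
    between them leaves the Hermitian square of this vector. *)
Lemma curvature_second z x y : U z ->
  complex.Re (\sum_i \sum_j \sum_k \sum_l (\sum_p \sum_q invmx (gC G z) q p
      * partialz k (fun p => gC G p i q) z * partialzbar l (fun x => gC G x p j) z)
    * cx x 0 i * (cx x 0 j)^* * cx y 0 k * (cx y 0 l)^*)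
  = 2^-1 * bf (G z) (Gam G z y x) (Gam G z y x).
Proof.
move=> Uz; rewrite (sum4_factor (fun q p => invmx (gC G z) q p) (fun k i q => partialz k (fun p => gC G p i q) z)
  (fun l p j => partialzbar l (fun x => gC G x p j) z) (fun i => cx x 0 i) (fun j => (cx x 0 j)^*)
  (fun k => cx y 0 k) (fun l => (cx y 0 l)^*)).
set g := Gam G z y x; have hG := herm_metric Uz.
have tau q : \sum_i \sum_k partialz k (fun p => gC G p i q) z * cx x 0 i * cx y 0 k = hform (G z) g (frame q).
  rewrite -metric_dhform // -(hform_sum1 x (frame q) (herm_dmetric y Uz)) -(hform_sum1 x (frame q) (herm_dmetric (J y) Uz)).
  rewrite [X in _ - X]mulr_sumr -sumrB mulr_sumr; apply: eq_bigr => i _.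
  transitivity (cx x 0 i * (2^-1 * (hform (Dmx y G z) (frame i) (frame q) - 'i * hform (Dmx (J y) G z) (frame i) (frame q)))).
    rewrite -(holo_sum y (rlin_dhform (frame i) (frame q) Uz)) mulr_sumr; apply: eq_bigr => k _.
    by rewrite partialz_gC //; ring.
  by ring.
have cj l p j : partialzbar l (fun x => gC G x p j) z = (partialz l (fun x => gC G x j p) z)^*.
  rewrite partialz_gC // partialzbar_gC // (hform_sym (frame j) (frame p) (herm_dmetric (frame l) Uz)).
  rewrite (hform_sym (frame j) (frame p) (herm_dmetric (J (frame l)) Uz)) half_complex.
  move: (hform _ _ _) (hform _ _ _) => [p1 q1] [p2 q2]; apply: complex_ext => /=; ring.
have sig p : \sum_j \sum_l partialzbar l (fun x => gC G x p j) z * (cx x 0 j)^* * (cx y 0 l)^* = hform (G z) (frame p) g.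
  rewrite (hform_sym _ _ hG) -tau raddf_sum; apply: eq_bigr => j _.
  rewrite raddf_sum; apply: eq_bigr => l _ /=.
  by rewrite cj !rmorphM.
(* A kernel vector is [cx w] for a real [w], and then the metric vanishes on [w]. *)
have gu : gC G z \in unitmx.
  rewrite -row_free_unit; apply/inj_row_free => a ag0.
  pose w : V := row_mx (\row_k complex.Re (a 0 k)) (\row_k complex.Im (a 0 k)).
  have aw : a = cx w.
    by apply/rowP => k; rewrite mxE row_mxEl row_mxEr !mxE; case: (a 0 k).
  have w0 : w = 0.
    apply: contrapT => /eqP /(metric_pos riem Uz).
    have : hform (G z) w w = 0.
      rewrite -(hform_sum2 w w hG) big1 // => j _; rewrite -(hform_sum1 w (frame j) hG).
      have := congr1 (fun M : 'rV[C]_n => M 0 j) ag0; rewrite !mxE aw => e.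
      rewrite (_ : \sum_k _ = 0) ?mulr0 // -[RHS]e; apply: eq_bigr => k _.
      by rewrite gC_hform.
    by move=> /(congr1 (@complex.Re R)) /= e; rewrite (_ : bf _ _ _ = 0) ?ltxx //; lra.
  apply/rowP => k; rewrite aw w0 !mxE; exact: complex_ext.
(* In coordinates, lowering the index of [g] is multiplication of [cx g] by [gC], so the inverse
   matrix recovers [cx g]. *)
have tauM : (\row_q hform (G z) g (frame q)) = cx g *m gC G z.
  apply/rowP => q; rewrite !mxE -(hform_sum1 g (frame q) hG); apply: eq_bigr => k _.
  by rewrite gC_hform.
transitivity (complex.Re (\sum_p cx g 0 p * hform (G z) (frame p) g)).
  congr complex.Re; apply: eq_bigr => p _; rewrite sig -mulr_suml; congr (_ * _).
  have -> : cx g 0 p = ((\row_q hform (G z) g (frame q)) *m invmx (gC G z)) 0 p.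
    by rewrite tauM mulmxK.
  by rewrite mxE; apply: eq_bigr => q _; rewrite tau mxE mulrC.
by rewrite hform_sum1.
Qed.

(** The real part suffices for transferring the bounds: comparison with 0 and 1 in the complex order
    already contains reality. The factor 1/4 comes from the halves in [cx x] and [cx y]. *)
Lemma bisectional_real z x y : U z ->
  complex.Re (bisectional G z (cx x) (cx y)) = 4^-1 * Bis G z x y.
Proof.
move=> Uz.
have -> : bisectional G z (cx x) (cx y) =
  \sum_i \sum_j \sum_k \sum_l (\sum_p \sum_q invmx (gC G z) q p
      * partialz k (fun p => gC G p i q) z * partialzbar l (fun x => gC G x p j) z)
    * cx x 0 i * (cx x 0 j)^* * cx y 0 k * (cx y 0 l)^*
  - \sum_i \sum_j \sum_k \sum_l partialz k (partialzbar l (fun p => gC G p i j)) z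
    * cx x 0 i * (cx x 0 j)^* * cx y 0 k * (cx y 0 l)^*.
  rewrite /bisectional -sumrB; apply: eq_bigr => i _; rewrite -sumrB; apply: eq_bigr => j _.
  rewrite -sumrB; apply: eq_bigr => k _; rewrite -sumrB; apply: eq_bigr => l _.
  by rewrite /curv; ring.
rewrite (BisE oU riem hJ hK) // -[LHS]/(complex.Re (_ - _)).
have ReB (p q : C) : complex.Re (p - q) = complex.Re p - complex.Re q by case: p; case: q.
by rewrite ReB curvature_first // curvature_second //; field.
Qed.

Lemma real_bisectional_bounds :
  (forall z (u v : 'rV[C]_n), U z -> unit10 G z u -> unit10 G z v -> 0 < bisectional G z u v <= 1) ->
  forall z x y, U z -> bf (G z) x x = 1 -> bf (G z) y y = 1 -> 0 < Bis G z x y <= 1.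
Proof.
(* Scaling both vectors by the square root of 2 makes [cx] of them unit vectors; the resulting
   factor 4 cancels the 1/4 of [bisectional_real]. *)
move=> H z x y Uz x1 y1; pose s := Num.sqrt 2 : R.
have s2 : s ^+ 2 = 2 by rewrite sqr_sqrtr.
have un w : bf (G z) w w = 1 -> unit10 G z (cx (s *: w)).
  by move=> w1; apply: unit10_hform; [exact: herm_metric|rewrite bfZl bfZr w1 mulr1 -expr2].
have := H z _ _ Uz (un x x1) (un y y1); have := bisectional_real (s *: x) (s *: y) Uz.
rewrite (BisZ oU riem) // s2.
case: (bisectional _ _ _ _) => p q /= -> /andP[]; rewrite ltcE lecE /= => /andP[_ h1] /andP[_ h2].
by lra.
Qed.

End ComplexToReal.

(** * Geodesics and Jacobi fields in a chart *)

Section ChainRule.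
Context {R : realType}.

(** The chain rule taken as the definition of a derivative of [c]: one predicate for curves and for
    the linear projections of tangent coordinates. *)
Definition chain m (D : normedModType R) (c : D -> 'rV[R]_m) (t e : D) (dc : 'rV[R]_m) :=
  forall (W : normedModType R) (f : 'rV[R]_m -> W), differentiable f (c t) ->
    is_derive t e (f \o c) ('D_dc f (c t)).

Lemma chain_curve m (c : R -> 'rV[R]_m) (t : R) dc : is_derive t 1 c dc -> chain c t 1 dc.
Proof. by move=> hc W f df; apply: is_derive_curve. Qed.

Lemma chain_linear m p (L : {linear 'rV[R]_p -> 'rV[R]_m}) (t e : 'rV[R]_p) : chain L t e (L e).
Proof.
move=> W f df; have Lc := linear_rV_continuous (L := L).
have dL : differentiable L t by apply: linear_differentiable.
have dfL : differentiable (f \o L) t by apply: differentiable_comp.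
apply: DeriveDef; first exact: diff_derivable.
rewrite (derive_comp_rV e dL df); congr ('D__ f _).
by rewrite (deriveE e dL); have -> := diff_lin (f := L) t Lc.
Qed.

Lemma chain_is_derive m (D : normedModType R) (c : D -> 'rV[R]_m) (t e : D) dc :
  chain c t e dc -> is_derive t e c dc.
Proof.
pose L : {linear 'rV[R]_m -> 'rV[R]_m} := idfun.
have dL : differentiable (L : 'rV[R]_m -> 'rV[R]_m) (c t).
  by apply: linear_differentiable; apply: linear_rV_continuous.
move=> h; have := h _ _ dL; rewrite (deriveE dc dL).
by have -> := diff_lin (f := L) (c t) (linear_rV_continuous (L := L)).
Qed.

End ChainRule.

(** * The geodesic spray and its linearization *)

Section GeodesicField.
Context {R : realType} {n : nat}.
Local Notation N := (n + n)%N.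
Local Notation V := 'rV[R]_(n + n).
Context (U : set V) (G : V -> 'M[R]_(n + n)) (oU : open U) (riem : riemannian U G).
Implicit Types (z a b u v w x y : V).
Local Notation Gam := (Gam G).

Lemma Gam_frames z u v : U z ->
  Gam z u v = \sum_i \sum_j (u 0 i * v 0 j) *: Gam z (delta_mx 0 i) (delta_mx 0 j).
Proof.
move=> Uz.
have Z w : Gam z 0 w = 0 by have := GamZl oU riem 0 0 w Uz; rewrite !scale0r.
have Z' w : Gam z w 0 = 0 by have := GamZr oU riem 0 w 0 Uz; rewrite !scale0r.
have addl w : {morph (fun u => Gam z u w) : a b / a + b} by move=> a b; exact: (GamDl oU riem).
have addr w : {morph (fun v => Gam z w v) : a b / a + b} by move=> a b; exact: (GamDr oU riem).
rewrite {1}(row_coord_sum u) (big_morph (fun u => Gam z u v) (addl v) (Z v)).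
apply: eq_bigr => i _; rewrite (GamZl oU riem) // {1}(row_coord_sum v).
rewrite (big_morph (fun v => Gam z (delta_mx 0 i) v) (addr _) (Z' _)).
rewrite scaler_sumr; apply: eq_bigr => j _; by rewrite (GamZr oU riem) // scalerA.
Qed.

Lemma Gam_frames_entry z u v k : U z ->
  Gam z u v 0 k = \sum_i \sum_j u 0 i * v 0 j * Gam z (delta_mx 0 i) (delta_mx 0 j) 0 k.
Proof.
move=> Uz; rewrite {1}(Gam_frames u v Uz) summxE; apply: eq_bigr => i _.
by rewrite summxE; apply: eq_bigr => j _; rewrite mxE.
Qed.

Lemma is_derive_Gam_frames (D : normedModType R) (c f g : D -> V) (t e : D) (dc df dg : V) k :
  (\forall s \near t, U (c s)) -> U (c t) -> chain c t e dc ->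
  is_derive t e f df -> is_derive t e g dg ->
  is_derive t e (fun s => Gam (c s) (f s) (g s) 0 k)
    (\sum_i \sum_j (f t 0 i * g t 0 j * Dmx dc (fun p => Gam p (delta_mx 0 i) (delta_mx 0 j)) (c t) 0 k
      + (df 0 i * g t 0 j + f t 0 i * dg 0 j) * Gam (c t) (delta_mx 0 i) (delta_mx 0 j) 0 k)).
Proof.
move=> nU Ut ch /is_derive_mxP hf /is_derive_mxP hg.
have hG i j : is_derive t e (fun s => Gam (c s) (delta_mx 0 i) (delta_mx 0 j) 0 k)
    (Dmx dc (fun p => Gam p (delta_mx 0 i) (delta_mx 0 j)) (c t) 0 k).
  have d := Ck1_diff_mx oU (Gam_Ck oU riem 1 (delta_mx 0 i) (delta_mx 0 j)) Ut.
  by have /is_derive_mxP := ch _ _ d; rewrite DmxE => /(_ 0 k).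
have nr : \forall s \near t, \sum_i (\sum_j (fun s : D => f s 0 i * g s 0 j * Gam (c s) (delta_mx 0 i) (delta_mx 0 j) 0 k) s)
    = Gam (c s) (f s) (g s) 0 k.
  by apply: filterS nU => s Us; rewrite [RHS]Gam_frames_entry.
apply: (near_eq_is_derive nr).
apply: is_derive_ext (is_derive_sum (fun i => is_derive_sum (fun j => is_deriveM (is_deriveM (hf 0 i) (hg 0 j)) (hG i j)))) _ _.
  by move=> s; rewrite fct_sumE; apply: eq_bigr => i _; rewrite fct_sumE.
apply: eq_bigr => i _; apply: eq_bigr => j _.
rewrite /GRing.scale /=.
rewrite -[((fun _ => _) * _) t]/(f t 0 i * g t 0 j); ring.
Qed.

Lemma Dmx_Gam_entry z a u v k : U z ->
  Dmx a (fun p => Gam p u v) z 0 k =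
  \sum_i \sum_j u 0 i * v 0 j * Dmx a (fun p => Gam p (delta_mx 0 i) (delta_mx 0 j)) z 0 k.
Proof.
move=> Uz; have ch : chain (id : V -> V) z a a.
  by move=> W f df; apply: DeriveDef => //; apply: diff_derivable.
have nU : \forall s \near z, U (id s) by exact: open_nbhs_nbhs (conj oU Uz).
have [_ e] := is_derive_Gam_frames k nU Uz ch (is_derive_cst u z a) (is_derive_cst v z a).
have /is_derive_mxP/(_ 0 k)[_ <-] := is_derive_Gam oU riem a u v Uz.
rewrite [LHS]e; apply: eq_bigr => i _; apply: eq_bigr => j _.
by rewrite !mxE /=; ring.
Qed.

Lemma is_derive_Gam_chain (D : normedModType R) (c f g : D -> V) (t e : D) (dc df dg : V) :
  (\forall s \near t, U (c s)) -> U (c t) -> chain c t e dc ->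
  is_derive t e f df -> is_derive t e g dg ->
  is_derive t e (fun s => Gam (c s) (f s) (g s))
    (Dmx dc (fun p => Gam p (f t) (g t)) (c t) + Gam (c t) df (g t) + Gam (c t) (f t) dg).
Proof.
move=> nU Ut ch hf hg; apply/is_derive_mxP => i k; rewrite (ord1 i).
apply: is_derive_ext (is_derive_Gam_frames k nU Ut ch hf hg) _ _ => //.
rewrite [RHS]mxE [X in _ = X + _]mxE Dmx_Gam_entry // !(Gam_frames_entry _ _ _ Ut) -!big_split /=.
by apply: eq_bigr => a _; rewrite -!big_split /=; apply: eq_bigr => b _; ring.
Qed.

Definition geo_dom : set 'rV[R]_(N + N) := [set w | U (lsubmx w)].

(** The geodesic spray: the geodesic equation as a first order system for position and velocity. *)
Definition geo_field (w : 'rV[R]_(N + N)) : 'rV[R]_(N + N) :=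
  row_mx (rsubmx w) (- Gam (lsubmx w) (rsubmx w) (rsubmx w)).

Lemma geo_field_smooth : smooth_field geo_dom geo_field.
Proof.
have oD : open geo_dom by exact: open_lsubmx.
split => // k; have Cl := Ck_lsubmx (p := N) oD (Ck_id k _).
have Cr := Ck_rsubmx (p := N) oD (Ck_id k _).
apply: Ck_row_mx => //.
have CS : Ck k geo_dom (fun w : 'rV[R]_(N + N) => -1 *: Gam (lsubmx w) (rsubmx w) (rsubmx w)).
  apply: Ck_scalemx => //; apply/(Ck_mxP _ _ oD) => i j; rewrite (ord1 i).
  have C (a b : 'I_N) : Ck k geo_dom (fun w : 'rV[R]_(N + N) => (rsubmx w) 0 a * (rsubmx w) 0 b * Gam (lsubmx w) (delta_mx 0 a) (delta_mx 0 b) 0 j).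
    apply: Ck_mul => //; first by apply: Ck_mul => //; apply: ((Ck_mxP _ _ oD).1 Cr).
    have CG := (Ck_mxP _ _ oU).1 (Gam_Ck oU riem k (delta_mx 0 a) (delta_mx 0 b)) 0 j.
    exact: (Ck_comp oD oU _ Cl CG).
  have CC (a : 'I_N) := Ck_sum (index_enum _) xpredT oD (C a).
  apply: (Ck_eq oD _ (Ck_sum (index_enum _) xpredT oD CC)) => w Uw.
  by rewrite -Gam_frames_entry.
by apply: Ck_eq CS => // w _; rewrite scaleN1r.
Qed.

Lemma derive_geo_field (w e : 'rV[R]_(N + N)) : geo_dom w ->
  'D_e geo_field w = row_mx (rsubmx e)
    (- (Dmx (lsubmx e) (fun p => Gam p (rsubmx w) (rsubmx w)) (lsubmx w)
        + Gam (lsubmx w) (rsubmx e) (rsubmx w) + Gam (lsubmx w) (rsubmx w) (rsubmx e))).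
Proof.
move=> Uw; have oD : open geo_dom by exact: open_lsubmx.
have nU : \forall s \near w, U (lsubmx s) by exact: open_nbhs_nbhs (conj oD Uw).
have Ll : chain (lsubmx : 'rV[R]_(N + N) -> V) w e (lsubmx e) by pose L : {linear 'rV[R]_(N + N) -> V} := @lsubmx R 1 N N; exact: (chain_linear (L := L)).
have Lr : is_derive w e (rsubmx : 'rV[R]_(N + N) -> V) (rsubmx e).
  by apply: chain_is_derive; pose L : {linear 'rV[R]_(N + N) -> V} := @rsubmx R 1 N N; exact: (chain_linear (L := L)).
have h := is_deriveN (is_derive_Gam_chain nU Uw Ll Lr Lr).
suff : is_derive w e geo_field (row_mx (rsubmx e)
    (- (Dmx (lsubmx e) (fun p => Gam p (rsubmx w) (rsubmx w)) (lsubmx w)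
        + Gam (lsubmx w) (rsubmx e) (rsubmx w) + Gam (lsubmx w) (rsubmx w) (rsubmx e)))) by case.
move: h Lr => /is_derive_mxP h /is_derive_mxP Lr; apply/is_derive_mxP => i j.
case: (split_ordP j) => a ->.
  by rewrite row_mxEl; apply: is_derive_ext (Lr i a) _ _ => // y; rewrite row_mxEl.
by rewrite row_mxEr; apply: is_derive_ext (h i a) _ _ => // y; rewrite row_mxEr.
Qed.

End GeodesicField.

Lemma is_derive_affine {R : realType} (t : R) : is_derive t 1 (fun s : R => 2 * s - 1) 2.
Proof.
have h : is_derive t 1 (((2 : R) \*: (id : R -> R)) - cst (1 : R)) ((2 : R) *: (1 : R) - 0).
  by apply: is_deriveB.
by move: h; rewrite subr0 [_ *: _]mulr1.
Qed.

Section Jacobi.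
Context {R : realType} {n : nat}.
Local Notation N := (n + n)%N.
Local Notation V := 'rV[R]_(n + n).
Context (U : set V) (G : V -> 'M[R]_(n + n)) (oU : open U) (riem : riemannian U G).
Context (hJ : J_invariant U G) (hK : forall z u v w, U z -> d_kahler_form G z u v w = 0).
Implicit Types (z a b u v w x y : V).
Local Notation Gam := (Gam G).
Local Notation J := (@stdJ R n).

(** For [w = (x, u)] and a tangent vector [e = (Y, Y')] at [w], the covariant derivative of Y along
    u. Unlike the coordinate derivative Y', it transforms as a tangent vector. *)
Definition covar (w e : 'rV[R]_(N + N)) : V := rsubmx e + Gam (lsubmx w) (rsubmx w) (lsubmx e).
Definition sq (w : 'rV[R]_(N + N)) : R := bf (G (lsubmx w)) (rsubmx w) (rsubmx w).

Lemma sq_Ck k : Ck k (geo_dom U) sq.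
Proof.
have oD : open (geo_dom U) by exact: open_lsubmx.
have Cl := Ck_lsubmx (p := N) oD (Ck_id k _).
have Cr := Ck_rsubmx (p := N) oD (Ck_id k _).
have CG := Ck_comp_mx oD oU (fun _ h => h) Cl (metric_Ck riem k).
exact: (Ck_bf oD CG Cr Cr).
Qed.

Lemma derive_sq (w e : 'rV[R]_(N + N)) : geo_dom U w ->
  'D_e sq w = 2 * bf (G (lsubmx w)) (rsubmx e + Gam (lsubmx w) (rsubmx w) (lsubmx e)) (rsubmx w).
Proof.
move=> Uw.
pose L : {linear 'rV[R]_(N + N) -> V} := @lsubmx R 1 N N.
pose L' : {linear 'rV[R]_(N + N) -> V} := @rsubmx R 1 N N.
have hG := chain_linear (L := L) (t := w) e (metric_diff oU riem Uw).
have Lr := chain_is_derive (chain_linear (L := L') (t := w) e).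
rewrite DmxE in hG.
have [_ E] := covariant_product oU riem Uw hG Lr Lr.
rewrite /sq [LHS]E (bf_sym (L' w) _ (metric_sym riem Uw)) (Gam_sym oU riem _ _ Uw).
by rewrite -[L' w]/(rsubmx w) -[L' e]/(rsubmx e) -[L e]/(lsubmx e) -[L w]/(lsubmx w); ring.
Qed.

Context (X Z : R -> 'rV[R]_(N + N)) (t : R).
Hypotheses (Ut : geo_dom U (X t)) (hX : is_derive t 1 X (geo_field G (X t)))
  (hZ : is_derive t 1 Z ('D_(Z t) (geo_field G) (X t))).

Local Notation x := (lsubmx (X t)).
Local Notation u := (rsubmx (X t)).
Local Notation Y := (lsubmx (Z t)).
Local Notation P := (covar (X t) (Z t)).
Local Notation Y1 := (rsubmx (Z t)).

Lemma near_geo_dom : \forall s \near t, U (lsubmx (X s)).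
Proof.
have oD : open (geo_dom U) by exact: open_lsubmx.
have c : {for t, continuous X}.
  by have [d _] := hX; apply: differentiable_continuous; apply/derivable1_diffP.
exact: c _ (open_nbhs_nbhs (conj oD Ut)).
Qed.

Let hx : is_derive t 1 (fun s => lsubmx (X s)) u.
Proof. by have := is_derive_lsubmx hX; rewrite row_mxKl. Qed.
Let hu : is_derive t 1 (fun s => rsubmx (X s)) (- Gam x u u).
Proof. by have := is_derive_rsubmx hX; rewrite row_mxKr. Qed.
Let hY : is_derive t 1 (fun s => lsubmx (Z s)) Y1.
Proof. by have := is_derive_lsubmx hZ; rewrite (derive_geo_field oU riem) // row_mxKl. Qed.
Let hY1 : is_derive t 1 (fun s => rsubmx (Z s))
  (- (Dmx Y (fun p => Gam p u u) x + Gam x Y1 u + Gam x u Y1)).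
Proof. by have := is_derive_rsubmx hZ; rewrite (derive_geo_field oU riem) // row_mxKr. Qed.
Let hG : is_derive t 1 (G \o (fun s => lsubmx (X s))) (Dmx u G x).
Proof. by rewrite -DmxE; apply: is_derive_curve => //; apply: (metric_diff oU riem). Qed.

Let cov_u : - Gam x u u + Gam x u u = 0. Proof. by rewrite addNr. Qed.

Let hJu := is_derive_stdJ hu.
Let cov_Ju : J (- Gam x u u) + Gam x u (J u) = 0.
Proof. by rewrite (Gam_J oU riem hJ hK) // -stdJD addNr stdJ0. Qed.

(** The Jacobi equation, obtained from the linearized spray. *)
Lemma covar_derive : exists2 dP, is_derive t 1 (fun s => covar (X s) (Z s)) dP &
  dP + Gam x u P = - Rm G x Y u u.
Proof.
have h := is_derive_mxD hY1 (is_derive_Gam_chain oU riem near_geo_dom Ut (chain_curve hx) hu hY).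
eexists; first exact: h.
have E a : Gam x (- a) Y = - Gam x a Y by rewrite -scaleN1r (GamZl oU riem _ _ _ Ut) scaleN1r.
have D : Dmx u (fun p => Gam p u Y) x = Dmx u (fun p => Gam p Y u) x.
  rewrite -!DmxE. have h' := near_derive_eq (W := V) oU (f := (fun p => Gam p u Y)) (g := (fun p => Gam p Y u)) u Ut. apply: h' => p Up; exact: (Gam_sym oU riem).
rewrite /covar (GamDr oU riem _ _ _ Ut) E /Rm D (Gam_sym oU riem u Y1 Ut) (Gam_sym oU riem u Y Ut).
rewrite (Gam_sym oU riem (Gam x u u) Y Ut).
by apply/rowP => j; rewrite !mxE; ring.
Qed.

Lemma energy_derive : is_derive t 1 (fun s => sq (X s)) 0.
Proof.
apply: is_derive_ext (covariant_product (c := fun s => lsubmx (X s)) oU riem Ut hG hu hu) _ _ => //.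
by rewrite cov_u bf0l bf0r addr0.
Qed.

Lemma momentum_derive : is_derive t 1 (fun s => bf (G (lsubmx (X s))) (rsubmx (X s)) (lsubmx (Z s)))
  (bf (G x) u P).
Proof.
apply: is_derive_ext (covariant_product (c := fun s => lsubmx (X s)) oU riem Ut hG hu hY) _ _ => //.
by rewrite cov_u bf0l add0r.
Qed.

Lemma rotated_derive : is_derive t 1 (fun s => bf (G (lsubmx (X s))) (J (rsubmx (X s))) (lsubmx (Z s)))
  (bf (G x) (J u) P).
Proof.
apply: is_derive_ext (covariant_product (c := fun s => lsubmx (X s)) oU riem Ut hG hJu hY) _ _ => //.
by rewrite cov_Ju bf0l add0r.
Qed.

Lemma norm_derive : is_derive t 1 (fun s => bf (G (lsubmx (X s))) (lsubmx (Z s)) (lsubmx (Z s)))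
  (2 * bf (G x) P Y).
Proof.
apply: is_derive_ext (covariant_product (c := fun s => lsubmx (X s)) oU riem Ut hG hY hY) _ _ => //.
by rewrite -[_ + Gam _ _ _]/P (bf_sym Y P (metric_sym riem Ut)); ring.
Qed.

Lemma covar_norm_derive :
  is_derive t 1 (fun s => bf (G (lsubmx (X s))) (covar (X s) (Z s)) (lsubmx (Z s)))
  (bf (G x) P P - R4 G x Y u u Y).
Proof.
have [dP hP e] := covar_derive.
apply: is_derive_ext (covariant_product (c := fun s => lsubmx (X s)) oU riem Ut hG hP hY) _ _ => //.
by rewrite e bfNl addrC.
Qed.

Lemma covar_rotated_derive :
  is_derive t 1 (fun s => bf (G (lsubmx (X s))) (J (rsubmx (X s))) (covar (X s) (Z s)))
  (- R4 G x Y u u (J u)).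
Proof.
have [dP hP e] := covar_derive.
apply: is_derive_ext (covariant_product (c := fun s => lsubmx (X s)) oU riem Ut hG hJu hP) _ _ => //.
by rewrite cov_Ju e bf0l add0r (bf_sym (J u) _ (metric_sym riem Ut)) bfNl.
Qed.

Context (hB : forall z x y, U z -> bf (G z) x x = 1 -> bf (G z) y y = 1 -> 0 < Bis G z x y <= 1).
Hypotheses (t01 : 0 <= t <= 1) (e2 : sq (X t) <= 2^-1).

Let rsym a b : R4 G x a u u b = R4 G x b u u a.
Proof.
rewrite (R4_pair oU riem a u u b Ut) (R4_skew12 G) (R4_skew34 oU riem _ _ _ _ Ut); ring.
Qed.

Let e0 : 0 <= sq (X t). Proof. exact: (metric_ge0 riem). Qed.

(** 3/4 is the sectional bound 3/2 times the bound 1/2 on the squared speed. *)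
Let secb v : R4 G x v u u v <= 3 / 4 * bf (G x) v v.
Proof.
have := sectional_bound oU riem hJ hK hB v u Ut.
have v0 : 0 <= bf (G x) v v by exact: (metric_ge0 riem).
have : bf (G x) v v * sq (X t) <= bf (G x) v v * 2^-1 by rewrite ler_wpM2l.
rewrite -/(sq (X t)); lra.
Qed.

(** Positivity of the metric on [v - (2 t - 1) w], together with [(2 t - 1) ^+ 2 <= 1]. *)
Let young v w : 2 * (2 * t - 1) * bf (G x) v w <= bf (G x) v v + bf (G x) w w.
Proof.
have p : 0 <= bf (G x) (v - (2 * t - 1) *: w) (v - (2 * t - 1) *: w) by exact: (metric_ge0 riem).
have w0 : 0 <= bf (G x) w w by exact: (metric_ge0 riem).
have : (2 * t - 1) ^+ 2 * bf (G x) w w <= bf (G x) w w.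
  have /andP[t0 t1] := t01; have : 0 <= t * (1 - t) by rewrite mulr_ge0 ?subr_ge0.
  move=> tt; rewrite -[leRHS]mul1r ler_wpM2r // expr2; lra.
move: p; rewrite bfBl !bfBr !bfZl !bfZr (bf_sym w v (metric_sym riem Ut)) expr2; lra.
Qed.

(* With [a = 2 t - 1], [a^2 <= 1] on the unit interval and [|P + a Y|^2 >= 0], so the summand
   [2 |Y|^2] coming from the derivative of [a] absorbs the curvature term, at most [3/4 |Y|^2]. *)
Lemma growth_derive : exists2 d,
  is_derive t 1 (fun s => bf (G (lsubmx (X s))) (covar (X s) (Z s)) (lsubmx (Z s))
     + (2 * s - 1) * bf (G (lsubmx (X s))) (lsubmx (Z s)) (lsubmx (Z s))) d &
  0 <= d /\ (Y = 0 -> d = bf (G x) P P).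
Proof.
have ha := is_derive_affine t.
eexists; first exact: (is_deriveD covar_norm_derive (is_deriveM ha norm_derive)).
rewrite /GRing.scale /=; split.
  have := secb Y; have := young (- P) Y; rewrite !bfNl bfNr.
  have Y0 : 0 <= bf (G x) Y Y by exact: (metric_ge0 riem).
  lra.
by move=> ->; rewrite /R4 !bf0r subr0 !mulr0 !mul0r !addr0.
Qed.

(* This is [<P, Y>] wherever [Y = J u].  Its derivative is [- R(J u, u, u, J u)] plus terms in
   [J u - Y], which are nonpositive as in [growth_derive]. *)
Lemma rotation_derive : u != 0 -> exists2 d,
  is_derive t 1 (fun s => 2 * bf (G (lsubmx (X s))) (J (rsubmx (X s))) (covar (X s) (Z s))
     - bf (G (lsubmx (X s))) (covar (X s) (Z s)) (lsubmx (Z s))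
     - (2 * s - 1) * (sq (X s) - 2 * bf (G (lsubmx (X s))) (J (rsubmx (X s))) (lsubmx (Z s))
        + bf (G (lsubmx (X s))) (lsubmx (Z s)) (lsubmx (Z s)))) d & d < 0.
Proof.
move=> u0.
have ha := is_derive_affine t.
eexists; first exact: (is_deriveB (is_deriveB (is_deriveZ 2 covar_rotated_derive) covar_norm_derive)
  (is_deriveM ha (is_deriveD (is_deriveB energy_derive (is_deriveZ 2 rotated_derive)) norm_derive))).
rewrite /GRing.scale /=.
have JJ : sq (X t) = bf (G x) (J u) (J u) by rewrite (metric_J hJ _ _ Ut).
have pos : 0 < R4 G x (J u) u u (J u).
  have := Bis_gt0 oU riem hB Ut u0 u0; rewrite /Bis.
  by rewrite (R4_skew12 G) (R4_skew34 oU riem _ _ _ _ Ut) opprK.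
have s1 := secb (J u - Y); have y1 := young P (J u - Y).
have D0 : 0 <= bf (G x) (J u - Y) (J u - Y) by exact: (metric_ge0 riem).
have DE : bf (G x) (J u - Y) (J u - Y) = sq (X t) - 2 * bf (G x) (J u) Y + bf (G x) Y Y.
  by rewrite bfBl !bfBr (bf_sym Y (J u) (metric_sym riem Ut)) -JJ; ring.
have RE : R4 G x (J u - Y) u u (J u - Y) = R4 G x (J u) u u (J u) - 2 * R4 G x Y u u (J u) + R4 G x Y u u Y.
  have z1 a : R4 G x (- a) u u (J u - Y) = - R4 G x a u u (J u - Y).
    by rewrite -scaleN1r (R4Z1 oU riem) // mulN1r.
  have z2 a b : R4 G x a u u (b - Y) = R4 G x a u u b - R4 G x a u u Y.
    by rewrite /R4 bfBr.
  by rewrite (R4D1 oU riem) // z1 !z2 (rsym (J u) Y); ring.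
have PD : bf (G x) P (J u - Y) = bf (G x) (J u) P - bf (G x) P Y.
  by rewrite bfBr (bf_sym (J u) P (metric_sym riem Ut)).
move: s1 y1 D0; rewrite RE PD DE.
rewrite -[((fun=> _) - _ + _) t]/(sq (X t) - 2 * bf (G x) (J u) Y + bf (G x) Y Y); lra.
Qed.

End Jacobi.

(** * Geodesics on a Kähler manifold *)

Section SecondDerivative.
Context {R : realType}.

Lemma schwarz_mx m p (U : set 'rV[R]_m) (f : 'rV[R]_m -> 'rV[R]_p) z u v : open U -> Ck 2 U f -> U z ->
  'D_v (fun x => 'D_u f x) z = 'D_u (fun x => 'D_v f x) z.
Proof.
move=> oU C Uz; apply/rowP => j.
have Cj := (Ck_mxP _ _ oU).1 C 0 j.
have E a b : ('D_a (fun x => 'D_b f x) z) 0 j = 'D_a (fun x => 'D_b (fun y => f y 0 j) x) z.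
  have /is_derive_mxP/(_ 0 j)[_ <-] := derivableP (Ck_derivable (v := a) (Ck_derive b C) Uz).
  apply: near_eq_derive; apply: filterS (open_nbhs_nbhs (conj oU Uz)) => x Ux.
  by have /is_derive_mxP/(_ 0 j)[_ ->] := derivableP (Ck_derivable (v := b) C Ux).
have h := schwarz u v oU Cj Uz.
have e1 := E v u.
have e2 := E u v.
transitivity ('D_v (fun x => 'D_u (fun y => f y 0 j) x) z).
  exact e1.
transitivity ('D_u (fun x => 'D_v (fun y => f y 0 j) x) z).
  exact h.
symmetry.
exact e2.
Qed.

(** The direction is split into a base part and a fibre part, and the prolongation is linear in the
    fibre. The second derivative appearing here is what compares geodesic equations in two
    charts. *)
Lemma derive_extended_field m (U : set 'rV[R]_m) (F : 'rV[R]_m -> 'rV[R]_m) (w e : 'rV[R]_(m + m)) :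
  smooth_field U F -> U (lsubmx w) ->
  'D_e (extended_field F) w = row_mx ('D_(lsubmx e) F (lsubmx w))
     ('D_(lsubmx e) (fun p => 'D_(rsubmx w) F p) (lsubmx w) + 'D_(rsubmx e) F (lsubmx w)).
Proof.
move=> sF Uw; have [oU CF] := sF.
have oW : open [set w : 'rV[R]_(m + m) | U (lsubmx w)] by exact: open_lsubmx.
have dE : differentiable (extended_field F) w by exact: (Ck1_diff_mx oW (extended_smooth sF 1) Uw).
have dF : differentiable F (lsubmx w) by exact: (Ck1_diff_mx oU (CF 1%N) Uw).
have -> : e = row_mx (lsubmx e) 0 + row_mx 0 (rsubmx e) by rewrite add_row_mx addr0 add0r hsubmxK.
rewrite (deriveDl _ _ dE) linearD /= row_mxKl row_mxKl addr0 linearD /= !row_mxKr add0r.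
have -> : 'D_(row_mx (lsubmx e) 0) (extended_field F) w =
    row_mx ('D_(lsubmx e) F (lsubmx w)) ('D_(lsubmx e) (fun p => 'D_(rsubmx w) F p) (lsubmx w)).
  suff : is_derive w (row_mx (lsubmx e) 0) (extended_field F) (row_mx ('D_(lsubmx e) F (lsubmx w))
     ('D_(lsubmx e) (fun p => 'D_(rsubmx w) F p) (lsubmx w))) by case.
  apply: is_derive_from_line.
  have d1 := Ck_derivable (v := lsubmx e) (CF 1%N) Uw.
  have d2 := Ck_derivable (v := lsubmx e) (Ck_derive (rsubmx w) (CF 2%N)) Uw.
  have h1 := @is_derive_line R m _ F (lsubmx w) (lsubmx e) 0.
  have h2 := @is_derive_line R m _ (fun p => 'D_(rsubmx w) F p) (lsubmx w) (lsubmx e) 0.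
  move: h1 h2; rewrite !scale0r !add0r => /(_ d1) h1 /(_ d2) h2.
  have h3 := is_derive_row_mx h1 h2.
  apply: (is_derive_ext h3 _ erefl) => h.
  by rewrite /extended_field !linearD !linearZ /= row_mxKl row_mxKr scaler0 add0r.
have -> : 'D_(row_mx 0 (rsubmx e)) (extended_field F) w = row_mx 0 ('D_(rsubmx e) F (lsubmx w)).
  suff : is_derive w (row_mx 0 (rsubmx e)) (extended_field F) (row_mx 0 ('D_(rsubmx e) F (lsubmx w))) by case.
  apply: is_derive_from_line.
  have h0 : is_derive (0 : R) 1 (fun h : R => h *: 'D_(rsubmx e) F (lsubmx w)) ('D_(rsubmx e) F (lsubmx w)).
    have := @is_derive_line R _ _ (id : 'rV[R]_m -> 'rV[R]_m) 0 ('D_(rsubmx e) F (lsubmx w)) 0.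
    rewrite scale0r add0r derive_id => /(_ (@derivable_id _ _ _ _)) h.
    by apply: (is_derive_ext h _ erefl) => y; rewrite addr0.
  have h1 := is_derive_mxD h0 (is_derive_cst ('D_(rsubmx w) F (lsubmx w)) (0 : R) 1).
  have h2 := is_derive_row_mx (is_derive_cst (F (lsubmx w)) (0 : R) 1) h1.
  rewrite addr0 in h2.
  apply: (is_derive_ext h2 _ erefl) => h; rewrite /extended_field !linearD !linearZ /= row_mxKl row_mxKr scaler0 add0r.
  by rewrite (deriveDl _ _ dF) (deriveZl _ _ dF).
by rewrite add_row_mx addr0.
Qed.

End SecondDerivative.

(** Coordinates in [phi] of the velocity vector at time [t], meaningful when [c t] lies in the
    domain of [phi]. Pairs of this kind stand for points of the tangent bundle. *)
HB.lock Definition jet {R : realType} {n : nat} {M : topologicalType} (phi : chart R (n + n) M) (c : R -> M) (t : R)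
    : 'rV[R]_((n + n) + (n + n)) :=
  row_mx (chart_map phi (c t)) (((chart_map phi \o c : R -> 'rV[R]_(n + n))^`())%classic t).

Lemma jet_l {R : realType} {n : nat} {M : topologicalType} (phi : chart R (n + n) M) c t :
  lsubmx (jet phi c t) = chart_map phi (c t).
Proof. by rewrite jet.unlock row_mxKl. Qed.

Lemma jet_r {R : realType} {n : nat} {M : topologicalType} (phi : chart R (n + n) M) c t :
  rsubmx (jet phi c t) = ((chart_map phi \o c : R -> 'rV[R]_(n + n))^`())%classic t.
Proof. by rewrite jet.unlock row_mxKr. Qed.

Section Manifold.
Context {R : realType} {n : nat} (M : kahlerManifold R n).
Local Notation N := (n + n)%N.
Local Notation V := 'rV[R]_(n + n).
Local Notation W := 'rV[R]_((n + n) + (n + n)).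
Local Notation J := (@stdJ R n).
Implicit Types (phi psi : chart R (n + n) M) (c : R -> M) (p q : M) (t s : R).
Local Notation met := (kmetric M).
Local Notation img := (@chart_img R (n + n) M).

Lemma open_chart_preimage phi (O : set M) : open O -> open (img phi `&` chart_inv phi @^-1` O).
Proof.
move=> oO; rewrite openE => z [iz Oz].
have h1 : nbhs z (img phi) := open_nbhs_nbhs (conj (@chart_img_open _ _ _ phi) iz).
have h2 : nbhs z (chart_inv phi @^-1` O) := chart_inv_cont iz (open_nbhs_nbhs (conj oO Oz)).
exact: filterI h1 h2.
Qed.

Lemma open_overlap phi psi : open (overlap phi psi).
Proof. exact: open_chart_preimage (chart_dom_open psi). Qed.

Lemma chart_img_map phi p : chart_dom phi p -> img phi (chart_map phi p).
Proof. by move=> h; exists p. Qed.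

Lemma chart_invK phi z : img phi z -> chart_dom phi (chart_inv phi z) /\ chart_map phi (chart_inv phi z) = z.
Proof. by move=> [p dp <-]; rewrite chart_mapK. Qed.

Lemma overlap_map phi psi p : chart_dom phi p -> chart_dom psi p ->
  overlap phi psi (chart_map phi p) /\ transition phi psi (chart_map phi p) = chart_map psi p.
Proof.
move=> h1 h2; split; last by rewrite /transition /= chart_mapK.
by split; [exact: chart_img_map|rewrite /= chart_mapK].
Qed.

Lemma overlapC phi psi z : overlap phi psi z -> overlap psi phi (transition phi psi z) /\
  transition psi phi (transition phi psi z) = z.
Proof.
move=> [iz dz]; have [d1 e1] := chart_invK iz.
have [od e] := overlap_map dz d1; split; first exact: od.
by rewrite /transition /= chart_mapK.
Qed.

Lemma transition_smooth phi psi : katlas M phi -> katlas M psi ->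
  smooth_field (overlap phi psi) (transition phi psi).
Proof.
by move=> a b; split; [exact: open_overlap|have [h _] := kholomorphic a b => k; apply: h].
Qed.

Lemma transition_diff phi psi z : katlas M phi -> katlas M psi -> overlap phi psi z ->
  differentiable (transition phi psi) z.
Proof.
by move=> a b; have [ot C] := transition_smooth a b; apply: Ck1_diff_mx ot (C 1%N).
Qed.

Lemma transition_derive_surj phi psi z v : katlas M phi -> katlas M psi -> overlap phi psi z ->
  'D_('D_v (transition psi phi) (transition phi psi z)) (transition phi psi) z = v.
Proof.
move=> a b oz; have [oz' e] := overlapC oz.
have d1 := transition_diff b a oz'.
have d2 : differentiable (transition phi psi) (transition psi phi (transition phi psi z)).
  by rewrite e; apply: transition_diff.
have := derive_comp_rV v d1 d2; rewrite e => <-.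
rewrite -[RHS](derive_id (transition phi psi z) v).
have nb : nbhs (transition phi psi z) (overlap psi phi).
  exact: open_nbhs_nbhs (conj (@open_overlap psi phi) oz').
by apply: near_eq_derive; apply: filterS nb => y oy; have [_] := overlapC oy.
Qed.

Lemma transition_metric phi psi z u v : katlas M phi -> katlas M psi -> overlap phi psi z ->
  bf (met phi z) u v = bf (met psi (transition phi psi z))
     ('D_u (transition phi psi) z) ('D_v (transition phi psi) z).
Proof. by move=> a b oz; have := kcompatible u v a b oz; rewrite !inner_bf. Qed.

Lemma transition_J phi psi z v : katlas M phi -> katlas M psi -> overlap phi psi z ->
  'D_(J v) (transition phi psi) z = J ('D_v (transition phi psi) z).
Proof. by move=> a b oz; have [_ ->] := kholomorphic a b. Qed.

(** The transformation law of Christoffel symbols. [H] is symmetric in its first two arguments and,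
    by compatibility with the metric, determines the derivatives of the metric; the cyclic
    combination that defines [chr] then recovers it. *)
Lemma transition_Gam phi psi z a b : katlas M phi -> katlas M psi -> overlap phi psi z ->
  'D_(Gam (met phi) z a b) (transition phi psi) z =
  'D_a (fun y : V => 'D_b (transition phi psi) y) z +
  Gam (met psi) (transition phi psi z) ('D_a (transition phi psi) z) ('D_b (transition phi psi) z).
Proof.
move=> Aphi Apsi oz; have [oU C] := transition_smooth Aphi Apsi.
have [iz dz] := oz.
have r1 := kriemannian Aphi; have r2 := kriemannian Apsi.
have oi1 := @chart_img_open _ _ _ phi; have oi2 := @chart_img_open _ _ _ psi.
have [[iz' dz'] ez] := overlapC oz.
set tau := transition phi psi in C ez iz' dz' *.
pose T v := 'D_v tau z.
pose D2 a b := 'D_a (fun y : V => 'D_b tau y) z.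
pose H a b w := bf (met psi (tau z)) (D2 a b + Gam (met psi) (tau z) (T a) (T b)) (T w).
have Hs a' b' w : H a' b' w = H b' a' w.
  by rewrite /H /D2 (schwarz_mx b' a' oU (C 2%N) oz) (Gam_sym oi2 r2 _ _ iz').
have dG v b' w : bf (Dmx v (met phi) z) b' w = H v b' w + H v w b'.
  rewrite -(derive_inner r1) //.
  have hG : is_derive z v (met psi \o tau) (Dmx (T v) (met psi) (tau z)).
    apply: DeriveDef; last by rewrite (derive_comp_rV v (transition_diff Aphi Apsi oz) (metric_diff oi2 r2 iz')) DmxE.
    apply: diff_derivable; apply: differentiable_comp; first exact: transition_diff.
    exact: (metric_diff oi2 r2).
  have hd u := derivableP (Ck_derivable (v := v) (Ck_derive u (C 2%N)) oz).
  have [_ E] := covariant_product (c := tau) oi2 r2 iz' hG (hd b') (hd w).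
  rewrite (bf_sym ('D_b' tau z) _ (metric_sym r2 iz')) in E.
  rewrite /H -[RHS]E; apply: near_eq_derive.
  apply: filterS (open_nbhs_nbhs (conj oU oz)) => y oy.
  by rewrite inner_bf (transition_metric _ _ Aphi Apsi oy).
apply: (metric_inj r2 iz') => w.
pose w' := 'D_w (transition psi phi) (tau z).
have ew : T w' = w := transition_derive_surj w Aphi Apsi oz.
have e1 := transition_metric (Gam (met phi) z a b) w' Aphi Apsi oz.
have e2 : bf (met phi z) (Gam (met phi) z a b) w' = H a b w'.
  rewrite (GamE oi1 r1 a b w' iz) /chr (dG a b w') (dG b a w') (dG w' a b).
  rewrite (Hs b a w') (Hs w' a b) (Hs w' b a).
  by move: (H a b w') (H a w' b) (H b w' a) => x1 x2 x3; lra.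
by rewrite -ew; transitivity (bf (met phi z) (Gam (met phi) z a b) w').
Qed.

(** The geodesic equation at a single time, in all charts around the point. Being a condition on the
    germ of the curve, it can be glued and propagated along an interval. *)
Definition geod_at c t := {for t, continuous c} /\
  forall phi, katlas M phi -> chart_dom phi (c t) ->
    is_derive t 1 (jet phi c) (geo_field (met phi) (jet phi c t)).

Lemma jet_near phi c c' t : (\forall s \near t, c s = c' s) -> jet phi c t = jet phi c' t.
Proof.
move=> e; rewrite jet.unlock (nbhs_singleton e); congr row_mx; rewrite !derive1E.
by apply: near_eq_derive; apply: filterS e => s /= ->.
Qed.

Lemma geod_at_near c c' t : (\forall s \near t, c s = c' s) -> geod_at c t -> geod_at c' t.
Proof.
move=> e [cc h]; split; first exact: near_eq_continuous e cc.
move=> phi a d; rewrite -(jet_near phi e).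
have d' : chart_dom phi (c t) by rewrite (nbhs_singleton e).
apply: near_eq_is_derive (h _ a d').
by apply: filterS (nbhs_interior e) => s es; apply: jet_near.
Qed.

Lemma geod_at_geodesic (I : set R) c : (forall t, I t -> geod_at c t) -> geodesic I c.
Proof.
move=> h; split=> [t /h[] //|phi t a /h[_ H] d x].
have H' := H _ a d.
have jr y : rsubmx (jet phi c y) = (x^`())%classic y by rewrite jet_r.
have jl y : lsubmx (jet phi c y) = x y by rewrite jet_l.
have hx : is_derive t 1 x ((x^`())%classic t).
  have := is_derive_lsubmx H'; rewrite /geo_field row_mxKl jr => hh.
  exact: (is_derive_ext hh jl erefl).
have hu : is_derive t 1 ((x^`())%classic) (- Gam (met phi) (x t) ((x^`())%classic t) ((x^`())%classic t)).
  have := is_derive_rsubmx H'; rewrite /geo_field row_mxKr jr jl => hh.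
  exact: (is_derive_ext hh jr erefl).
split; [by case: hx|by case: hu|move=> w].
have it : img phi (x t) by exact: chart_img_map.
have [_ e] := hu; rewrite [X in inner _ _ X](derive1E _ t) e.
have r := kriemannian a; have o := @chart_img_open _ _ _ phi.
by rewrite inner_bf bfNl (GamE o r _ _ _ it) (christoffelE r) // addNr.
Qed.

End Manifold.

Lemma is_derive_affine_comp {R : realType} m (X : R -> 'rV[R]_m) (k l t : R) dX :
  is_derive (k * t + l) 1 X dX -> is_derive t 1 (fun s : R => X (k * s + l)) (k *: dX).
Proof.
move=> /curve_coord h; apply/curve_coord => i j.
have ha : is_derive t 1 (fun s : R => k * s + l) k.
  have h1 : is_derive t 1 ((k \*: (id : R -> R)) + cst l) (k *: (1 : R) + 0).
    by apply: is_deriveD.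
  by move: h1; rewrite addr0 [_ *: _]mulr1.
have := @is_derive1_comp R (fun s => X s i j) (fun s : R => k * s + l) t _ _ (h i j) ha.
by move=> h1; rewrite mxE mulrC.
Qed.

Lemma no_common_half_ball {R : realType} m (x y z : 'rV[R]_m) :
  `|z - x| < `|x - y| / 2 -> `|z - y| < `|x - y| / 2 -> False.
Proof.
move=> h1 h2; have := ler_distD z x y; rewrite (distrC x z) => h.
by have := le_lt_trans h (ltrD h1 h2); rewrite -splitr ltxx.
Qed.

(** * Independence of the chart and uniqueness of geodesics *)

Section ManifoldGeodesics.
Context {R : realType} {n : nat} (M : kahlerManifold R n).
Local Notation N := (n + n)%N.
Local Notation V := 'rV[R]_(n + n).
Local Notation W := 'rV[R]_((n + n) + (n + n)).
Implicit Types (phi psi : chart R (n + n) M) (c : R -> M) (p q : M) (t s : R) (w : W).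
Local Notation met := (kmetric M).
Local Notation img := (@chart_img R (n + n) M).

Lemma near_dom phi c t : {for t, continuous c} -> chart_dom phi (c t) -> \forall s \near t, chart_dom phi (c s).
Proof. by move=> cc d; exact: cc _ (open_nbhs_nbhs (conj (chart_dom_open phi) d)). Qed.

Lemma jet_transition phi psi c t : katlas M phi -> katlas M psi -> {for t, continuous c} ->
  chart_dom phi (c t) -> chart_dom psi (c t) -> derivable (chart_map phi \o c : R -> V) t 1 ->
  jet psi c t = extended_field (transition phi psi) (jet phi c t).
Proof.
move=> a b cc d1 d2 dx; have [ov e] := overlap_map d1 d2.
rewrite /extended_field jet_l jet_r e jet.unlock; congr row_mx; rewrite !derive1E.
have [_ <-] := is_derive_curve (transition_diff a b ov) (derivableP dx).
apply: near_eq_derive; apply: filterS2 (near_dom cc d1) (near_dom cc d2) => s h1 h2 /=.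
by have [_ ->] := overlap_map h1 h2.
Qed.

(** Differentiating the change of coordinates of the jet produces a second derivative of the
    transition map, which the transformation law of [Gam] cancels. *)
Lemma geod_transfer phi psi c t : katlas M phi -> katlas M psi ->
  (\forall s \near t, {for s, continuous c} /\ derivable (chart_map phi \o c : R -> V) s 1) ->
  chart_dom phi (c t) -> chart_dom psi (c t) ->
  is_derive t 1 (jet phi c) (geo_field (met phi) (jet phi c t)) ->
  is_derive t 1 (jet psi c) (geo_field (met psi) (jet psi c t)).
Proof.
move=> a b nc d1 d2 h; have [cc dx] := nbhs_singleton nc.
have [ov e] := overlap_map d1 d2.
have sT := transition_smooth a b; have [oT CT] := sT.
have ov' : overlap phi psi (lsubmx (jet phi c t)) by rewrite jet_l.
have oD : open [set w : W | overlap phi psi (lsubmx w)] by exact: open_lsubmx.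
have dE := Ck1_diff_mx oD (extended_smooth sT 1) ov'.
have hc := is_derive_curve dE h.
have nr : \forall s \near t, (extended_field (transition phi psi) \o jet phi c) s = jet psi c s.
  apply: filterS3 nc (near_dom cc d1) (near_dom cc d2) => s [h1 h2] h3 h4 /=.
  by rewrite -jet_transition.
have hd := near_eq_is_derive nr hc.
move: hd; rewrite (derive_extended_field _ sT ov') (jet_transition a b cc d1 d2 dx).
move: ov'; generalize (jet phi c t) => w ov'.
set x := lsubmx w in ov' *; set u := rsubmx w.
have -> : lsubmx (geo_field (met phi) w) = u by rewrite /geo_field row_mxKl.
have -> : rsubmx (geo_field (met phi) w) = - Gam (met phi) x u u by rewrite /geo_field row_mxKr.
have -> : geo_field (met psi) (extended_field (transition phi psi) w) =
    row_mx ('D_u (transition phi psi) x)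
      (- Gam (met psi) (transition phi psi x) ('D_u (transition phi psi) x) ('D_u (transition phi psi) x)).
  by rewrite /geo_field /extended_field row_mxKl row_mxKr.
have E := transition_Gam u u a b ov'.
have -> : 'D_(- Gam (met phi) x u u) (transition phi psi) x = - 'D_(Gam (met phi) x u u) (transition phi psi) x.
  by rewrite -scaleN1r (deriveZl _ _ (transition_diff a b ov')) scaleN1r.
by rewrite E opprD addrA subrr add0r.
Qed.

Lemma geod_at_chart phi (X : R -> W) c t : katlas M phi ->
  (\forall s \near t, [/\ geo_dom (img phi) (X s), is_derive s 1 X (geo_field (met phi) (X s)) &
     c s = chart_inv phi (lsubmx (X s))]) ->
  [/\ geod_at c t, jet phi c t = X t & chart_dom phi (c t)].
Proof.
move=> a nr.
have P s : (\forall u \near s, [/\ geo_dom (img phi) (X u), is_derive u 1 X (geo_field (met phi) (X u)) &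
     c u = chart_inv phi (lsubmx (X u))]) ->
   [/\ {for s, continuous c}, is_derive s 1 (chart_map phi \o c : R -> V) (rsubmx (X s)),
     jet phi c s = X s & chart_dom phi (c s)].
  move=> nu; have [h1 h2 h3] := nbhs_singleton nu.
  have [dX _] := h2.
  have hl : is_derive s 1 (fun u => lsubmx (X u)) (rsubmx (X s)).
    by have := is_derive_lsubmx h2; rewrite row_mxKl.
  have cl : {for s, continuous (fun u => lsubmx (X u))}.
    by have [d _] := hl; apply: differentiable_continuous; apply/derivable1_diffP.
  have [d1 e1] := chart_invK h1.
  have nr1 : \forall u \near s, lsubmx (X u) = (chart_map phi \o c) u.
    by apply: filterS nu => u [g1 g2 g3] /=; rewrite g3; have [_ ->] := chart_invK g1.
  have hx := near_eq_is_derive nr1 hl.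
  split => //; last by rewrite h3.
    have nr2 : \forall u \near s, (chart_inv phi \o (fun u => lsubmx (X u))) u = c u.
      by apply: filterS nu => u [].
    apply: near_eq_continuous nr2 _; apply: continuous_comp => //; exact: chart_inv_cont.
  by rewrite jet.unlock derive1E; have [_ ->] := hx; rewrite h3 e1 hsubmxK.
have nP : \forall s \near t, [/\ {for s, continuous c},
    is_derive s 1 (chart_map phi \o c : R -> V) (rsubmx (X s)), jet phi c s = X s & chart_dom phi (c s)].
  by apply: filterS (nbhs_interior nr) => s; exact: P.
have [cc hx e d] := P t nr.
have [h1 h2 h3] := nbhs_singleton nr.
have hj : is_derive t 1 (jet phi c) (geo_field (met phi) (jet phi c t)).
  rewrite e; apply: near_eq_is_derive h2; by apply: filterS nP => s [].
split; [split; first exact: cc|exact: e|exact: d] => psi b dpsi.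
apply: (geod_transfer a b _ d dpsi hj); by apply: filterS nP => s [h1' [h2' _] _ _].
Qed.

Lemma geod_at_derivable phi c t : geod_at c t -> katlas M phi -> chart_dom phi (c t) ->
  derivable (chart_map phi \o c : R -> V) t 1.
Proof.
move=> [_ h] a d; have [D _] := is_derive_lsubmx (h _ a d).
have nr s : lsubmx (jet phi c s) = (chart_map phi \o c) s by rewrite jet_l.
by have [] := is_derive_ext (derivableP D) nr erefl.
Qed.

Lemma geod_jet_continuous phi c t : geod_at c t -> katlas M phi -> chart_dom phi (c t) ->
  {for t, continuous (jet phi c)}.
Proof.
move=> [_ h] a d; have [D _] := h _ a d.
by apply: differentiable_continuous; apply/derivable1_diffP.
Qed.

Lemma jet_eq_transfer phi psi c1 c2 t : geod_at c1 t -> geod_at c2 t -> katlas M phi -> katlas M psi ->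
  c1 t = c2 t -> chart_dom phi (c1 t) -> chart_dom psi (c1 t) ->
  jet phi c1 t = jet phi c2 t -> jet psi c1 t = jet psi c2 t.
Proof.
move=> g1 g2 a b e d1 d2 ej; have d1' := d1; have d2' := d2; rewrite e in d1' d2'.
rewrite (jet_transition a b g1.1 d1 d2 (geod_at_derivable g1 a d1)) ej.
by rewrite -(jet_transition a b g2.1 d1' d2' (geod_at_derivable g2 a d1')).
Qed.

Definition geod_on (a b : R) c := forall t, a < t < b -> geod_at c t.

Lemma near_interval (a b t : R) : a < t < b -> \forall s \near t, a < s < b.
Proof.
move=> /andP[h1 h2]; apply: (@norm_lt_nbhs R R^o t _ (Num.min (t - a) (b - t))).
  by rewrite lt_min !subr_gt0 h1.
by move=> s; rewrite lt_min !ltr_norml => /andP[/andP[x1 x2] /andP[x3 x4]]; lra.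
Qed.

(** Three cases at [t1]: different points are separated by the Hausdorff property and different
    velocities by continuity, so no [t'] near [t1] satisfies the hypotheses; equal jets put both
    curves in one chart, where the Gronwall estimate applies. The form fits [interval_induction]. *)
Lemma geod_unique_local (a b : R) c1 c2 t1 : geod_on a b c1 -> geod_on a b c2 -> a < t1 < b ->
  exists2 e : R, 0 < e & forall t t', a < t < b -> a < t' < b -> `|t - t1| < e -> `|t' - t1| < e ->
    c1 t' = c2 t' ->
    (forall phi, katlas M phi -> chart_dom phi (c1 t') -> jet phi c1 t' = jet phi c2 t') -> c1 t = c2 t.
Proof.
move=> g1 g2 t1I; have G1 := g1 _ t1I; have G2 := g2 _ t1I.
have vac (P : set R) : nbhs t1 P -> (forall t', P t' -> c1 t' = c2 t' ->
    (forall phi, katlas M phi -> chart_dom phi (c1 t') -> jet phi c1 t' = jet phi c2 t') -> False) ->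
  exists2 e : R, 0 < e & forall t t', a < t < b -> a < t' < b -> `|t - t1| < e -> `|t' - t1| < e ->
    c1 t' = c2 t' ->
    (forall phi, katlas M phi -> chart_dom phi (c1 t') -> jet phi c1 t' = jet phi c2 t') -> c1 t = c2 t.
  move=> nP H; have [e e0 he] := nbhs_norm_lt (W := R^o) nP.
  by exists e => // t t' _ _ _ /he Pt' e1 e2; exfalso; exact: H Pt' e1 e2.
have [e12|ne] := pselect (c1 t1 = c2 t1); last first.
  have H := @khausdorff R n M.
  have [[A B] /= [nA nB] AB] : exists2 AB : set M * set M, (nbhs (c1 t1) AB.1 /\ nbhs (c2 t1) AB.2) & AB.1 `&` AB.2 = set0.
    apply: contrapT => nex; apply: ne; apply: H => A B nA nB.
    by apply: contrapT => /set0P/negP; rewrite negbK => /eqP AB; apply: nex; exists (A, B).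
  apply: (vac (c1 @^-1` A `&` c2 @^-1` B)).
    by apply: filterI; [exact: G1.1 _ nA|exact: G2.1 _ nB].
  move=> t' [h1 h2] e _; have : (A `&` B) (c1 t') by split => //; rewrite e.
  by rewrite AB.
have [phi aphi d1] := kcovering (c1 t1).
have d2 : chart_dom phi (c2 t1) by rewrite -e12.
have C1 := geod_jet_continuous G1 aphi d1; have C2 := geod_jet_continuous G2 aphi d2.
have [ej|nej] := eqVneq (jet phi c1 t1) (jet phi c2 t1); last first.
  have ne0 : 0 < `|jet phi c1 t1 - jet phi c2 t1| / 2 by rewrite divr_gt0 // normr_gt0 subr_eq0.
  pose Bl x := [set y : W | `|y - x| < `|jet phi c1 t1 - jet phi c2 t1| / 2].
  have nb (x : W) : nbhs x (Bl x) by apply: (norm_lt_nbhs ne0) => y.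
  have n1 := near_dom G1.1 d1.
  apply: (vac (jet phi c1 @^-1` Bl (jet phi c1 t1) `&` jet phi c2 @^-1` Bl (jet phi c2 t1) `&` [set s | chart_dom phi (c1 s)])).
    by apply: filterI => //; apply: filterI; [exact: C1 _ (nb _)|exact: C2 _ (nb _)].
  move=> t' [[h1 h2] d'] _ /(_ phi aphi d') e; move: h1 h2; rewrite /Bl /= e => h1 h2.
  exact: (no_common_half_ball h1 h2).
set w0 := jet phi c1 t1 in C1 ej.
have r := kriemannian aphi; have oi := @chart_img_open _ _ _ phi.
have [oD CD] := geo_field_smooth oi r.
have w0D : geo_dom (img phi) w0 by rewrite /geo_dom /= jet_l; exact: chart_img_map.
have [rr [K [rr0 K0 [b1 b2]]]] := local_taylor oD w0D (CD 2%N).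
have lip x y : `|x - w0| < rr -> `|y - w0| < rr -> `|geo_field (met phi) x - geo_field (met phi) y| <= K * `|x - y|.
  by move=> hx hy; apply: (b2 _ _ hx hy).1.
pose Bl := [set y : W | `|y - w0| < rr].
have nb : nbhs w0 Bl by apply: (norm_lt_nbhs rr0) => y.
have nb2 : nbhs (jet phi c2 t1) Bl by rewrite -ej.
have nn : nbhs t1 ((jet phi c1 @^-1` Bl `&` jet phi c2 @^-1` Bl) `&`
   ([set s | chart_dom phi (c1 s)] `&` [set s | chart_dom phi (c2 s)]) `&` [set s | a < s < b]).
  apply: filterI; last exact: near_interval.
  apply: filterI; first by apply: filterI; [exact: C1 _ nb|exact: C2 _ nb2].
  by apply: filterI; [exact: near_dom G1.1 d1|exact: near_dom G2.1 d2].
have [e0 e00 he] := nbhs_norm_lt (W := R^o) nn.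
(* Time is recentred at [t']: the window of radius [2 e] about [t'] contains [t], stays within [e0]
   of [t1], and is short enough for the Gronwall estimate. *)
pose e := Num.min (e0 / 3) (4 * K)^-1.
have e_gt0 : 0 < e by rewrite lt_min divr_gt0 // invr_gt0 mulr_gt0.
have ee0 : 3 * e <= e0 by have : e <= e0 / 3 by [rewrite ge_min lexx]; lra.
have eK : (2 * e) * K <= 2^-1.
  have : e * K <= (4 * K)^-1 * K by rewrite ler_pM2r // ge_min lexx orbT.
  have -> : (4 * K)^-1 * K = 4^-1 by field; rewrite gt_eqF.
  lra.
exists e => // t t' tI t'I te t'e e1 e2.
have W' s : - (2 * e) < s < 2 * e -> ((jet phi c1 @^-1` Bl `&` jet phi c2 @^-1` Bl) `&`
   ([set s | chart_dom phi (c1 s)] `&` [set s | chart_dom phi (c2 s)]) `&` [set s | a < s < b]) (1 * s + t').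
  by move=> hs; apply: he; move: t'e; rewrite mul1r !ltr_norml => /andP[x1 x2]; lra.
have sol c : geod_on a b c -> (forall s, - (2 * e) < s < 2 * e -> [/\ Bl (jet phi c (1 * s + t')),
    chart_dom phi (c (1 * s + t')) & a < 1 * s + t' < b]) -> forall s, - (2 * e) < s < 2 * e ->
    `|jet phi c (1 * s + t') - w0| < rr /\ is_derive s 1 (fun s => jet phi c (1 * s + t')) (geo_field (met phi) (jet phi c (1 * s + t'))).
  move=> g H s /H[h1 h2 h3]; split => //.
  have := is_derive_affine_comp ((g _ h3).2 _ aphi h2); by rewrite scale1r.
have S1 := sol c1 g1 (fun s hs => let: conj (conj (conj x1 x2) (conj x3 x4)) x5 := W' s hs in And3 x1 x3 x5).
have S2 := sol c2 g2 (fun s hs => let: conj (conj (conj x1 x2) (conj x3 x4)) x5 := W' s hs in And3 x2 x4 x5).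
have U := short_uniqueness K0 eK lip S1 S2.
have z0 : - (2 * e) < 0 < 2 * e by lra.
have ts : - (2 * e) < t - t' < 2 * e.
  by move: te t'e; rewrite !ltr_norml => /andP[x1 x2] /andP[x3 x4]; lra.
have [[_ [dt' _]] _] := W' _ z0; rewrite mulr0 add0r /= in dt'.
have E0 : jet phi c1 (1 * 0 + t') = jet phi c2 (1 * 0 + t') by rewrite mulr0 add0r; exact: e2.
have E := U _ ts; rewrite E0 subrr normr0 mulr0 normr_le0 subr_eq0 in E.
have [[_ [k1 k2]] _] := W' _ ts.
have := congr1 lsubmx (eqP E); rewrite !jet_l mul1r subrK => E'.
rewrite /= mul1r subrK in k1 k2.
by rewrite -(chart_mapK k1) E' chart_mapK.
Qed.

Lemma geod_unique (a b : R) c1 c2 s0 phi : geod_on a b c1 -> geod_on a b c2 -> a < s0 < b ->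
  katlas M phi -> c1 s0 = c2 s0 -> chart_dom phi (c1 s0) -> jet phi c1 s0 = jet phi c2 s0 ->
  forall t, a < t < b -> c1 t = c2 t.
Proof.
move=> g1 g2 s0I aphi e d ej.
(* Equality of germs rather than of values, so that the jets agree as well. *)
pose P s := \forall u \near s, c1 u = c2 u.
have grow t1 : a < t1 < b -> exists2 e : R, 0 < e & forall t t', a < t < b -> a < t' < b -> `|t - t1| < e -> `|t' - t1| < e ->
    c1 t' = c2 t' ->
    (forall phi, katlas M phi -> chart_dom phi (c1 t') -> jet phi c1 t' = jet phi c2 t') -> P t.
  move=> t1I; have [e0 e00 he] := geod_unique_local g1 g2 t1I; exists e0 => // t t' tI t'I te t'e h1 h2.
  have n1 : \forall s \near t, `|s - t1| < e0.
    apply: (@norm_lt_nbhs R R^o t _ (e0 - `|t - t1|)); first by rewrite subr_gt0.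
    by move=> s hs /=; have := ler_distD t s t1; lra.
  by apply: filterS2 (near_interval tI) n1 => s sI se; apply: (he s t').
have Pi t : P t -> c1 t = c2 t /\ (forall phi, katlas M phi -> chart_dom phi (c1 t) -> jet phi c1 t = jet phi c2 t).
  by move=> Pt; split; [exact: nbhs_singleton Pt|move=> psi _ _; exact: jet_near].
have P0 : P s0.
  have [e0 e00 he] := grow s0 s0I; apply: (he s0 s0) => //; rewrite ?subrr ?normr0 //.
  move=> psi b' d'; exact: (jet_eq_transfer (g1 _ s0I) (g2 _ s0I) aphi b' e d d' ej).
move=> t tI; have [] // := Pi t.
apply: (interval_induction _ s0I P0 tI) => t1 t1I.
have [e0 e00 he] := grow t1 t1I; exists e0 => // u u' uI u'I ue u'e /Pi[h1 h2].
exact: (he u u').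
Qed.

End ManifoldGeodesics.

Lemma mvt_in_interval {R : realType} (f df : R -> R) (a b s t : R) :
  (forall u, a < u < b -> is_derive u 1 f (df u)) -> a < s -> s <= t -> t < b ->
  exists2 c, s <= c <= t & f t - f s = df c * (t - s).
Proof.
move=> h as_ st tb.
have cf : {within `[s, t], continuous f}.
  apply: derivable_within_continuous => u; rewrite in_itv /= => /andP[u1 u2].
  by have [] : is_derive u 1 f (df u) by apply: h; apply/andP; split; lra.
have hd u : u \in `]s, t[%R -> is_derive u 1 f (df u).
  by rewrite in_itv /= => /andP[u1 u2]; apply: h; apply/andP; split; lra.
have [c] := MVT_segment st hd cf.
by rewrite in_itv /= => ci e; exists c.
Qed.

(** * Existence of geodesics for a uniform time *)

Section GeodesicExistence.
Context {R : realType} {n : nat} (M : kahlerManifold R n).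
Local Notation N := (n + n)%N.
Local Notation V := 'rV[R]_(n + n).
Local Notation W := 'rV[R]_((n + n) + (n + n)).
Implicit Types (phi psi : chart R (n + n) M) (c : R -> M) (p q : M) (t s : R) (w : W).
Local Notation met := (kmetric M).
Local Notation img := (@chart_img R (n + n) M).

Lemma flow_geod phi w0 k (rho d : R) Phi w t0 c : katlas M phi ->
  flow_on (geo_field (met phi)) (geo_dom (img phi)) k w0 rho d Phi -> `|w - w0| < rho ->
  (forall s, t0 - d < s < t0 + d -> c s = chart_inv phi (lsubmx (Phi (s - t0) w))) ->
  forall s, t0 - d < s < t0 + d -> [/\ geod_at c s, jet phi c s = Phi (s - t0) w & chart_dom phi (c s)].
Proof.
move=> a [rho0 d0 F0 Ft FC] hw hc s sI.
apply: (geod_at_chart (X := fun s => Phi (s - t0) w) a).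
apply: filterS (near_interval sI) => u uI.
have uI' : - d < u - t0 < d by lra.
have [h1 h2] := Ft _ _ hw uI'; split => //; last exact: hc.
have E : 1 * u + - t0 = u - t0 by rewrite mul1r.
have := @is_derive_affine_comp R _ (fun s => Phi s w) 1 (- t0) u (geo_field (met phi) (Phi (u - t0) w)).
rewrite E scale1r => /(_ h2) h3; apply: (is_derive_ext h3 _ erefl) => y; by rewrite mul1r.
Qed.

(** By uniqueness, every geodesic whose jet enters the domain of the local flow follows it; in
    particular it stays in the chart for the time of the flow. *)
Lemma geod_follow phi w0 k (rho d a b t0 : R) Phi c : katlas M phi ->
  flow_on (geo_field (met phi)) (geo_dom (img phi)) k w0 rho d Phi ->
  geod_on a b c -> a < t0 < b -> chart_dom phi (c t0) -> `|jet phi c t0 - w0| < rho ->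
  forall t, a < t < b -> `|t - t0| < d ->
    chart_dom phi (c t) /\ jet phi c t = Phi (t - t0) (jet phi c t0).
Proof.
move=> aphi fl g t0I dt0 hw t tI td.
set w := jet phi c t0 in hw *.
pose c2 s := chart_inv phi (lsubmx (Phi (s - t0) w)).
have H := flow_geod (c := c2) (t0 := t0) aphi fl hw (fun _ _ => erefl).
have [rho0 d0 F0 _ _] := fl.
have t0d : t0 - d < t0 < t0 + d by lra.
have [_ e0 d2] := H t0 t0d; rewrite subrr F0 // in e0.
pose a' := Num.max a (t0 - d); pose b' := Num.min b (t0 + d).
have sub s : a' < s < b' -> a < s < b /\ t0 - d < s < t0 + d.
  by rewrite gt_max lt_min => /andP[/andP[-> ->] /andP[-> ->]].
have sup s : a < s < b -> t0 - d < s < t0 + d -> a' < s < b'.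
  by rewrite gt_max lt_min => /andP[-> ->] /andP[-> ->].
have tI' : a' < t < b' by apply: sup => //; move: td; rewrite ltr_norml => /andP[x1 x2]; lra.
have ec : c t0 = c2 t0.
  by rewrite -(chart_mapK dt0) -(chart_mapK d2) -!jet_l e0.
have E : forall s, a' < s < b' -> c s = c2 s.
  apply: (geod_unique _ _ (sup _ t0I t0d) aphi ec dt0).
  - by move=> s /sub[/g].
  - by move=> s /sub[_ /H[]].
  - by rewrite e0.
have [_ tI2] := sub _ tI'; have [_ <- dt] := H t tI2.
rewrite (E t tI'); split => //; apply: jet_near.
by apply: filterS (near_interval tI') => s; exact: E.
Qed.

Lemma sq_chart phi psi c t : katlas M phi -> katlas M psi -> geod_at c t ->
  chart_dom phi (c t) -> chart_dom psi (c t) ->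
  sq (met phi) (jet phi c t) = sq (met psi) (jet psi c t).
Proof.
move=> a b g d1 d2; rewrite (jet_transition a b g.1 d1 d2 (geod_at_derivable g a d1)).
have [ov e] := overlap_map d1 d2.
rewrite /sq /extended_field row_mxKl row_mxKr jet_l.
exact: transition_metric.
Qed.

Lemma energy_const (a b t0 : R) c phi psi t : geod_on a b c -> a < t0 < b -> a < t < b ->
  katlas M phi -> katlas M psi -> chart_dom phi (c t0) -> chart_dom psi (c t) ->
  sq (met psi) (jet psi c t) = sq (met phi) (jet phi c t0).
Proof.
move=> g t0I tI aphi apsi d0 d1.
pose P s := forall psi, katlas M psi -> chart_dom psi (c s) -> sq (met psi) (jet psi c s) = sq (met phi) (jet phi c t0).
suff : P t by apply.
apply: (interval_induction (s0 := t0) (a := a) (b := b)) => //; last first.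
  by move=> chi achi dchi; exact: (sq_chart achi aphi (g _ t0I)).
move=> t1 t1I; have [chi achi dchi] := kcovering (c t1).
have nn : nbhs t1 ([set s | chart_dom chi (c s)] `&` [set s | a < s < b]).
  by apply: filterI; [exact: near_dom (g _ t1I).1 dchi|exact: near_interval].
have [e e0 he] := nbhs_norm_lt (W := R^o) nn.
exists e => // s s' sI s'I se s'e Ps' chi' a' d'.
have r := kriemannian achi; have oi := @chart_img_open _ _ _ chi.
have D u : t1 - e < u < t1 + e -> is_derive u 1 (fun s => sq (met chi) (jet chi c s)) 0.
  move=> ue; have [d2 uI] : chart_dom chi (c u) /\ a < u < b.
    by apply: he; rewrite ltr_norml; lra.
  apply: (energy_derive oi r) ((g _ uI).2 _ achi d2).
  by rewrite /geo_dom /= jet_l; exact: chart_img_map.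
have C x y : t1 - e < x < t1 + e -> t1 - e < y < t1 + e -> x <= y ->
    sq (met chi) (jet chi c x) = sq (met chi) (jet chi c y).
  move=> /andP[x1 x2] /andP[y1 y2] xy.
  have [z _] := mvt_in_interval D x1 xy y2.
  by rewrite mul0r => /eqP; rewrite subr_eq0 => /eqP ->.
have I1 : t1 - e < s < t1 + e by move: se; rewrite ltr_norml => /andP[x1 x2]; lra.
have I2 : t1 - e < s' < t1 + e by move: s'e; rewrite ltr_norml => /andP[x1 x2]; lra.
have [ds _] := he s se; have [ds' _] := he s' s'e.
rewrite (sq_chart a' achi (g _ sI) d' ds) -(Ps' chi achi ds').
by have [/C->|/ltW/C->] := leP s s'.
Qed.

(* Cauchy-Schwarz against the dual basis vectors bounds the coordinates of [u]. *)
Lemma local_norm_bound phi z0 : katlas M phi -> img phi z0 ->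
  exists r C : R, [/\ 0 < r, 0 < C & forall z (u : V), `|z - z0| < r -> img phi z /\
     (bf (met phi z) u u <= 1 -> `|u| < C)].
Proof.
move=> a iz0; have r := kriemannian a; have oi := @chart_img_open _ _ _ phi.
have CI : Ck 0 (img phi) (fun z => invmx (met phi z)).
  by apply: Ck_invmx => //; [exact: (metric_unit r)|exact: (metric_Ck r)].
have c0 := Ck_cont CI iz0.
have nb : nbhs z0 [set z : V | `|invmx (met phi z) - invmx (met phi z0)| < 1].
  have nb0 : nbhs (invmx (met phi z0)) [set A : 'M[R]_(n + n) | `|A - invmx (met phi z0)| < 1].
    by apply: (norm_lt_nbhs ltr01) => A.
  exact: c0 _ nb0.
have nn : nbhs z0 ([set z : V | `|invmx (met phi z) - invmx (met phi z0)| < 1] `&` img phi).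
  by apply: filterI => //; exact: open_nbhs_nbhs (conj oi iz0).
have [e e0 he] := nbhs_norm_lt nn.
pose K := `|invmx (met phi z0)| + 1.
have K0 : 0 < K by rewrite ltr_wpDl.
exists e, (K + 1); split => //; first by rewrite addr_gt0.
move=> z u /he[h1 iz]; split => // u1.
have Kb : `|invmx (met phi z)| <= K.
  have : `|invmx (met phi z)| <= `|invmx (met phi z) - invmx (met phi z0)| + `|invmx (met phi z0)|.
    by rewrite -{1}[invmx (met phi z)](subrK (invmx (met phi z0))) ler_normD.
  by move=> h; apply: (le_trans h); rewrite addrC lerD2l ltW.
apply: (@le_lt_trans _ _ K); last by rewrite ltrDl.
have K1 : 1 <= K by rewrite lerDr.
apply: mx_norm_leP => [|i k]; first exact: ltW.
rewrite (ord1 i); pose g := delta_mx 0 k *m invmx (met phi z) : V.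
have gu v : bf (met phi z) g v = v 0 k.
  by rewrite bf_mulmxV ?(metric_unit r) // -rowE !mxE.
have gg : bf (met phi z) g g <= K.
  rewrite gu /g -rowE mxE; apply: le_trans (ler_norm _) _; apply: le_trans Kb; exact: coord_le_norm.
have p s : 0 <= bf (met phi z) (u - s *: g) (u - s *: g) by exact: (metric_ge0 r).
have ug : bf (met phi z) u g = u 0 k by rewrite (bf_sym _ _ (metric_sym r iz)) gu.
have := p (u 0 k / K); rewrite bfBl !bfBr !bfZl !bfZr ug gu.
set x := u 0 k; move: gg; rewrite gu; move: (g 0 k) u1 => G0; move: (bf _ u u) => Q Q1 G1 h.
have xK : x ^+ 2 <= K.
  have k2 : x / K * (x / K) * G0 <= x / K * (x / K) * K by rewrite ler_wpM2l // -expr2 sqr_ge0.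
  have k3 : x / K * (x / K) * K = x ^+ 2 / K by field; rewrite gt_eqF.
  have k4 : x / K * x = x ^+ 2 / K by field; rewrite gt_eqF.
  have : x ^+ 2 / K <= 1 by lra.
  by rewrite ler_pdivrMr // mul1r.
have x2 : `|x| ^+ 2 <= K ^+ 2.
  rewrite real_normK ?num_real //; apply: (le_trans xK).
  by rewrite expr2 -[leLHS]mul1r ler_wpM2r // ltW.
by move: x2; rewrite ler_pXn2r // nnegrE ?normr_ge0 // ltW.
Qed.

Definition short_time (d : R) q := forall phi (u : V) t0, katlas M phi -> chart_dom phi q ->
  bf (met phi (chart_map phi q)) u u <= 1 ->
  exists2 c, geod_on (t0 - d) (t0 + d) c & c t0 = q /\ jet phi c t0 = row_mx (chart_map phi q) u.

(** Homogeneity of the spray: changing the time scale rescales the velocity. *)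
Lemma scaled_solution (G : V -> 'M[R]_(n + n)) (U : set V) (oU : open U) (riem : riemannian U G)
    (X : R -> W) (l t0 s : R) : l != 0 ->
  geo_dom U (X (l^-1 * s + t0)) ->
  is_derive (l^-1 * s + t0) 1 X (geo_field G (X (l^-1 * s + t0))) ->
  let X' := fun s => row_mx (lsubmx (X (l^-1 * s + t0))) (l^-1 *: rsubmx (X (l^-1 * s + t0))) in
  geo_dom U (X' s) /\ is_derive s 1 X' (geo_field G (X' s)).
Proof.
move=> l0 Us h X'; split; first by rewrite /geo_dom /= /X' row_mxKl.
have h1 := is_derive_affine_comp h.
have hl := is_derive_lsubmx h1; have hr := is_derive_rsubmx h1.
move: hl hr; rewrite /geo_field !linearZ /= row_mxKl row_mxKr => hl hr.
have hr' := is_deriveZ (l^-1) hr.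
have h2 := is_derive_row_mx hl hr'.
have e : geo_field G (X' s) = row_mx (l^-1 *: rsubmx (X (l^-1 * s + t0)))
    (l^-1 *: (l^-1 *: - Gam G (lsubmx (X (l^-1 * s + t0))) (rsubmx (X (l^-1 * s + t0))) (rsubmx (X (l^-1 * s + t0))))).
  by rewrite /geo_field /X' row_mxKl row_mxKr (GamZl oU riem _ _ _ Us) (GamZr oU riem _ _ _ Us) !scalerN.
exact: (is_derive_ext h2 (fun _ => erefl) (esym e)).
Qed.

Lemma short_time_near p : exists2 d : R, 0 < d & \forall q \near p, short_time d q.
Proof.
have [phi0 a0 d0] := kcovering p.
have r := kriemannian a0; have oi := @chart_img_open _ _ _ phi0.
have i0 := chart_img_map d0; set z0 := chart_map phi0 p in i0.
have [e [C [e0 C0 hC]]] := local_norm_bound a0 i0.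
have w0D : geo_dom (img phi0) (row_mx z0 0) by rewrite /geo_dom /= row_mxKl.
have [rho [d [Phi [fl _]]]] := local_flow 0 (geo_field_smooth oi r) w0D.
have [rho0 dd0 F0 Ft _] := fl.
(* The flow near the zero vector covers vectors of coordinate norm below [rho]; vectors of metric
   length at most 1 are shrunk into this range by [l], at the price of time [l * d] instead of
   [d]. *)
pose l := rho / C; have l0 : 0 < l by rewrite divr_gt0.
exists (l * d); first by rewrite mulr_gt0.
have nb : nbhs z0 [set z : V | `|z - z0| < Num.min e rho].
  have m0 : 0 < Num.min e rho by rewrite lt_min e0.
  by apply: (norm_lt_nbhs m0) => y.
have n1 : nbhs p (chart_map phi0 @^-1` [set z : V | `|z - z0| < Num.min e rho]) := chart_map_cont d0 nb.
have n2 : nbhs p (chart_dom phi0) := open_nbhs_nbhs (conj (chart_dom_open phi0) d0).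
apply: filterS2 n1 n2 => q hq dq.
move: hq; rewrite /= lt_min => /andP[he hrho].
have [iz _] := hC _ 0 he.
have main (u : V) t0 : bf (met phi0 (chart_map phi0 q)) u u <= 1 ->
   exists2 c, geod_on (t0 - l * d) (t0 + l * d) c & c t0 = q /\ jet phi0 c t0 = row_mx (chart_map phi0 q) u.
  move=> u1; have uC := (hC _ u he).2 u1.
  pose w := row_mx (chart_map phi0 q) (l *: u) : W.
  have hw : `|w - row_mx z0 0| < rho.
    rewrite /w row_mxB subr0; apply: norm_row_mx_lt => //.
    by rewrite normrZ gtr0_norm // -[ltRHS](divfK (lt0r_neq0 C0)) -/l ltr_pM2l.
  pose X s := Phi s w.
  pose X' s := row_mx (lsubmx (X (l^-1 * s + - (l^-1 * t0)))) (l^-1 *: rsubmx (X (l^-1 * s + - (l^-1 * t0)))) : W.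
  pose c s := chart_inv phi0 (lsubmx (X' s)).
  have H s : t0 - l * d < s < t0 + l * d -> [/\ geod_at c s, jet phi0 c s = X' s & chart_dom phi0 (c s)].
    move=> sI; apply: (geod_at_chart (X := X') a0).
    apply: filterS (near_interval sI) => y yI.
    have yI' : - d < l^-1 * y + - (l^-1 * t0) < d.
      rewrite -mulrBr -ltr_norml normrM gtr0_norm ?invr_gt0 // ltr_pdivrMl // ltr_norml; lra.
    have [h1 h2] := Ft _ _ hw yI'.
    by have [h3 h4] := scaled_solution oi r (lt0r_neq0 l0) h1 h2; split.
  have t0I : t0 - l * d < t0 < t0 + l * d by have := mulr_gt0 l0 dd0; lra.
  have X0 : X' t0 = row_mx (chart_map phi0 q) u.
    rewrite /X' subrr /X F0 // /w row_mxKl row_mxKr scalerA mulVf ?gt_eqF // scale1r //.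
  exists c; first by move=> s /H[].
  have [_ j0 _] := H _ t0I; split; last by rewrite j0.
  by rewrite /c X0 row_mxKl chart_mapK.
move=> phi u t0 a dphi u1.
have [ov e1] := overlap_map dphi dq; have [ov' e2] := overlap_map dq dphi.
have u1' : bf (met phi0 (chart_map phi0 q)) ('D_u (transition phi phi0) (chart_map phi q))
    ('D_u (transition phi phi0) (chart_map phi q)) <= 1.
  by rewrite -e1 -(transition_metric _ _ a a0 ov).
have [c g [cq cj]] := main _ t0 u1'.
exists c => //; split => //.
have t0I : t0 - l * d < t0 < t0 + l * d by have := mulr_gt0 l0 dd0; lra.
have G := g _ t0I.
have dq' : chart_dom phi0 (c t0) by rewrite cq.
have dphi' : chart_dom phi (c t0) by rewrite cq.
rewrite (jet_transition a0 a G.1 dq' dphi' (geod_at_derivable G a0 dq')) cj /extended_field row_mxKl row_mxKr e2.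
congr row_mx.
by have := transition_derive_surj u a0 a ov'; rewrite e2.
Qed.

(** Shorter times are valid wherever longer ones are, so the local times have a common positive
    lower bound on a compact manifold. *)
Lemma short_time_uniform : compact [set: M] -> exists2 d : R, 0 < d & forall q, short_time d q.
Proof.
move=> /compact_near_coveringP cM.
have H : \forall r \near (0 : R)^'+, [set: M] `<=` [set q | short_time r q].
  apply: (cM R (0 : R)^'+ (fun r q => short_time r q)) => p _.
  have [d d0 nd] := short_time_near p.
  exists ([set q | short_time d q], [set r : R | 0 < r < d]).
    split => //=; exists d => //= r /=; rewrite sub0r normrN => rd r0.
    by rewrite r0 /=; apply: le_lt_trans (ler_norm _) rd.
  move=> [q r] [/= Sq /andP[r0 rd]] phi u t0 a dphi u1.
  have [c g h] := Sq phi u t0 a dphi u1; exists c => // s /andP[s1 s2]; apply: g.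
  by apply/andP; split; lra.
have nz : \forall r \near (0 : R)^'+, 0 < r by exact: nbhs_right_gt.
near (0 : R)^'+ => r; exists r; first by near: r.
move=> q; have h : [set: M] `<=` [set q | short_time r q] by near: r.
exact: h.
Unshelve. all: by end_near.
Qed.

Definition long_geodesic (d T : R) phi w c :=
  [/\ geod_on (- d) T c, c 0 = chart_inv phi (lsubmx w) & jet phi c 0 = w].

(** A short geodesic is restarted at time [T - d / 2] with the velocity reached there, which is
    still of length at most 1 because the speed is constant. The two curves agree where they
    overlap, and [d / 2] is gained. *)
Lemma long_geodesic_extend (d T : R) phi w c : 0 < d -> d <= T -> (forall q, short_time d q) ->
  katlas M phi -> geo_dom (img phi) w -> sq (met phi) w <= 1 ->
  long_geodesic d T phi w c -> exists c', long_geodesic d (T + d / 2) phi w c'.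
Proof.
move=> d0 dT short aphi Dw w1 [g c0 j0].
pose t0 := T - d / 2.
have t0I : - d < t0 < T by rewrite /t0; apply/andP; split; lra.
have z0I : - d < 0 < T by apply/andP; split; lra.
have dc0 : chart_dom phi (c 0) by rewrite c0; have [] := chart_invK Dw.
have [psi apsi dpsi] := kcovering (c t0).
have E := energy_const g z0I t0I aphi apsi dc0 dpsi.
have E1 : bf (met psi (chart_map psi (c t0))) (rsubmx (jet psi c t0)) (rsubmx (jet psi c t0)) <= 1.
  by rewrite -jet_l -/(sq _ _) E j0.
have [c2 g2 [c20 j20]] := short (c t0) psi _ t0 apsi dpsi E1.
rewrite -jet_l hsubmxK in j20.
have eq2 s : t0 - d < s < T -> c s = c2 s.
  apply: (geod_unique (s0 := t0) (phi := psi)) => //.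
  - by move=> u uI; apply: g; move: uI; rewrite /t0 => /andP[u1 u2]; apply/andP; split; lra.
  - by move=> u uI; apply: g2; move: uI; rewrite /t0 => /andP[u1 u2]; apply/andP; split; lra.
  - by rewrite /t0; apply/andP; split; lra.
pose c' s := if s < T then c s else c2 s.
have n1 s : s < T -> \forall u \near s, c u = c' u.
  move=> sT; have sI : s - 1 < s < T by apply/andP; split; lra.
  by apply: filterS (near_interval sI) => u /andP[_ uT]; rewrite /c' uT.
exists c'; split.
- move=> s /andP[s1 s2]; have [sT|Ts] := ltP s T.
    by apply: (geod_at_near (n1 _ sT)); apply: g; rewrite s1.
  have sI : t0 - d < s < T + d / 2 by rewrite /t0; apply/andP; split; lra.
  apply: (geod_at_near (c := c2)); last first.
    by apply: g2; rewrite /t0; apply/andP; split; lra.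
  apply: filterS (near_interval sI) => u /andP[u1 u2]; rewrite /c'.
  by case: ltP => // uT; rewrite eq2 // u1.
- by rewrite /c' (_ : 0 < T) //; lra.
- have T0 : 0 < T by lra.
  by rewrite -(jet_near phi (n1 _ T0)).
Qed.

(** The geodesics extend beyond 0 and 1 on both sides, so that ordinary derivatives exist at both
    ends of the unit interval. The choice is made separately for each chart. *)
Theorem geodesic_family : compact [set: M] ->
  exists2 d : R, 0 < d & exists gam : chart R (n + n) M -> W -> R -> M,
   forall phi w, katlas M phi -> geo_dom (img phi) w -> sq (met phi) w <= 1 ->
     long_geodesic d 2 phi w (gam phi w).
Proof.
move=> /short_time_uniform[d d0 short]; exists d => //.
have H : forall x : chart R (n + n) M * W, exists c : R -> M,
    katlas M x.1 -> geo_dom (img x.1) x.2 -> sq (met x.1) x.2 <= 1 -> long_geodesic d 2 x.1 x.2 c.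
  move=> [phi w] /=.
  have [[a [Dw w1]]|no] := pselect (katlas M phi /\ geo_dom (img phi) w /\ sq (met phi) w <= 1); last first.
    by exists (fun=> chart_inv phi 0) => a Dw w1; exfalso; apply: no.
  have [dw ew] := chart_invK Dw.
  have step k : exists c, long_geodesic d (d + k%:R * (d / 2)) phi w c.
    elim: k => [|k [c IH]].
      have w1' : bf (met phi (chart_map phi (chart_inv phi (lsubmx w)))) (rsubmx w) (rsubmx w) <= 1.
        by rewrite ew.
      have [c g [c0 j0]] := short _ phi _ 0 a dw w1'.
      exists c; split => //; last by rewrite j0 ew hsubmxK.
      by move=> s /andP[s1 s2]; apply: g; apply/andP; split; lra.
    have dT : d <= d + k%:R * (d / 2) by rewrite lerDl mulr_ge0 // divr_ge0 // ltW.
    have [c' h] := long_geodesic_extend d0 dT short a Dw w1 IH; exists c'.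
    by move: h; rewrite -addrA -{2}[d / 2]mul1r -mulrDl natr1.
  (* After [k] extensions the time [d + k d / 2] exceeds 2. *)
  pose k := Num.bound (4 / d).
  have [c [g c0 j0]] := step k; exists c => _ _ _; split => // s /andP[s1 s2]; apply: g.
  have kd : 4 / d < k%:R by apply: archi_boundP; rewrite divr_ge0 // ltW.
  have k4 : 4 < k%:R * d by rewrite -ltr_pdivrMr.
  by apply/andP; split; lra.
have [gam h] := choice H; exists (fun phi w => gam (phi, w)) => phi w a Dw w1.
exact: (h (phi, w)).
Qed.

End GeodesicExistence.

(** * Variations of geodesics *)

Lemma is_derive_increasing {R : realType} (f : R -> R) (t df : R) : is_derive t 1 f df -> 0 < df ->
  exists2 e, 0 < e & forall s, t < s < t + e -> f t < f s.
Proof.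
move=> [fd fE] df0.
Transparent derive.
have C : (fun h : R => h^-1 *: (f (h *: 1 + t) - f t)) @ 0^' --> df by rewrite -fE; exact: fd.
Opaque derive.
have /cvgrPdist_lt/(_ df df0)[e /= e0 he] := C.
exists e => // s /andP[ts se].
have h0 : 0 < s - t by rewrite subr_gt0.
have := he (s - t); rewrite /= sub0r normrN gtr0_norm // => /(_ _ _).
rewrite [(s - t) *: 1]mulr1 subrK => h.
have := h (ltac:(lra)) (ltac:(by rewrite gt_eqF)).
move=> /(le_lt_trans (ler_norm _)); rewrite gtrDl oppr_lt0.
by rewrite [_ *: _]/(_ * _) pmulr_rgt0 ?invr_gt0 // subr_gt0.
Qed.

Lemma Ck_shrink {R : realType} m p k (r : R) (w0 : 'rV[R]_m) (f : 'rV[R]_m -> 'rV[R]_p) (O : set 'rV[R]_p) : 0 < r ->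
  Ck k [set w | `|w - w0| < r] f -> open O -> O (f w0) ->
  exists r', [/\ 0 < r', r' <= r & forall w, `|w - w0| < r' -> O (f w)].
Proof.
move=> r0 C oO Of0; have w0r : [set w | `|w - w0| < r] w0 by rewrite /= subrr normr0.
have [e e0 he] := nbhs_norm_lt (Ck_cont C w0r (open_nbhs_nbhs (conj oO Of0))).
exists (Num.min r e); rewrite lt_min r0 e0 ge_min lexx; split => // w.
by rewrite lt_min => /andP[_ /he].
Qed.

Section GeodesicFamily.
Context {R : realType} {n : nat} (M : kahlerManifold R n).
Local Notation N := (n + n)%N.
Local Notation V := 'rV[R]_(n + n).
Local Notation W := 'rV[R]_((n + n) + (n + n)).
Implicit Types (phi psi chi : chart R (n + n) M) (c : R -> M) (p q : M) (t s : R) (w v : W).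
Local Notation met := (kmetric M).
Local Notation img := (@chart_img R (n + n) M).
Local Notation J := (@stdJ R n).
Context (d : R) (gam : chart R (n + n) M -> W -> R -> M) (d0 : 0 < d).
Hypothesis long : forall phi w, katlas M phi -> geo_dom (img phi) w -> sq (met phi) w <= 1 ->
     long_geodesic d 2 phi w (gam phi w).
Context (phi0 : chart R (n + n) M) (a0 : katlas M phi0).

(** The strict bound makes the set open, so that derivatives in the initial jet make sense. *)
Definition disc : set W := [set w | geo_dom (img phi0) w /\ sq (met phi0) w < 1].

Lemma open_disc : open disc.
Proof.
have oi := @chart_img_open _ _ _ phi0; have r := kriemannian a0.
have oD : open (geo_dom (img phi0)) by exact: open_lsubmx.
rewrite openE => w [Dw w1].
have h1 : nbhs w (geo_dom (img phi0)) := open_nbhs_nbhs (conj oD Dw).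
have h2 : nbhs w (sq (met phi0) @^-1` [set x : R | x < 1]).
  exact: (cvgr_lt _ (Ck_cont (sq_Ck oi r 0) Dw) _ w1).
exact: filterI h1 h2.
Qed.

Lemma disc_geod w : disc w -> geod_on (- d) 2 (gam phi0 w).
Proof. by move=> [Dw /ltW w1]; have [] := long a0 Dw w1. Qed.

Lemma disc_jet0 w : disc w -> jet phi0 (gam phi0 w) 0 = w.
Proof. by move=> [Dw /ltW w1]; have [] := long a0 Dw w1. Qed.

Lemma disc_point0 w : disc w -> gam phi0 w 0 = chart_inv phi0 (lsubmx w).
Proof. by move=> [Dw /ltW w1]; have [] := long a0 Dw w1. Qed.

Lemma disc_dom0 w : disc w -> chart_dom phi0 (gam phi0 w 0).
Proof. by move=> h; rewrite disc_point0 //; have [] := chart_invK h.1. Qed.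

Let zero_in : - d < (0 : R) < 2.
Proof. by rewrite oppr_lt0 d0 ltr0n. Qed.

(** Smooth dependence on the initial jet at one fixed time, including that the nearby geodesics are
    then still in the chart [psi]. *)
Definition jet_smooth (k : nat) w0 psi t := exists r : R, [/\ 0 < r,
  forall w, `|w - w0| < r -> disc w /\ chart_dom psi (gam phi0 w t) &
  Ck k [set w | `|w - w0| < r] (fun w => jet psi (gam phi0 w) t)].

Lemma jet_smooth_chart k w0 chi psi t : disc w0 -> - d < t < 2 -> katlas M chi -> katlas M psi ->
  chart_dom psi (gam phi0 w0 t) -> jet_smooth k w0 chi t -> jet_smooth k w0 psi t.
Proof.
move=> D0 tI achi apsi dpsi [r [r0 hr Cr]].
have sT := transition_smooth achi apsi.
have oO : open [set w : W | overlap chi psi (lsubmx w)] by exact: open_lsubmx (@open_overlap _ _ _ chi psi).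
have [_ dchi] := hr w0 (ltac:(by rewrite subrr normr0)).
have O0 : [set w : W | overlap chi psi (lsubmx w)] (jet chi (gam phi0 w0) t).
  by rewrite /= jet_l; have [] := overlap_map dchi dpsi.
have [r' [r'0 r'r hr']] := Ck_shrink r0 Cr oO O0.
have oB := @open_norm_lt R _ w0 r'.
have sub w : `|w - w0| < r' -> disc w /\ chart_dom psi (gam phi0 w t).
  move=> h; have [Dw dw] := hr w (lt_le_trans h r'r); split => //.
  by have [_] := hr' w h; rewrite /= jet_l chart_mapK.
exists r'; split => //.
have Cr' : Ck k [set w | `|w - w0| < r'] (fun w => jet chi (gam phi0 w) t).
  by apply: Ck_sub Cr => w /= h; exact: lt_le_trans h r'r.
have CT := Ck_comp_mx oB oO hr' Cr' (extended_smooth sT k).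
apply: (Ck_eq oB _ CT) => w h /=.
have [Dw dw] := hr w (lt_le_trans h r'r); have [_ dw'] := sub w h.
have G := disc_geod Dw tI.
by rewrite (jet_transition achi apsi G.1 dw dw' (geod_at_derivable G achi dw)).
Qed.

Lemma jet_smooth_step k w0 chi t t' (rho e : R) w1 Phi : disc w0 -> katlas M chi ->
  flow_on (geo_field (met chi)) (geo_dom (img chi)) k w1 rho e Phi ->
  - d < t' < 2 -> - d < t < 2 -> `|t - t'| < e ->
  `|jet chi (gam phi0 w0) t' - w1| < rho -> jet_smooth k w0 chi t' ->
  exists r : R, [/\ 0 < r, forall w, `|w - w0| < r ->
     [/\ disc w, chart_dom chi (gam phi0 w t'), `|jet chi (gam phi0 w) t' - w1| < rho,
     chart_dom chi (gam phi0 w t) & jet chi (gam phi0 w) t = Phi (t - t') (jet chi (gam phi0 w) t')] &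
  Ck k [set w | `|w - w0| < r] (fun w => jet chi (gam phi0 w) t')].
Proof.
move=> D0 achi fl t'I tI te hw [r [r0 hr Cr]].
have [r' [r'0 r'r hr']] := Ck_shrink r0 Cr (@open_norm_lt R _ w1 rho) hw.
exists r'; split => //; last by apply: Ck_sub Cr => w /= h; exact: lt_le_trans h r'r.
move=> w h; have [Dw dw] := hr w (lt_le_trans h r'r).
have hh := hr' w h.
by have [h1 h2] := geod_follow achi fl (disc_geod Dw) t'I dw hh tI te; split.
Qed.

(** Near [t1] all nearby geodesics follow one local flow, so the jet at [t] is the jet at [t']
    composed with the time [t - t'] map. The order [k] is fixed because the domain of the local flow
    depends on it. *)
Theorem jet_smooth_all k w0 psi t : disc w0 -> - d < t < 2 -> katlas M psi ->
  chart_dom psi (gam phi0 w0 t) -> jet_smooth k w0 psi t.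
Proof.
move=> D0 tI; move: psi.
pose P t := forall psi, katlas M psi -> chart_dom psi (gam phi0 w0 t) -> jet_smooth k w0 psi t.
apply: (interval_induction (P := P) (s0 := 0) (a := - d) (b := 2)) => //; last first.
  move=> psi apsi dpsi; apply: (jet_smooth_chart (chi := phi0)) => //.
  have [r r0 hr] := nbhs_norm_lt (open_nbhs_nbhs (conj open_disc D0)).
  exists r; split => //; first by move=> w /hr Dw; split => //; exact: disc_dom0.
  apply: (Ck_eq (@open_norm_lt R _ w0 r) _ (Ck_id k _)) => w /hr Dw /=; by rewrite disc_jet0.
move=> t1 t1I; have G := disc_geod D0 t1I.
have [chi achi dchi] := kcovering (gam phi0 w0 t1).
have r := kriemannian achi; have oi := @chart_img_open _ _ _ chi.
have Dj : geo_dom (img chi) (jet chi (gam phi0 w0) t1) by rewrite /geo_dom /= jet_l; exact: chart_img_map.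
have [rho [e [Phi [fl _]]]] := local_flow k (geo_field_smooth oi r) Dj.
set w1 := jet chi (gam phi0 w0) t1 in Dj fl.
have [rho0 e0 _ _ FC] := fl.
have nb : nbhs w1 [set y : W | `|y - w1| < rho] by apply: (norm_lt_nbhs rho0) => y.
have nn : nbhs t1 (jet chi (gam phi0 w0) @^-1` [set y : W | `|y - w1| < rho] `&` [set s | chart_dom chi (gam phi0 w0 s)]).
  by apply: filterI; [exact: geod_jet_continuous G achi dchi _ nb|exact: near_dom G.1 dchi].
have [e1 e10 he1] := nbhs_norm_lt (W := R^o) nn.
exists (Num.min e1 (e / 2)); first by rewrite lt_min e10 divr_gt0.
move=> {}t t' {}tI t'I; rewrite !lt_min => /andP[te1 te] /andP[t'e1 t'e] Pt' psi apsi dpsi.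
have [hw dt'] := he1 _ t'e1.
have tt' : `|t - t'| < e.
  by have := ler_distD t1 t t'; rewrite (distrC t1 t'); lra.
have [r1 [r10 hr Cr]] := jet_smooth_step D0 achi fl t'I tI tt' hw (Pt' chi achi dt').
apply: (jet_smooth_chart (chi := chi)) => //; exists r1; split => //.
  by move=> w /hr[].
have te' : - e < t - t' < e by rewrite -ltr_norml.
have oB := @open_norm_lt R _ w0 r1.
have sub w : [set w | `|w - w0| < r1] w -> [set y : W | `|y - w1| < rho] (jet chi (gam phi0 w) t') by move=> /hr[].
have CC := Ck_comp_mx oB (@open_norm_lt R _ w1 rho) sub Cr (FC _ te').
apply: (Ck_eq oB _ CC) => w /hr[_ _ _ _ E] /=; by rewrite E.
Qed.

(** The variation of the geodesic when its initial jet moves along [v]: the Jacobi field together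
    with its coordinate derivative. *)
Definition var w0 v psi t : W := 'D_v (fun w => jet psi (gam phi0 w) t) w0.

Lemma jet_diff w0 psi t : disc w0 -> - d < t < 2 -> katlas M psi -> chart_dom psi (gam phi0 w0 t) ->
  differentiable (fun w => jet psi (gam phi0 w) t) w0.
Proof.
move=> D0 tI a dpsi; have [r [r0 hr Cr]] := jet_smooth_all 1 D0 tI a dpsi.
by apply: (Ck1_diff_mx (@open_norm_lt R _ w0 r) Cr); rewrite /= subrr normr0.
Qed.

Lemma var0 w0 v : disc w0 -> var w0 v phi0 0 = v.
Proof.
move=> D0; rewrite -[RHS](derive_id w0 v); apply: near_eq_derive.
apply: filterS (open_nbhs_nbhs (conj open_disc D0)) => w Dw; exact: disc_jet0.
Qed.

(** The local flow at [t1] maps the jet at [t1] to the jet at [t], so near [t1] the variation is the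
    derivative of this flow applied to [var w0 v psi t1]; the variational equation of the flow at
    time 0 is then the claim. *)
Lemma var_linearized w0 v psi t1 : disc w0 -> - d < t1 < 2 -> katlas M psi -> chart_dom psi (gam phi0 w0 t1) ->
  is_derive t1 1 (var w0 v psi) ('D_(var w0 v psi t1) (geo_field (met psi)) (jet psi (gam phi0 w0) t1)).
Proof.
move=> D0 t1I apsi dpsi.
have r := kriemannian apsi; have oi := @chart_img_open _ _ _ psi.
have Dj : geo_dom (img psi) (jet psi (gam phi0 w0) t1) by rewrite /geo_dom /= jet_l; exact: chart_img_map.
have [rho [e [Phi [fl lin]]]] := local_flow 1 (geo_field_smooth oi r) Dj.
set w1 := jet psi (gam phi0 w0) t1 in Dj fl lin *.
have [rho0 e0 F0 _ FC] := fl.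
have w1rho : `|w1 - w1| < rho by rewrite subrr normr0.
have z0 : - e < 0 < e by lra.
have E t : - d < t < 2 -> `|t - t1| < e -> var w0 v psi t = 'D_(var w0 v psi t1) (Phi (t - t1)) w1.
  move=> tI te.
  have [r1 [r10 hr Cr]] := jet_smooth_step D0 apsi fl t1I tI te w1rho (jet_smooth_all 1 D0 t1I apsi dpsi).
  have te' : - e < t - t1 < e by rewrite -ltr_norml.
  have dP : differentiable (Phi (t - t1)) w1 by exact: (Ck1_diff_mx (@open_norm_lt R _ w1 rho) (FC _ te')).
  have dj := jet_diff D0 t1I apsi dpsi.
  rewrite -(derive_comp_rV v dj dP); apply: near_eq_derive.
  have n1 : nbhs w0 [set w | `|w - w0| < r1] by apply: (norm_lt_nbhs r10) => w.
  by apply: filterS n1 => w /hr[_ _ _ _ h] /=; rewrite h.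
have H := lin w1 0 (var w0 v psi t1) w1rho z0.
have D1 : 'D_(var w0 v psi t1) (Phi 0) w1 = var w0 v psi t1.
  rewrite -[RHS](derive_id w1 (var w0 v psi t1)); apply: near_eq_derive.
  have n1 : nbhs w1 [set w | `|w - w1| < rho] by apply: (norm_lt_nbhs rho0) => w.
  by apply: filterS n1 => w /F0.
have E0 := F0 w1 w1rho.
have eq0 : 'D_('D_(var w0 v psi t1) (Phi 0) w1) (geo_field (met psi)) (Phi 0 w1) =
    'D_(var w0 v psi t1) (geo_field (met psi)) w1 by rewrite D1 E0.
have t10 : 0 = 1 * t1 + - t1 by rewrite mul1r subrr.
have H1 := is_derive_ext H (fun _ => erefl) eq0; rewrite t10 in H1.
have H' := is_derive_affine_comp H1; rewrite scale1r in H'.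
have nr : \forall t \near t1, (fun s => 'D_(var w0 v psi t1) (Phi (1 * s + - t1)) w1) t = var w0 v psi t.
  have ne : nbhs t1 [set t : R | `|t - t1| < e] by apply: (@norm_lt_nbhs R R^o t1 _ e).
  by apply: filterS2 (near_interval t1I) ne => t tI te /=; rewrite (E t tI te) mul1r.
exact: (near_eq_is_derive nr H').
Qed.

Lemma var_chart w0 v chi psi t : disc w0 -> - d < t < 2 -> katlas M chi -> katlas M psi ->
  chart_dom chi (gam phi0 w0 t) -> chart_dom psi (gam phi0 w0 t) ->
  var w0 v psi t = 'D_(var w0 v chi t) (extended_field (transition chi psi)) (jet chi (gam phi0 w0) t).
Proof.
move=> D0 tI achi apsi dchi dpsi.
have sT := transition_smooth achi apsi; have [ov _] := overlap_map dchi dpsi.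
have oD : open [set w : W | overlap chi psi (lsubmx w)] by exact: open_lsubmx (@open_overlap _ _ _ chi psi).
have ov' : overlap chi psi (lsubmx (jet chi (gam phi0 w0) t)) by rewrite jet_l.
have dE := Ck1_diff_mx oD (extended_smooth sT 1) ov'.
rewrite -(derive_comp_rV v (jet_diff D0 tI achi dchi) dE); apply: near_eq_derive.
have [r1 [r10 h1 _]] := jet_smooth_all 0 D0 tI achi dchi.
have [r2 [r20 h2 _]] := jet_smooth_all 0 D0 tI apsi dpsi.
have n1 : nbhs w0 [set w | `|w - w0| < r1] by apply: (norm_lt_nbhs r10) => w.
have n2 : nbhs w0 [set w | `|w - w0| < r2] by apply: (norm_lt_nbhs r20) => w.
apply: filterS2 n1 n2 => w /h1[Dw dw] /h2[_ dw'] /=.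
have G := disc_geod Dw tI.
by rewrite (jet_transition achi apsi G.1 dw dw' (geod_at_derivable G achi dw)).
Qed.

Local Notation T chi psi w0 t v := ('D_v (transition chi psi) (chart_map chi (gam phi0 w0 t))).

(** The second half of [var] is no tangent vector; only after the correction in [covar] do the
    second derivatives of the transition map cancel. *)
Lemma frame_chart w0 v chi psi t : disc w0 -> - d < t < 2 -> katlas M chi -> katlas M psi ->
  chart_dom chi (gam phi0 w0 t) -> chart_dom psi (gam phi0 w0 t) ->
  [/\ rsubmx (jet psi (gam phi0 w0) t) = T chi psi w0 t (rsubmx (jet chi (gam phi0 w0) t)),
      lsubmx (var w0 v psi t) = T chi psi w0 t (lsubmx (var w0 v chi t)) &
      covar (met psi) (jet psi (gam phi0 w0) t) (var w0 v psi t) =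
      T chi psi w0 t (covar (met chi) (jet chi (gam phi0 w0) t) (var w0 v chi t))].
Proof.
move=> D0 tI achi apsi dchi dpsi.
have sT := transition_smooth achi apsi; have [ov eT] := overlap_map dchi dpsi.
have ov' : overlap chi psi (lsubmx (jet chi (gam phi0 w0) t)) by rewrite jet_l.
have G := disc_geod D0 tI.
have ej := jet_transition achi apsi G.1 dchi dpsi (geod_at_derivable G achi dchi).
have eu : rsubmx (jet psi (gam phi0 w0) t) = T chi psi w0 t (rsubmx (jet chi (gam phi0 w0) t)).
  by rewrite ej /extended_field row_mxKr jet_l.
have ev := var_chart v D0 tI achi apsi dchi dpsi.
rewrite (derive_extended_field _ sT ov') jet_l in ev.
split; [exact: eu|by rewrite ev row_mxKl|].
rewrite /covar eu ev row_mxKr row_mxKl !jet_l.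
have dT := transition_diff achi apsi ov.
have r := kriemannian achi; have oi := @chart_img_open _ _ _ chi.
have r' := kriemannian apsi; have oi' := @chart_img_open _ _ _ psi.
rewrite (deriveDl _ _ dT) (Gam_sym oi r _ _ ov.1) (transition_Gam _ _ achi apsi ov) eT.
rewrite (Gam_sym oi' r' _ _ (chart_img_map dpsi)).
by apply/rowP => j; rewrite !mxE; ring.
Qed.

End GeodesicFamily.

(** * First and second variation, absence of conjugate points *)

Section Variations.
Context {R : realType} {n : nat} (M : kahlerManifold R n).
Local Notation N := (n + n)%N.
Local Notation V := 'rV[R]_(n + n).
Local Notation W := 'rV[R]_((n + n) + (n + n)).
Implicit Types (phi psi chi : chart R (n + n) M) (c : R -> M) (p q : M) (t s : R) (w v : W).
Local Notation met := (kmetric M).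
Local Notation img := (@chart_img R (n + n) M).
Local Notation J := (@stdJ R n).
Context (d : R) (gam : chart R (n + n) M -> W -> R -> M) (d0 : 0 < d).
Hypothesis long : forall phi w, katlas M phi -> geo_dom (img phi) w -> sq (met phi) w <= 1 ->
     long_geodesic d 2 phi w (gam phi w).
Context (phi0 : chart R (n + n) M) (a0 : katlas M phi0) (w0 v : W) (D0 : disc phi0 w0).
Local Notation c := (gam phi0 w0).
Local Notation X := (fun psi => jet psi (gam phi0 w0)).
Local Notation Z := (var gam phi0 w0 v).

Let inI t : 0 <= t <= 1 -> - d < t < 2.
Proof.
move=> /andP[t0 t1]; rewrite (lt_le_trans _ t0) ?oppr_lt0 //=.
by apply: (le_lt_trans t1); rewrite ltr1n.
Qed.

(** The mean value theorem along a geodesic that may leave every chart: a chart is chosen at each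
    time, and independence of the choice makes the resulting function differentiable. [A] carries
    what is known about the derivative. *)
Lemma chart_mvt (f : chart R (n + n) M -> R -> R) (A : R -> R -> Prop) s t psi0 psi1 :
  (forall chi psi (u : R), - d < u < 2 -> katlas M chi -> katlas M psi ->
     chart_dom chi (c u) -> chart_dom psi (c u) -> f chi u = f psi u) ->
  (forall psi (u : R), 0 <= u <= 1 -> katlas M psi -> chart_dom psi (c u) ->
     exists2 df, is_derive u 1 (f psi) df & A u df) ->
  0 <= s -> s <= t -> t <= 1 -> katlas M psi0 -> katlas M psi1 ->
  chart_dom psi0 (c s) -> chart_dom psi1 (c t) ->
  exists u df, [/\ 0 <= u <= 1, A u df & f psi1 t - f psi0 s = df * (t - s)].
Proof.
move=> indep der s0 st t1 b0 b1 k0 k1.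
have [ch hch] : exists ch : R -> chart R (n + n) M, forall u, katlas M (ch u) /\ chart_dom (ch u) (c u).
  have H (u : R) : exists chi, katlas M chi /\ chart_dom chi (c u).
    by have [chi x y] := kcovering (c u); exists chi.
  by have [ch hc] := choice H; exists ch.
pose F u := f (ch u) u.
have FE psi (u : R) : - d < u < 2 -> katlas M psi -> chart_dom psi (c u) -> F u = f psi u.
  by move=> uI a k; have [a' k'] := hch u; apply: indep.
have [df hdf] : exists df : R -> R, forall u : R, 0 <= u <= 1 -> is_derive u 1 F (df u) /\ A u (df u).
  have H (u : R) : exists e : R, 0 <= u <= 1 -> is_derive u 1 F e /\ A u e.
    have [uI|] := boolP (0 <= u <= 1); last by exists 0.
    have [a k] := hch u; have [e he Ae] := der _ u uI a k; exists e => _; split => //.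
    apply: near_eq_is_derive he.
    apply: filterS2 (near_dom (disc_geod long a0 D0 (inI uI)).1 k) (near_interval (inI uI)) => y ky yI.
    by rewrite (FE (ch u)).
  by have [df hd] := choice H; exists df.
have cF : {within `[s, t], continuous F}.
  apply: derivable_within_continuous => u; rewrite in_itv /= => /andP[u1 u2].
  have uI : 0 <= u <= 1 by apply/andP; split; lra.
  by have [[]] := hdf u uI.
have hd u : u \in `]s, t[%R -> is_derive u 1 F (df u).
  rewrite in_itv /= => /andP[u1 u2]; have uI : 0 <= u <= 1 by apply/andP; split; lra.
  by have [] := hdf u uI.
have [u] := MVT_segment st hd cF.
rewrite in_itv /= => /andP[u1 u2] e; exists u, (df u).
have uI : 0 <= u <= 1 by apply/andP; split; lra.
have sI : - d < s < 2 by apply: inI; apply/andP; split; lra.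
have tI : - d < t < 2 by apply: inI; apply/andP; split; lra.
split => //; first by have [] := hdf u uI.
by rewrite -(FE psi1 t tI b1 k1) -(FE psi0 s sI b0 k0).
Qed.

Let zI : - d < (0 : R) < 2. Proof. by apply: inI; rewrite lexx ler01. Qed.

Lemma jet_dom psi t : chart_dom psi (c t) -> geo_dom (img psi) (jet psi c t).
Proof. by move=> k; rewrite /geo_dom /= jet_l; exact: chart_img_map. Qed.

Lemma jet_solution psi t : - d < t < 2 -> katlas M psi -> chart_dom psi (c t) ->
  is_derive t 1 (jet psi c) (geo_field (met psi) (jet psi c t)).
Proof. by move=> tI a k; have [_] := disc_geod long a0 D0 tI; apply. Qed.

Lemma sq_along w psi t : disc phi0 w -> - d < t < 2 -> katlas M psi -> chart_dom psi (gam phi0 w t) ->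
  sq (met psi) (jet psi (gam phi0 w) t) = sq (met phi0) w.
Proof.
move=> Dw tI a k.
rewrite (energy_const (disc_geod long a0 Dw) zI tI a0 a (disc_dom0 long a0 Dw) k).
by rewrite (disc_jet0 long a0 Dw).
Qed.

(** The squared speed is constant along each geodesic of the family, so its variation may be
    computed at any time [t]. *)
Lemma derive_energy psi t : - d < t < 2 -> katlas M psi -> chart_dom psi (c t) ->
  'D_v (sq (met phi0)) w0 = 2 * bf (met psi (lsubmx (jet psi c t))) (covar (met psi) (jet psi c t) (Z psi t)) (rsubmx (jet psi c t)).
Proof.
move=> tI a k; have r := kriemannian a; have oi := @chart_img_open _ _ _ psi.
rewrite -(derive_sq oi r (Z psi t) (jet_dom k)).
have oD : open (geo_dom (img psi)) by exact: open_lsubmx.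
have dS : differentiable (sq (met psi)) (jet psi c t) by exact: (Ck1_diff oD (sq_Ck oi r 1) (jet_dom k)).
rewrite -(derive_comp_rV v (jet_diff d0 long a0 D0 tI a k) dS); apply: near_eq_derive.
have [r1 [r10 h1 _]] := jet_smooth_all d0 long a0 0 D0 tI a k.
have n1 : nbhs w0 [set w | `|w - w0| < r1] by apply: (norm_lt_nbhs r10) => w.
by apply: filterS n1 => w /h1[Dw kw] /=; rewrite sq_along.
Qed.

Lemma pairing_chart chi psi t : - d < t < 2 -> katlas M chi -> katlas M psi ->
  chart_dom chi (c t) -> chart_dom psi (c t) ->
  let g := met chi (lsubmx (jet chi c t)) in let g' := met psi (lsubmx (jet psi c t)) in
  let u := rsubmx (jet chi c t) in let u' := rsubmx (jet psi c t) in
  let Y := lsubmx (Z chi t) in let Y' := lsubmx (Z psi t) in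
  let P := covar (met chi) (jet chi c t) (Z chi t) in let P' := covar (met psi) (jet psi c t) (Z psi t) in
  [/\ bf g u Y = bf g' u' Y', bf g Y Y = bf g' Y' Y', bf g P Y = bf g' P' Y' &
      bf g (J u) Y = bf g' (J u') Y' /\ bf g (J u) P = bf g' (J u') P'].
Proof.
move=> tI a b k l; have [eu eY eP] := frame_chart d0 long a0 v D0 tI a b k l.
have [ov eT] := overlap_map k l.
cbv zeta; rewrite !jet_l eu eY eP -!(transition_J _ a b ov) -eT.
by do !split; rewrite (transition_metric _ _ a b ov).
Qed.

(** The pairing of velocity and Jacobi field has a constant derivative along the geodesic, namely
    half the variation of the squared speed. *)
Theorem first_variation psi : katlas M psi -> chart_dom psi (c 1) ->
  'D_v (sq (met phi0)) w0 = 2 * (bf (met psi (chart_map psi (c 1))) (rsubmx (jet psi c 1)) (lsubmx (Z psi 1))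
    - bf (met phi0 (lsubmx w0)) (rsubmx w0) (lsubmx v)).
Proof.
move=> a k.
pose f chi t := bf (met chi (lsubmx (jet chi c t))) (rsubmx (jet chi c t)) (lsubmx (Z chi t)).
have indep chi chi' (u : R) : - d < u < 2 -> katlas M chi -> katlas M chi' ->
     chart_dom chi (c u) -> chart_dom chi' (c u) -> f chi u = f chi' u.
  by move=> uI b b' l l'; have [] := pairing_chart uI b b' l l'.
have der chi (u : R) : 0 <= u <= 1 -> katlas M chi -> chart_dom chi (c u) ->
    exists2 df, is_derive u 1 (f chi) df & (fun _ df => df = 2^-1 * 'D_v (sq (met phi0)) w0) u df.
  move=> uI b l; have r := kriemannian b; have oi := @chart_img_open _ _ _ chi.
  eexists; first exact: (momentum_derive oi r (jet_dom l) (jet_solution (inI uI) b l) (var_linearized d0 long a0 v D0 (inI uI) b l)).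
  rewrite (derive_energy (inI uI) b l) mulrA mulVf // mul1r.
  exact: (bf_sym _ _ (metric_sym r (jet_dom l))).
have [u [df [uI -> e]]] := chart_mvt indep der (lexx 0) ler01 (lexx 1) a0 a (disc_dom0 long a0 D0) k.
move: e; rewrite /f jet_l (disc_jet0 long a0 D0) (var0 long a0 v D0) => ->.
by rewrite subr0 mulr1 mulrA divff ?mul1r // pnatr_eq0.
Qed.

Context (hbis : bisectional_in_01 M) (e2 : sq (met phi0) w0 <= 2^-1).

Let bounds psi : katlas M psi -> forall z x y : V,
  img psi z -> bf (met psi z) x x = 1 -> bf (met psi z) y y = 1 -> 0 < Bis (met psi) z x y <= 1.
Proof.
move=> a; apply: (real_bisectional_bounds (@chart_img_open _ _ _ psi) (kriemannian a) (khermitian a)).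
  by move=> z u v' w; apply: kclosed.
by move=> z u v'; apply: hbis.
Qed.

(** The function [f] of [growth_derive] is nondecreasing and vanishes at both ends, while its
    derivative at 0 is the squared norm of the initial covariant derivative. *)
Theorem no_conjugate psi : katlas M psi -> chart_dom psi (c 1) ->
  lsubmx v = 0 -> lsubmx (Z psi 1) = 0 -> v = 0.
Proof.
move=> a k v0 Z1.
pose f chi t := bf (met chi (lsubmx (jet chi c t))) (covar (met chi) (jet chi c t) (Z chi t)) (lsubmx (Z chi t))
     + (2 * t - 1) * bf (met chi (lsubmx (jet chi c t))) (lsubmx (Z chi t)) (lsubmx (Z chi t)).
have indep chi chi' (u : R) : - d < u < 2 -> katlas M chi -> katlas M chi' ->
     chart_dom chi (c u) -> chart_dom chi' (c u) -> f chi u = f chi' u.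
  by move=> uI b b' l l'; have [_ h1 h2 _] := pairing_chart uI b b' l l'; rewrite /f h1 h2.
have der chi (u : R) : 0 <= u <= 1 -> katlas M chi -> chart_dom chi (c u) ->
    exists2 df, is_derive u 1 (f chi) df & 0 <= df /\ (lsubmx (Z chi u) = 0 ->
      df = bf (met chi (lsubmx (jet chi c u))) (covar (met chi) (jet chi c u) (Z chi u)) (covar (met chi) (jet chi c u) (Z chi u))).
  move=> uI b l; have r := kriemannian b; have oi := @chart_img_open _ _ _ chi.
  apply: (growth_derive oi r (khermitian b) _ (jet_dom l) (jet_solution (inI uI) b l) (var_linearized d0 long a0 v D0 (inI uI) b l) (bounds b) uI).
    by move=> z x y w; apply: kclosed.
  by rewrite sq_along // inI.
have k0 := disc_dom0 long a0 D0; have r := kriemannian a0; have oi := @chart_img_open _ _ _ phi0.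
have z01 : 0 <= (0 : R) <= 1 by rewrite lexx ler01.
have [df hdf [df0 dfE]] := der phi0 0 z01 a0 k0.
rewrite (var0 long a0 v D0) (disc_jet0 long a0 D0) in dfE.
have {}dfE := dfE v0.
have P0 : covar (met phi0) w0 v = rsubmx v.
  rewrite /covar v0; have := GamZr oi r 0 (rsubmx w0) 0 D0.1; rewrite !scale0r => ->; by rewrite addr0.
apply: contrapT => nv.
have nr : rsubmx v != 0.
  by apply/eqP => r0; apply: nv; rewrite -[v]hsubmxK v0 r0 row_mx0.
have dfp : 0 < df by rewrite dfE P0; exact: (metric_pos r D0.1 nr).
have [e e0 he] := is_derive_increasing hdf dfp.
have [e1 e10 he1] := nbhs_norm_lt (W := R^o) (near_dom (disc_geod long a0 D0 zI).1 k0).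
(* A time at which [f] is already positive and the geodesic is still in the chart [phi0];
   monotonicity from [s] to 1 then contradicts [f psi 1 = 0]. *)
pose s := Num.min (Num.min (e / 2) (e1 / 2)) 2^-1.
have eh : 0 < e / 2 by rewrite divr_gt0.
have eh1 : 0 < e1 / 2 by rewrite divr_gt0.
have s0 : 0 < s by rewrite /s !lt_min eh eh1 invr_gt0 ltr0n.
have se : s <= e / 2 by rewrite /s !ge_min lexx.
have se1 : s <= e1 / 2 by rewrite /s !ge_min lexx orbT.
have s1 : s <= 2^-1 by rewrite /s ge_min lexx orbT.
clearbody s.
have ks : chart_dom phi0 (c s) by apply: he1; rewrite subr0 gtr0_norm //; lra.
have fs : f phi0 0 < f phi0 s by apply: he; apply/andP; split; lra.
have der' chi (u : R) : 0 <= u <= 1 -> katlas M chi -> chart_dom chi (c u) ->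
    exists2 df, is_derive u 1 (f chi) df & (fun _ df => 0 <= df) u df.
  by move=> yI b l; have [z h1 [h2 _]] := der chi u yI b l; exists z.
have s1' : s <= 1 by apply: le_trans s1 _; rewrite invf_le1 // ler1n.
have [u [df' [uI df'_ge0 df'0]]] := chart_mvt indep der' (ltW s0) s1' (lexx 1) a0 a ks k.
have f0 : f phi0 0 = 0 by rewrite /f (var0 long a0 v D0) v0 !bf0r mulr0 addr0.
have f1 : f psi 1 = 0 by rewrite /f Z1 !bf0r mulr0 addr0.
have : 0 <= df' * (1 - s) by rewrite mulr_ge0 // subr_ge0.
by rewrite f0 in fs; rewrite -df'0 f1 sub0r oppr_ge0 leNgt fs.
Qed.

(** The function of [rotation_derive] is strictly decreasing. Its corrections vanish where the
    Jacobi field equals J u, so at both ends it is the pairing of the Jacobi field with its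
    covariant derivative. *)
Theorem second_variation psi : katlas M psi -> chart_dom psi (c 1) -> rsubmx w0 != 0 ->
  lsubmx v = J (rsubmx w0) -> lsubmx (Z psi 1) = J (rsubmx (jet psi c 1)) ->
  bf (met psi (chart_map psi (c 1))) (covar (met psi) (jet psi c 1) (Z psi 1)) (lsubmx (Z psi 1))
  < bf (met phi0 (lsubmx w0)) (covar (met phi0) w0 v) (lsubmx v).
Proof.
move=> a k u0 v0 Z1.
pose f chi t := 2 * bf (met chi (lsubmx (jet chi c t))) (J (rsubmx (jet chi c t))) (covar (met chi) (jet chi c t) (Z chi t))
     - bf (met chi (lsubmx (jet chi c t))) (covar (met chi) (jet chi c t) (Z chi t)) (lsubmx (Z chi t))
     - (2 * t - 1) * (sq (met chi) (jet chi c t) - 2 * bf (met chi (lsubmx (jet chi c t))) (J (rsubmx (jet chi c t))) (lsubmx (Z chi t))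
        + bf (met chi (lsubmx (jet chi c t))) (lsubmx (Z chi t)) (lsubmx (Z chi t))).
have ends chi t : - d < t < 2 -> katlas M chi -> chart_dom chi (c t) -> lsubmx (Z chi t) = J (rsubmx (jet chi c t)) ->
   f chi t = bf (met chi (lsubmx (jet chi c t))) (covar (met chi) (jet chi c t) (Z chi t)) (lsubmx (Z chi t)).
  move=> tI b l E; have r := kriemannian b.
  have JJ : sq (met chi) (jet chi c t) = bf (met chi (lsubmx (jet chi c t))) (J (rsubmx (jet chi c t))) (J (rsubmx (jet chi c t))).
    by rewrite (metric_J (khermitian b) _ _ (jet_dom l)).
  rewrite /f E JJ (bf_sym (J _) (covar _ _ _) (metric_sym r (jet_dom l))).
  move: (bf _ _ (J _)) (bf _ (J _) (J _)) => x y; ring.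
have k0 := disc_dom0 long a0 D0.
have oneI : - d < (1 : R) < 2 by apply: inI; rewrite lexx ler01.
have indep chi chi' (t : R) : - d < t < 2 -> katlas M chi -> katlas M chi' ->
     chart_dom chi (c t) -> chart_dom chi' (c t) -> f chi t = f chi' t.
  move=> tI b b' l l'; have [_ h1 h2 [h3 h4]] := pairing_chart tI b b' l l'.
  by rewrite /f h1 h2 h3 h4 !sq_along.
have der chi (t : R) : 0 <= t <= 1 -> katlas M chi -> chart_dom chi (c t) ->
    exists2 df, is_derive t 1 (f chi) df & (fun _ df => df < 0) t df.
  move=> tI b l; have r := kriemannian b; have oi := @chart_img_open _ _ _ chi.
  have E := sq_along D0 (inI tI) b l.
  apply: (rotation_derive oi r (khermitian b) _ (jet_dom l) (jet_solution (inI tI) b l) (var_linearized d0 long a0 v D0 (inI tI) b l) (bounds b) tI).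
  - by move=> z x y w; apply: kclosed.
  - by rewrite E.
  apply/eqP => z; have := metric_pos (kriemannian a0) D0.1 u0; rewrite -/(sq _ _) -E /sq z bf0l ltxx //.
have [u [df [uI df0]]] := chart_mvt indep der (lexx 0) ler01 (lexx 1) a0 a k0 k.
rewrite subr0 mulr1 (ends psi 1 oneI a k Z1).
rewrite (ends phi0 0 zI a0 k0); last by rewrite (var0 long a0 v D0) (disc_jet0 long a0 D0).
rewrite (var0 long a0 v D0) (disc_jet0 long a0 D0) jet_l => e.
by move: df0; rewrite -e subr_lt0.
Qed.

End Variations.

(** * Geodesics with common endpoints *)

Section PairMap.
Context {R : realType} {n : nat} (M : kahlerManifold R n).
Local Notation N := (n + n)%N.
Local Notation V := 'rV[R]_(n + n).
Local Notation W := 'rV[R]_((n + n) + (n + n)).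
Implicit Types (phi psi chi : chart R (n + n) M) (c : R -> M) (p q : M) (t s : R) (w v : W).
Local Notation met := (kmetric M).
Local Notation img := (@chart_img R (n + n) M).
Local Notation J := (@stdJ R n).
Context (d : R) (gam : chart R (n + n) M -> W -> R -> M) (d0 : 0 < d).
Hypothesis long : forall phi w, katlas M phi -> geo_dom (img phi) w -> sq (met phi) w <= 1 ->
     long_geodesic d 2 phi w (gam phi w).
Hypothesis hbis : bisectional_in_01 M.

Let oneI : - d < (1 : R) < 2.
Proof. by rewrite (lt_trans _ ltr01) ?oppr_lt0 //= ltr1n. Qed.

(** A chart expression of the map from tangent vectors to pairs (origin, endpoint). *)
Definition pair_map phi psi w : W := row_mx (lsubmx w) (lsubmx (jet psi (gam phi w) 1)).

Lemma var_derive phi psi w0 v : katlas M phi -> katlas M psi -> disc phi w0 -> chart_dom psi (gam phi w0 1) ->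
  is_derive w0 v (fun w => jet psi (gam phi w) 1) (var gam phi w0 v psi 1).
Proof.
move=> a b D0 k; apply: derivableP; apply: diff_derivable; exact: (jet_diff d0 long a D0 oneI b k).
Qed.

Lemma pair_map_derive phi psi w0 v : katlas M phi -> katlas M psi -> disc phi w0 -> chart_dom psi (gam phi w0 1) ->
  'D_v (pair_map phi psi) w0 = row_mx (lsubmx v) (lsubmx (var gam phi w0 v psi 1)).
Proof.
move=> a b D0 k; pose L : {linear W -> V} := @lsubmx R 1 N N.
have h1 : is_derive w0 v (L : W -> V) (lsubmx v).
  by apply: chain_is_derive; exact: (chain_linear (L := L)).
move: h1 (var_derive v a b D0 k) => /is_derive_mxP h1 /is_derive_mxP h2.
suff : is_derive w0 v (pair_map phi psi) (row_mx (lsubmx v) (lsubmx (var gam phi w0 v psi 1))) by case.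
apply/is_derive_mxP => i j; case: (split_ordP j) => l ->.
  by rewrite row_mxEl; apply: is_derive_ext (h1 i l) _ _ => // y; rewrite row_mxEl.
by rewrite row_mxEr; apply: is_derive_ext (h2 i (lshift N l)) _ _ => [y|]; rewrite ?row_mxEr mxE.
Qed.

(** A vector in the kernel of the derivative is a Jacobi field vanishing at both ends, which
    [no_conjugate] excludes. *)
Lemma pair_inverse k phi psi w0 : katlas M phi -> katlas M psi -> disc phi w0 -> sq (met phi) w0 <= 2^-1 ->
  chart_dom psi (gam phi w0 1) ->
  exists (D : set W) (g : W -> W),
   [/\ open D /\ D w0, forall w, D w -> disc phi w /\ chart_dom psi (gam phi w 1),
       open (pair_map phi psi @` D), forall w, D w -> g (pair_map phi psi w) = w &
       Ck k.+1 (pair_map phi psi @` D) g].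
Proof.
move=> a b D0 w2 kk.
have [r [r0 hr Cr]] := jet_smooth_all d0 long a k.+1 D0 oneI b kk.
have oB := @open_norm_lt R _ w0 r.
have CF : Ck k.+1 [set w | `|w - w0| < r] (pair_map phi psi).
  exact: (Ck_row_mx oB (Ck_lsubmx (p := N) oB (Ck_id _ _)) (Ck_lsubmx (p := N) oB Cr)).
have w0B : [set w | `|w - w0| < r] w0 by rewrite /= subrr normr0.
have C1 : Ck 1 [set w | `|w - w0| < r] (pair_map phi psi) by apply: Ck_le CF.
have inj v : 'D_v (pair_map phi psi) w0 = 0 -> v = 0.
  rewrite (pair_map_derive v a b D0 kk) -row_mx0 => E.
  have [e1 e2] := eq_row_mx E.
  rewrite row_mx0; exact: (no_conjugate d0 long a D0 hbis w2 b kk e1 e2).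
have [D [g [oD Dw0 DB oI [gK Cg]]]] := inverse_function oB w0B C1 inj.
exists D, g; split => //; last exact: Cg CF.
by move=> w /DB /hr.
Qed.

(* Half the derivative of the squared length when the ends of the geodesic move in the directions [a] and [b]. *)
Definition momentum_gap phi psi (a b : V) w : R :=
  bf (met psi (chart_map psi (gam phi w 1))) (rsubmx (jet psi (gam phi w) 1)) b
  - bf (met phi (lsubmx w)) (rsubmx w) a.

(** The endpoints are moved along straight coordinate lines, and the inverse of the pair map
    supplies the geodesics between them. The terms with [Gam] are the covariant accelerations of
    these lines; they cancel when the two geodesics of a minimal pair are added. *)
Theorem endpoint_variation phi psi w0 (a b : V) : katlas M phi -> katlas M psi -> disc phi w0 ->
  sq (met phi) w0 <= 2^-1 -> chart_dom psi (gam phi w0 1) ->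
  exists (e : R) (w : R -> W) (v : W), [/\ 0 < e, w 0 = w0 /\ {for (0 : R), continuous w},
    forall s, `|s| < e -> [/\ disc phi (w s), chart_dom psi (gam phi (w s) 1),
      lsubmx (w s) = s *: a + lsubmx w0 &
      chart_map psi (gam phi (w s) 1) = s *: b + chart_map psi (gam phi w0 1)],
    forall s, `|s| < e -> is_derive s 1 (sq (met phi) \o w) (2 * momentum_gap phi psi a b (w s)) &
    [/\ lsubmx v = a, lsubmx (var gam phi w0 v psi 1) = b &
     is_derive (0 : R) 1 (fun s => momentum_gap phi psi a b (w s))
      (bf (met psi (chart_map psi (gam phi w0 1))) (covar (met psi) (jet psi (gam phi w0) 1) (var gam phi w0 v psi 1)) b
       + bf (met psi (chart_map psi (gam phi w0 1))) (rsubmx (jet psi (gam phi w0) 1)) (Gam (met psi) (chart_map psi (gam phi w0 1)) b b)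
       - (bf (met phi (lsubmx w0)) (covar (met phi) w0 v) a
          + bf (met phi (lsubmx w0)) (rsubmx w0) (Gam (met phi) (lsubmx w0) a a)))]].
Proof.
move=> aphi apsi D0 w2 k0.
have [D [g [[oD Dw0] hD oI gK Cg]]] := pair_inverse 0 aphi apsi D0 w2 k0.
pose y0 := pair_map phi psi w0; pose ab : W := row_mx a b.
have Iy0 : (pair_map phi psi @` D) y0 by exists w0.
have [rho rho0 hr] := nbhs_norm_lt (open_nbhs_nbhs (conj oI Iy0)).
pose e := rho / (`|ab| + 1).
have n1 : 0 < `|ab| + 1 by rewrite ltr_wpDl.
have e0 : 0 < e by rewrite divr_gt0.
pose y (s : R) : W := s *: ab + y0.
pose w s := g (y s).
have Iy s : `|s| < e -> (pair_map phi psi @` D) (y s).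
  move=> se; apply: hr; rewrite /y addrK normrZ.
  apply: (@le_lt_trans _ _ (`|s| * (`|ab| + 1))); first by rewrite ler_wpM2l // lerDl.
  by rewrite -ltr_pdivlMr.
have Fw s : `|s| < e -> D (w s) /\ pair_map phi psi (w s) = y s.
  by move=> /Iy[x Dx xy]; rewrite /w -xy gK.
have near_e s : `|s| < e -> nbhs s [set u : R | `|u| < e].
  move=> se; apply: (@norm_lt_nbhs R R^o s _ (e - `|s|)); first by rewrite subr_gt0.
  by move=> u hu /=; rewrite -(subrK s u); apply: (le_lt_trans (ler_normD _ _)); rewrite -ltrBrDr.
have pos s : `|s| < e -> [/\ disc phi (w s), chart_dom psi (gam phi (w s) 1),
      lsubmx (w s) = s *: a + lsubmx w0 &
      chart_map psi (gam phi (w s) 1) = s *: b + chart_map psi (gam phi w0 1)].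
  move=> /Fw[/hD[h1 h2] h3]; split => //.
    by have := congr1 lsubmx h3; rewrite /y /ab /y0 /pair_map linearD linearZ /= !row_mxKl.
  by have := congr1 rsubmx h3; rewrite /y /ab /y0 /pair_map linearD linearZ /= !row_mxKr !jet_l.
pose v s := 'D_ab g (y s).
have hw s : `|s| < e -> is_derive s 1 w (v s).
  by move=> /Iy h; apply: is_derive_line; exact: (Ck_derivable Cg h).
have hj s : `|s| < e -> is_derive s 1 (fun s => jet psi (gam phi (w s)) 1) (var gam phi (w s) (v s) psi 1).
  move=> se; have [h1 h2 _ _] := pos s se.
  exact: (is_derive_curve (jet_diff d0 long aphi h1 oneI apsi h2) (hw s se)).
have hline (z x : V) (s : R) : is_derive s 1 (fun u : R => u *: z + x) z.
  have := @is_derive_line R _ _ (id : V -> V) x z s (@derivable_id _ _ _ _).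
  by rewrite derive_id.
have va s : `|s| < e -> lsubmx (v s) = a.
  move=> se; have [_ E1] := is_derive_lsubmx (hw s se); have [_ E2] := hline a (lsubmx w0) s.
  rewrite -E1 -E2; apply: near_eq_derive; apply: filterS (near_e s se) => u ue.
  by have [_ _ ->] := pos u ue.
have vb s : `|s| < e -> lsubmx (var gam phi (w s) (v s) psi 1) = b.
  move=> se; have [_ E1] := is_derive_lsubmx (hj s se); have [_ E2] := hline b (chart_map psi (gam phi w0 1)) s.
  rewrite -E1 -E2; apply: near_eq_derive; apply: filterS (near_e s se) => u ue.
  by rewrite jet_l; have [_ _ _ ->] := pos u ue.
have z0 : `|0 : R| < e by rewrite normr0.
have w00 : w 0 = w0 by rewrite /w /y scale0r add0r /y0 gK.
exists e, w, (v 0); split => //.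
- split => //; have [dw _] := hw 0 z0.
  by apply: differentiable_continuous; apply/derivable1_diffP.
- move=> s se; have [h1 h2 h3 h4] := pos s se.
  have r := kriemannian aphi; have oi := @chart_img_open _ _ _ phi.
  have oG : open (geo_dom (img phi)) by exact: open_lsubmx.
  have hs := is_derive_curve (Ck1_diff oG (sq_Ck oi r 1) h1.1) (hw s se).
  rewrite (first_variation d0 long aphi (v s) h1 apsi h2) (va s se) (vb s se) in hs.
  exact: hs.
have r := kriemannian aphi; have oi := @chart_img_open _ _ _ phi.
have r' := kriemannian apsi; have oi' := @chart_img_open _ _ _ psi.
split; [exact: va z0|by have := vb 0 z0; rewrite w00|].
have hwz := hw 0 z0; have hjz := hj 0 z0.
have hl := is_derive_lsubmx hwz; have hr0 := is_derive_rsubmx hwz.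
have hjl := is_derive_lsubmx hjz; have hjr := is_derive_rsubmx hjz.
have vaz := va 0 z0; have vbz := vb 0 z0.
rewrite vaz in hl; rewrite vbz in hjl.
have jl x : lsubmx (jet psi (gam phi (w x)) 1) = chart_map psi (gam phi (w x) 1) by rewrite jet_l.
have hc : is_derive (0 : R) 1 (fun s => chart_map psi (gam phi (w s) 1)) b := is_derive_ext hjl jl erefl.
have U1 : img psi (chart_map psi (gam phi (w 0) 1)) by rewrite w00; exact: chart_img_map.
have U2 : img phi (lsubmx (w 0)) by rewrite w00; exact: D0.1.
have hG1 := is_derive_curve (metric_diff oi' r' U1) hc; rewrite DmxE in hG1.
have hG2 := is_derive_curve (metric_diff oi r U2) hl; rewrite DmxE in hG2.
have K1 := covariant_product (c := fun s => chart_map psi (gam phi (w s) 1)) oi' r' U1 hG1 hjr (is_derive_cst b (0 : R) 1).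
have K2 := covariant_product (c := fun s => lsubmx (w s)) oi r U2 hG2 hr0 (is_derive_cst a (0 : R) 1).
have K := is_deriveB K1 K2.
apply: (is_derive_ext K (fun _ => erefl)).
rewrite w00 in vaz vbz U1 U2 *.
rewrite !add0r /covar vaz vbz !jet_l.
by rewrite (Gam_sym oi' r' b (rsubmx _) U1) (Gam_sym oi r a (rsubmx _) U2).
Qed.

End PairMap.

Section LocalMinimum.
Context {R : realType}.
Implicit Types (f k : R -> R) (e s : R).

Lemma local_min_first f df e : 0 < e -> (forall s, `|s| < e -> f 0 <= f s) ->
  is_derive (0 : R) 1 f df -> 0 <= df.
Proof.
move=> e0 hf d; rewrite leNgt; apply/negP => df0.
have ndf : 0 < - df by rewrite oppr_gt0.
have [e1 e10 he] := is_derive_increasing (is_deriveN d) ndf.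
pose s := Num.min (e / 2) (e1 / 2).
have s0 : 0 < s by rewrite lt_min !divr_gt0.
have se : s <= e / 2 by rewrite ge_min lexx.
have se1 : s <= e1 / 2 by rewrite ge_min lexx orbT.
clearbody s.
have h1 : f 0 <= f s by apply: hf; rewrite gtr0_norm //; lra.
have := he s; rewrite add0r s0 /= => /(_ _) h2.
have : - f 0 < - f s by apply: h2; lra.
by rewrite ltrN2 ltNge h1.
Qed.

Lemma local_min_second f k e dk : 0 < e -> (forall s, `|s| < e -> f 0 <= f s) ->
  (forall s, `|s| < e -> is_derive s 1 f (2 * k s)) -> k 0 = 0 -> is_derive (0 : R) 1 k dk -> 0 <= dk.
Proof.
move=> e0 hf hd k0 d; rewrite leNgt; apply/negP => dk0.
have ndk : 0 < - dk by rewrite oppr_gt0.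
have [e1 e10 he] := is_derive_increasing (is_deriveN d) ndk.
pose s := Num.min (e / 2) (e1 / 2).
have s0 : 0 < s by rewrite lt_min !divr_gt0.
have se : s <= e / 2 by rewrite ge_min lexx.
have se1 : s <= e1 / 2 by rewrite ge_min lexx orbT.
clearbody s.
have kneg u : 0 < u -> u <= s -> k u < 0.
  move=> u0 us; have h : 0 < u < 0 + e1 by rewrite u0 /=; lra.
  by have := he u h; rewrite -[(- k) 0]/(- k 0) -[(- k) u]/(- k u) k0 ltrN2.
have D u : - e < u < e -> is_derive u 1 f (2 * k u).
  by move=> ue; apply: hd; rewrite ltr_norml.
have h1 : f 0 <= f s by apply: hf; rewrite gtr0_norm //; lra.
(* The interval is halved because the intermediate point of the first half may be 0, where [k]
   vanishes; strictness comes from the second half. *)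
have [c /andP[c0 c1] E1] := mvt_in_interval (s := 0) (t := s / 2) D (ltac:(lra)) (ltac:(lra)) (ltac:(lra)).
have [c' /andP[c0' c1'] E2] := mvt_in_interval (s := s / 2) (t := s) D (ltac:(lra)) (ltac:(lra)) (ltac:(lra)).
have kc : k c <= 0.
  by move: c0; rewrite le_eqVlt => /orP[/eqP <-|c0]; [rewrite k0|apply/ltW/kneg => //; lra].
have kc' : k c' < 0 by apply: kneg; lra.
have x1 : 2 * k c * (s / 2 - 0) <= 0 by rewrite subr0 mulr_le0_ge0 //; [rewrite mulr_ge0_le0|rewrite divr_ge0 // ltW].
have x2 : 2 * k c' * (s - s / 2) < 0.
  by rewrite pmulr_llt0 ?pmulr_rlt0 // subr_gt0; lra.
by move: E1 E2 x1 x2 h1; move: (2 * k c * _) (2 * k c' * _) (f 0) (f s) (f _) => *; lra.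
Qed.

End LocalMinimum.

(** * Exclusion of a minimizing pair *)

Section NoMinimalPair.
Context {R : realType} {n : nat} (M : kahlerManifold R n).
Local Notation N := (n + n)%N.
Local Notation V := 'rV[R]_(n + n).
Local Notation W := 'rV[R]_((n + n) + (n + n)).
Implicit Types (phi psi chi : chart R (n + n) M) (c : R -> M) (p q : M) (t s : R) (w v : W).
Local Notation met := (kmetric M).
Local Notation img := (@chart_img R (n + n) M).
Local Notation J := (@stdJ R n).
Context (d : R) (gam : chart R (n + n) M -> W -> R -> M) (d0 : 0 < d).
Hypothesis long : forall phi w, katlas M phi -> geo_dom (img phi) w -> sq (met phi) w <= 1 ->
     long_geodesic d 2 phi w (gam phi w).
Hypothesis hbis : bisectional_in_01 M.

(** A failure of injectivity of the exponential map at a base point that is itself free. *)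
Definition geodesic_pair phi v w := [/\ disc phi v, disc phi w, lsubmx v = lsubmx w, v != w &
  gam phi v 1 = gam phi w 1].

Let oneI : - d < (1 : R) < 2.
Proof. by rewrite (lt_trans _ ltr01) ?oppr_lt0 //= ltr1n. Qed.

(** The two geodesics of a closed pair have opposite velocities at both ends, so a common
    displacement J u of the endpoints is -J of the velocity of the second geodesic. Linearity in [v]
    reduces this to [second_variation]. *)
Lemma second_variation_opp phi psi w0 v : katlas M phi -> katlas M psi -> disc phi w0 ->
  sq (met phi) w0 <= 2^-1 -> chart_dom psi (gam phi w0 1) -> rsubmx w0 != 0 ->
  lsubmx v = - J (rsubmx w0) -> lsubmx (var gam phi w0 v psi 1) = - J (rsubmx (jet psi (gam phi w0) 1)) ->
  bf (met psi (chart_map psi (gam phi w0 1))) (covar (met psi) (jet psi (gam phi w0) 1) (var gam phi w0 v psi 1)) (lsubmx (var gam phi w0 v psi 1))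
  < bf (met phi (lsubmx w0)) (covar (met phi) w0 v) (lsubmx v).
Proof.
move=> a b D0 w2 k u0 v0 Z1.
have vN : var gam phi w0 (- v) psi 1 = - var gam phi w0 v psi 1.
  by rewrite /var -scaleN1r (deriveZl _ _ (jet_diff d0 long a D0 oneI b k)) scaleN1r.
have covN chi (y e : W) : katlas M chi -> geo_dom (img chi) y -> covar (met chi) y (- e) = - covar (met chi) y e.
  move=> ac Dy; have r := kriemannian ac; have oi := @chart_img_open _ _ _ chi.
  rewrite /covar !linearN /= -(scaleN1r (lsubmx e)) (GamZr oi r _ _ _ Dy) scaleN1r.
  by rewrite opprD.
have h1 : lsubmx (- v) = J (rsubmx w0) by rewrite linearN /= v0 opprK.
have h2 : lsubmx (var gam phi w0 (- v) psi 1) = J (rsubmx (jet psi (gam phi w0) 1)).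
  by rewrite vN linearN /= Z1 opprK.
have := second_variation d0 long a D0 hbis w2 b k u0 h1 h2.
rewrite vN (covN psi _ _ b (jet_dom k)) (covN phi _ _ a D0.1).
by rewrite !linearN /= !bfNl !bfNr !opprK.
Qed.

Theorem no_minimal_pair phi v w : katlas M phi -> geodesic_pair phi v w ->
  sq (met phi) v <= 2^-1 -> sq (met phi) w <= 2^-1 ->
  (forall v' w', geodesic_pair phi v' w' -> sq (met phi) v + sq (met phi) w <= sq (met phi) v' + sq (met phi) w') ->
  False.
Proof.
move=> a [Dv Dw l_eq vw end_eq] v2 w2 minimal.
have [psi b kv] := kcovering (gam phi v 1).
have kw : chart_dom psi (gam phi w 1) by rewrite -end_eq.
have r := kriemannian a; have oi := @chart_img_open _ _ _ phi.
have r' := kriemannian b; have oi' := @chart_img_open _ _ _ psi.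
(* Moving the endpoints of both geodesics in the same way produces pairs again, so minimality gives
   the first order inequality and, at a critical direction, the second order one. *)
have var_ineq (x y : V) :
    0 <= momentum_gap gam phi psi x y v + momentum_gap gam phi psi x y w /\
    (momentum_gap gam phi psi x y v + momentum_gap gam phi psi x y w = 0 -> exists v' w' : W,
      [/\ lsubmx v' = x, lsubmx w' = x, lsubmx (var gam phi v v' psi 1) = y, lsubmx (var gam phi w w' psi 1) = y &
       0 <= (bf (met psi (chart_map psi (gam phi v 1))) (covar (met psi) (jet psi (gam phi v) 1) (var gam phi v v' psi 1)) y
       + bf (met psi (chart_map psi (gam phi v 1))) (rsubmx (jet psi (gam phi v) 1)) (Gam (met psi) (chart_map psi (gam phi v 1)) y y)
       - (bf (met phi (lsubmx v)) (covar (met phi) v v') x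
          + bf (met phi (lsubmx v)) (rsubmx v) (Gam (met phi) (lsubmx v) x x)))
       + (bf (met psi (chart_map psi (gam phi w 1))) (covar (met psi) (jet psi (gam phi w) 1) (var gam phi w w' psi 1)) y
       + bf (met psi (chart_map psi (gam phi w 1))) (rsubmx (jet psi (gam phi w) 1)) (Gam (met psi) (chart_map psi (gam phi w 1)) y y)
       - (bf (met phi (lsubmx w)) (covar (met phi) w w') x
          + bf (met phi (lsubmx w)) (rsubmx w) (Gam (met phi) (lsubmx w) x x)))]).
  have [e1 [cv [v' [e10 [cv0 cvc] Pv dv [lv yv Kv]]]]] := endpoint_variation d0 long hbis x y a b Dv v2 kv.
  have [e2 [cw [w' [e20 [cw0 cwc] Pw dw [lw yw Kw]]]]] := endpoint_variation d0 long hbis x y a b Dw w2 kw.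
  (* The initial jets start from [v != w] and stay distinct for small times, so the varied pair is
     genuine. *)
  have [e3 e30 he3] : exists2 e3 : R, 0 < e3 & forall s, `|s| < e3 -> cv s != cw s.
    have h0 : 0 < `|v - w| / 2 by rewrite divr_gt0 // normr_gt0 subr_eq0.
    have nb (z : W) : nbhs z [set u : W | `|u - z| < `|v - w| / 2] by apply: (norm_lt_nbhs h0) => u.
    have nn : nbhs (0 : R) (cv @^-1` [set u : W | `|u - v| < `|v - w| / 2] `&` cw @^-1` [set u : W | `|u - w| < `|v - w| / 2]).
      apply: filterI; first by apply: cvc; rewrite cv0.
      by apply: cwc; rewrite cw0.
    have [e e0 he] := nbhs_norm_lt (W := R^o) nn; exists e => // s se.
    have [h1 h2] := he s (ltac:(by rewrite subr0)).
    by apply/eqP => E; move: h1 h2; rewrite /= E; exact: no_common_half_ball.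
  pose e := Num.min e1 (Num.min e2 e3).
  have e0 : 0 < e by rewrite !lt_min e10 e20.
  have ee s : `|s| < e -> [/\ `|s| < e1, `|s| < e2 & `|s| < e3] by rewrite !lt_min => /andP[? /andP[]].
  clearbody e.
  pose f s := sq (met phi) (cv s) + sq (met phi) (cw s).
  have hf s : `|s| < e -> f 0 <= f s.
    move=> /ee[s1 s2 s3]; rewrite /f cv0 cw0; apply: minimal.
    have [x1 x2 x3 x4] := Pv s s1; have [y1 y2 y3 y4] := Pw s s2.
    split => //; [by rewrite x3 y3 l_eq|exact: he3|].
    by rewrite -(chart_mapK x2) -(chart_mapK y2) x4 y4 end_eq.
  pose k s := momentum_gap gam phi psi x y (cv s) + momentum_gap gam phi psi x y (cw s).
  have hd s : `|s| < e -> is_derive s 1 f (2 * k s).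
    move=> /ee[s1 s2 _]; have := is_deriveD (dv s s1) (dw s s2).
    by rewrite -mulrDr.
  have k0 : k 0 = momentum_gap gam phi psi x y v + momentum_gap gam phi psi x y w by rewrite /k cv0 cw0.
  split.
    have z0 : `|0 : R| < e by rewrite normr0.
    have := local_min_first e0 hf (hd 0 z0); rewrite k0 pmulr_rge0 //.
  move=> kz; exists v', w'; split => //.
  by apply: (local_min_second e0 hf hd _ (is_deriveD Kv Kw)); rewrite k0.
have bfG (y : V) : bf (met psi (chart_map psi (gam phi v 1))) (rsubmx (jet psi (gam phi v) 1) + rsubmx (jet psi (gam phi w) 1)) y
    - bf (met phi (lsubmx v)) (rsubmx v + rsubmx w) 0 = momentum_gap gam phi psi 0 y v + momentum_gap gam phi psi 0 y w.
  by rewrite /momentum_gap !bf0r -end_eq bfDl; ring.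
have U1 : img psi (chart_map psi (gam phi v 1)) by exact: chart_img_map.
(* Otherwise moving only the far end against the sum of the terminal velocities would decrease the
   squared lengths. *)
have ends1 : rsubmx (jet psi (gam phi w) 1) = - rsubmx (jet psi (gam phi v) 1).
  apply/eqP; rewrite -addr_eq0 addrC; apply/negPn/negP => nz.
  have := metric_pos r' U1 nz; set S := _ + _ in nz *.
  have [h _] := var_ineq 0 (- S).
  by move: h; rewrite -bfG -/S bf0r subr0 bfNr oppr_ge0 leNgt => /negP.
(* The same at the common origin, which is moved in the direction of the sum of the initial
   velocities. *)
have starts : rsubmx w = - rsubmx v.
  apply/eqP; rewrite -addr_eq0 addrC; apply/negPn/negP => nz.
  have := metric_pos r Dv.1 nz; set S := _ + _ in nz *.
  have [h _] := var_ineq S 0.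
  move: h; rewrite /momentum_gap !bf0r !sub0r -l_eq -opprD -bfDl -/S oppr_ge0 leNgt.
  by move=> /negP.
have rv0 : rsubmx v != 0.
  apply/eqP => z; move/eqP: vw; apply; rewrite -[v]hsubmxK -[w]hsubmxK l_eq starts z oppr0 //.
have rw0 : rsubmx w != 0 by rewrite starts oppr_eq0.
have gap0 (x y : V) : momentum_gap gam phi psi x y v + momentum_gap gam phi psi x y w = 0.
  by rewrite /momentum_gap -end_eq ends1 starts -l_eq !bfNl; ring.
have [_ /(_ (gap0 _ _))[v' [w' [lv lw yv yw]]]] := var_ineq (J (rsubmx v)) (J (rsubmx (jet psi (gam phi v) 1))).
have S1 := second_variation d0 long a Dv hbis v2 b kv rv0 lv yv.
have S2 : bf (met psi (chart_map psi (gam phi w 1))) (covar (met psi) (jet psi (gam phi w) 1) (var gam phi w w' psi 1)) (lsubmx (var gam phi w w' psi 1))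
  < bf (met phi (lsubmx w)) (covar (met phi) w w') (lsubmx w').
  apply: second_variation_opp => //; first by rewrite lw starts stdJN opprK.
  by rewrite yw ends1 stdJN opprK.
rewrite lv yv in S1; rewrite lw yw in S2.
move: S1 S2; rewrite -end_eq -l_eq starts ends1 !bfNl.
move: (bf _ (covar _ _ _) _) (bf _ (covar _ _ _) _) (bf _ (covar _ _ _) _) (bf _ (covar _ _ _) _) => x1 x2 x3 x4.
move: (bf _ _ _) (bf _ _ _) => y1 y2.
lra.
Qed.

End NoMinimalPair.

Lemma norm_le_compact {R : realType} m (C : R) : compact [set x : 'rV[R]_m | `|x| <= C].
Proof.
apply: bounded_closed_compact.
  exists C; split; first exact: num_real.
  by move=> B CB x /= xC; apply: le_trans xC (ltW CB).
rewrite -[X in closed X]setCK; apply: open_closedC; rewrite openE => x /= /negP; rewrite -ltNge => Cx.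
have h : 0 < `|x| - C by rewrite subr_gt0.
apply: (norm_lt_nbhs h) => y yx; apply/negP; rewrite -ltNge.
have h1 := ler_distD y x 0; rewrite !subr0 (distrC x y) in h1.
by move: h1 yx; move: (`|x|) (`|y|) (`|y - x|) => *; lra.
Qed.

(** * Compactness of the set of short pairs *)

Section NoPair.
Context {R : realType} {n : nat} (M : kahlerManifold R n).
Local Notation N := (n + n)%N.
Local Notation V := 'rV[R]_(n + n).
Local Notation W := 'rV[R]_((n + n) + (n + n)).
Implicit Types (phi psi chi : chart R (n + n) M) (c : R -> M) (p q : M) (t s : R) (w v : W).
Local Notation met := (kmetric M).
Local Notation img := (@chart_img R (n + n) M).
Context (d : R) (gam : chart R (n + n) M -> W -> R -> M) (d0 : 0 < d).
Hypothesis long : forall phi w, katlas M phi -> geo_dom (img phi) w -> sq (met phi) w <= 1 ->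
     long_geodesic d 2 phi w (gam phi w).
Hypothesis hbis : bisectional_in_01 M.

Let oneI : - d < (1 : R) < 2.
Proof. by rewrite (lt_trans _ ltr01) ?oppr_lt0 //= ltr1n. Qed.
Let zI : - d < (0 : R) < 2.
Proof. by rewrite oppr_lt0 d0 ltr0n. Qed.

Lemma sq_ge0 phi w : katlas M phi -> geo_dom (img phi) w -> 0 <= sq (met phi) w.
Proof. by move=> a D; exact: (metric_ge0 (kriemannian a) (rsubmx w) D). Qed.

(** The geodesics in [gam] were chosen chart by chart; uniqueness identifies those that belong to
    the same tangent vector. *)
Lemma chart_change chi phi w : katlas M chi -> katlas M phi -> disc chi w ->
  chart_dom phi (chart_inv chi (lsubmx w)) ->
  let w' := extended_field (transition chi phi) w in
  [/\ disc phi w', sq (met phi) w' = sq (met chi) w & gam phi w' 1 = gam chi w 1].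
Proof.
move=> achi aphi Dw k w'.
have ov : overlap chi phi (lsubmx w) by split => //; exact: Dw.1.
have [ov' e'] := overlapC ov.
have s_eq : sq (met phi) w' = sq (met chi) w.
  by rewrite /sq /w' /extended_field row_mxKl row_mxKr -(transition_metric _ _ achi aphi ov).
have Dw' : disc phi w'.
  split; last by rewrite s_eq; exact: Dw.2.
  by rewrite /geo_dom /= /w' /extended_field row_mxKl; exact: ov'.1.
split => //.
have g1 := disc_geod long aphi Dw'; have g2 := disc_geod long achi Dw.
have p1 := disc_point0 long aphi Dw'; have p2 := disc_point0 long achi Dw.
have l' : lsubmx w' = chart_map phi (chart_inv chi (lsubmx w)) by rewrite /w' /extended_field row_mxKl.
have p12 : gam phi w' 0 = gam chi w 0 by rewrite p1 p2 l' chart_mapK.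
have k2 : chart_dom phi (gam chi w 0) by rewrite p2.
apply: (geod_unique g1 g2 zI aphi p12 _ _ oneI); first by rewrite p12.
have kc := disc_dom0 long achi Dw; have G := g2 0 zI.
rewrite (disc_jet0 long aphi Dw') (jet_transition achi aphi G.1 kc k2 (geod_at_derivable G achi kc)).
by rewrite (disc_jet0 long achi Dw).
Qed.

Lemma pair_chart_change chi phi v w : katlas M chi -> katlas M phi -> geodesic_pair gam chi v w ->
  chart_dom phi (chart_inv chi (lsubmx v)) ->
  exists v' w', [/\ geodesic_pair gam phi v' w', lsubmx v' = chart_map phi (chart_inv chi (lsubmx v)),
     sq (met phi) v' = sq (met chi) v & sq (met phi) w' = sq (met chi) w].
Proof.
move=> achi aphi [Dv Dw l_eq vw e] k.
have k' : chart_dom phi (chart_inv chi (lsubmx w)) by rewrite -l_eq.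
have [Dv' sv ev] := chart_change achi aphi Dv k; have [Dw' sw ew] := chart_change achi aphi Dw k'.
exists (extended_field (transition chi phi) v), (extended_field (transition chi phi) w).
have ov : overlap chi phi (lsubmx v) by split => //; exact: Dv.1.
have [ov' e'] := overlapC ov.
split; [|exact: extended_fieldl|exact: sv|exact: sw].
split; [exact: Dv'|exact: Dw'|by rewrite !extended_fieldl l_eq| |by rewrite ev ew].
apply/eqP => E; move/eqP: vw; apply.
have := congr1 rsubmx E; rewrite !extended_fieldr -l_eq => E2.
have S u : 'D_('D_u (transition chi phi) (lsubmx v)) (transition phi chi) (transition chi phi (lsubmx v)) = u.
  by have := transition_derive_surj u aphi achi ov'; rewrite e'.
by rewrite -[v]hsubmxK -[w]hsubmxK -l_eq -(S (rsubmx v)) E2 S.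
Qed.

Lemma exp_continuous phi w0 : katlas M phi -> disc phi w0 -> {for w0, continuous (fun w => gam phi w 1)}.
Proof.
move=> a D0; have [psi b k] := kcovering (gam phi w0 1).
have [r [r0 hr Cr]] := jet_smooth_all d0 long a 0 D0 oneI b k.
have oB := @open_norm_lt R _ w0 r.
have w0B : [set w | `|w - w0| < r] w0 by rewrite /= subrr normr0.
have cl := Ck_cont (Ck_lsubmx (p := N) oB Cr) w0B.
have n1 : nbhs w0 [set w | `|w - w0| < r] by apply: (norm_lt_nbhs r0) => w.
have nr : \forall w \near w0, (chart_inv psi \o (fun w => lsubmx (jet psi (gam phi w) 1))) w = gam phi w 1.
  by apply: filterS n1 => w /hr[_ kw] /=; rewrite jet_l chart_mapK.
apply: (near_eq_continuous nr); apply: continuous_comp; first exact: cl.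
by apply: chart_inv_cont; rewrite jet_l; exact: chart_img_map.
Qed.

Section Gap.
Context (m : R) (m2 : m < 2^-1).
Hypothesis gap : forall phi v w, katlas M phi -> geodesic_pair gam phi v w ->
  m < sq (met phi) v + sq (met phi) w.

(** If the sum at [(v, w)] exceeds [m], continuity suffices. Otherwise no pairs exist nearby:
    different endpoints stay apart, and for [v = w] the pair map is injective near [v]. The
    remaining case, a true pair, contradicts [gap]. One [r] serves as radius and as gap, which suits
    the compactness arguments. *)
Lemma local_gap phi v w : katlas M phi -> img phi (lsubmx v) -> lsubmx v = lsubmx w ->
  exists2 r : R, 0 < r & forall v' w', `|v' - v| < r -> `|w' - w| < r -> geodesic_pair gam phi v' w' ->
    m + r <= sq (met phi) v' + sq (met phi) w'.
Proof.
move=> a iv l_eq; have r := kriemannian a; have oi := @chart_img_open _ _ _ phi.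
have Dv : geo_dom (img phi) v by []; have Dw : geo_dom (img phi) w by rewrite /geo_dom /= -l_eq.
have vacuous (A B : set W) : nbhs v A -> nbhs w B ->
    (forall v' w', A v' -> B w' -> geodesic_pair gam phi v' w' -> False) ->
   exists2 r : R, 0 < r & forall v' w', `|v' - v| < r -> `|w' - w| < r -> geodesic_pair gam phi v' w' ->
    m + r <= sq (met phi) v' + sq (met phi) w'.
  move=> /nbhs_norm_lt[e1 e10 h1] /nbhs_norm_lt[e2 e20 h2] H.
  exists (Num.min e1 e2); first by rewrite lt_min e10.
  move=> v' w'; rewrite !lt_min => /andP[x1 _] /andP[_ x2] pr; exfalso.
  exact: H (h1 _ x1) (h2 _ x2) pr.
have [big|small] := ltP m (sq (met phi) v + sq (met phi) w).
  pose del := (sq (met phi) v + sq (met phi) w - m) / 4.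
  have del0 : 0 < del by rewrite divr_gt0 // subr_gt0.
  have nb (z : W) : geo_dom (img phi) z -> nbhs z [set y | sq (met phi) z - del < sq (met phi) y].
    move=> Dz; have z1 : sq (met phi) z - del < sq (met phi) z by rewrite gtrDl oppr_lt0.
    exact: (cvgr_gt _ (Ck_cont (sq_Ck oi r 0) Dz) _ z1).
  have [e1 e10 h1] := nbhs_norm_lt (nb v Dv); have [e2 e20 h2] := nbhs_norm_lt (nb w Dw).
  exists (Num.min (Num.min e1 e2) del); first by rewrite !lt_min e10 e20.
  move=> v' w'; rewrite !lt_min => /andP[/andP[x1 _] _] /andP[/andP[_ x2] _] _.
  have y1 := h1 _ x1; have y2 := h2 _ x2; rewrite /= in y1 y2.
  have y3 : Num.min (Num.min e1 e2) del <= del by rewrite ge_min lexx orbT.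
  have E : del * 4 = sq (met phi) v + sq (met phi) w - m by rewrite /del divfK.
  move: (Num.min _ _) y3 => z y3; clearbody del.
  move: (sq (met phi) v) (sq (met phi) w) (sq (met phi) v') (sq (met phi) w') E y1 y2 => *; lra.
have v0 := sq_ge0 a Dv; have w0 := sq_ge0 a Dw; have m2' := m2.
have v2 : sq (met phi) v <= 2^-1 by move: (sq _ v) (sq _ w) v0 w0 small => *; lra.
have w2 : sq (met phi) w <= 2^-1 by move: (sq _ v) (sq _ w) v0 w0 small => *; lra.
have h1 : (2^-1 : R) < 1 by rewrite invf_lt1 // ltr1n.
have Dv' : disc phi v by split => //; exact: le_lt_trans v2 h1.
have Dw' : disc phi w by split => //; exact: le_lt_trans w2 h1.
have [ee|ne] := pselect (gam phi v 1 = gam phi w 1); last first.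
  have [A [B [nA nB AB]]] : exists A B : set M, [/\ nbhs (gam phi v 1) A, nbhs (gam phi w 1) B & A `&` B = set0].
    apply: contrapT => nex; apply: ne; apply: (@khausdorff R n M) => A B nA nB.
    by apply: contrapT => /set0P/negP; rewrite negbK => /eqP AB; apply: nex; exists A, B.
  apply: (vacuous _ _ (exp_continuous a Dv' nA) (exp_continuous a Dw' nB)) => v' w' Av Bw [_ _ _ _ e].
  have : (A `&` B) (gam phi v' 1) by split => //; rewrite e.
  by rewrite AB.
have [vw|vw] := eqVneq v w; last first.
  by have := gap a (And5 Dv' Dw' l_eq vw ee); rewrite ltNge small.
have [psi b k] := kcovering (gam phi v 1).
have [D [g [[oD Dv0] hD _ gK _]]] := pair_inverse d0 long hbis 0 a b Dv' v2 k.
have nv : nbhs v D := open_nbhs_nbhs (conj oD Dv0).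
have nw : nbhs w D by rewrite -vw.
apply: (vacuous D D nv nw) => v' w' Dv1 Dw1 [_ _ l e e'].
move/eqP: e; apply; rewrite -(gK _ Dv1) -(gK _ Dw1); congr g.
by rewrite /pair_map l !jet_l e'.
Qed.

(** A gap above [m] for all pairs based at [q], in whatever chart they are written. *)
Definition pair_gap (r : R) q := forall chi v w, katlas M chi -> geodesic_pair gam chi v w ->
  chart_inv chi (lsubmx v) = q -> m + r <= sq (met chi) v + sq (met chi) w.

(** Near [p] the coordinates of velocities of length at most 1 are bounded by [C], so both
    velocities together range over a compact ball; the local gaps become one, uniform in the base
    point as well. *)
Lemma pair_gap_near p : exists2 r : R, 0 < r & \forall q \near p, pair_gap r q.
Proof.
have [phi a kp] := kcovering p.
have [e [C [e0 C0 hC]]] := local_norm_bound a (chart_img_map kp).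
set z0 := chart_map phi p in hC.
pose K := [set x : W | `|x| <= C].
(* The halves of [x] hold the two velocities; the base point [z] is their common origin. *)
pose Q (r : R) (x : W) := forall z : V, `|z - z0| < r ->
   geodesic_pair gam phi (row_mx z (lsubmx x)) (row_mx z (rsubmx x)) ->
   m + r <= sq (met phi) (row_mx z (lsubmx x)) + sq (met phi) (row_mx z (rsubmx x)).
have cK : compact K by exact: norm_le_compact.
have near_Q : \forall r \near (0 : R)^'+, K `<=` [set x | Q r x].
  move/compact_near_coveringP: cK => cK; apply: (cK R (0 : R)^'+ Q) => x _.
  have iz : img phi (lsubmx (row_mx z0 (lsubmx x) : W)) by rewrite row_mxKl; exact: chart_img_map.
  have le : lsubmx (row_mx z0 (lsubmx x) : W) = lsubmx (row_mx z0 (rsubmx x) : W) by rewrite !row_mxKl.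
  have [rho rho0 hrho] := local_gap a iz le.
  exists ([set y : W | `|y - x| < rho], [set r : R | 0 < r < rho]).
    split; first by apply: (norm_lt_nbhs rho0) => y.
    exists rho => //= r /=; rewrite sub0r normrN => h1 h2.
    by rewrite h2 /=; apply: le_lt_trans (ler_norm _) h1.
  move=> [y r] [/= yx /andP[r0 rr]] z zz pr.
  have zr : `|z - z0| < rho by apply: lt_trans zz rr.
  apply: le_trans (hrho _ _ _ _ pr); first by rewrite lerD2l ltW.
    rewrite row_mxB; apply: norm_row_mx_lt => //; rewrite -linearB; exact: le_lt_trans (norm_lsubmx _) yx.
  rewrite row_mxB; apply: norm_row_mx_lt => //; rewrite -linearB; exact: le_lt_trans (norm_rsubmx _) yx.
have nz : \forall r \near (0 : R)^'+, 0 < r by exact: nbhs_right_gt.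
near (0 : R)^'+ => r.
have r0 : 0 < r by near: r.
have KQ : K `<=` [set x | Q r x] by near: r.
exists r => //.
have me : 0 < Num.min e r by rewrite lt_min e0.
have nb : nbhs z0 [set z : V | `|z - z0| < Num.min e r] by apply: (norm_lt_nbhs me) => z.
have n1 : nbhs p (chart_map phi @^-1` [set z : V | `|z - z0| < Num.min e r]) := chart_map_cont kp nb.
have n2 : nbhs p (chart_dom phi) := open_nbhs_nbhs (conj (chart_dom_open phi) kp).
apply: filterS2 n1 n2 => q hq kq chi v w achi pr eq.
move: hq; rewrite /= lt_min => /andP[he hr].
have kq' : chart_dom phi (chart_inv chi (lsubmx v)) by rewrite eq.
have [v' [w' [pr' lv <- <-]]] := pair_chart_change achi a pr kq'.
rewrite eq in lv; have [[Dv v1] [Dw w1] lw _ _] := pr'.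
have bv : `|rsubmx v'| < C.
  by have [_] := hC _ (rsubmx v') he; apply; rewrite -lv; exact: ltW.
have bw : `|rsubmx w'| < C.
  by have [_] := hC _ (rsubmx w') he; apply; rewrite -lv lw; exact: ltW.
have vE : v' = row_mx (chart_map phi q) (lsubmx (row_mx (rsubmx v') (rsubmx w') : W)) by rewrite row_mxKl -lv hsubmxK.
have wE : w' = row_mx (chart_map phi q) (rsubmx (row_mx (rsubmx v') (rsubmx w') : W)) by rewrite row_mxKr -lv lw hsubmxK.
have := KQ (row_mx (rsubmx v') (rsubmx w')) (ltW (norm_row_mx_lt bv bw)) (chart_map phi q) hr.
by rewrite -vE -wE; apply.
Unshelve. all: by end_near.
Qed.

End Gap.

(** If the infimum over all pairs is below 1/2 it is not attained, by [no_minimal_pair]. Then the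
    local gaps apply, and compactness of M bounds all sums away from the infimum. Below 1/2, both
    squared speeds of a pair lie in the range without conjugate points. *)
Theorem no_geodesic_pair phi v w : compact [set: M] -> katlas M phi -> geodesic_pair gam phi v w ->
  2^-1 <= sq (met phi) v + sq (met phi) w.
Proof.
move=> cM aphi pr0; rewrite leNgt; apply/negP => small.
pose S := [set x : R | exists phi v w, [/\ katlas M phi, geodesic_pair gam phi v w & x = sq (met phi) v + sq (met phi) w]].
have S0 : S (sq (met phi) v + sq (met phi) w) by exists phi, v, w.
have lS : lbound S 0.
  by move=> x [chi [v' [w' [a [[Dv _] [Dw _] _ _ _] ->]]]]; rewrite addr_ge0 // sq_ge0.
have hS : has_inf S by split; [exists (sq (met phi) v + sq (met phi) w)|exists 0].
have mlb chi v' w' : katlas M chi -> geodesic_pair gam chi v' w' -> inf S <= sq (met chi) v' + sq (met chi) w'.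
  by move=> a pr; apply: ge_inf; [exists 0|exists chi, v', w'].
have m2 : inf S < 2^-1 by apply: le_lt_trans (mlb _ _ _ aphi pr0) small.
have gap chi v' w' : katlas M chi -> geodesic_pair gam chi v' w' -> inf S < sq (met chi) v' + sq (met chi) w'.
  move=> a pr; rewrite lt_neqAle mlb // andbT; apply/negP => /eqP E.
  have [Dv Dw _ _ _] := pr.
  have v0 := sq_ge0 a Dv.1; have w0 := sq_ge0 a Dw.1.
  have m2' : sq (met chi) v' + sq (met chi) w' < 2^-1 by rewrite -E.
  apply: (no_minimal_pair d0 long hbis a pr).
  - by apply: ltW; apply: le_lt_trans m2'; rewrite lerDl.
  - by apply: ltW; apply: le_lt_trans m2'; rewrite lerDr.
  by move=> v1 w1 pr1; rewrite -E; exact: mlb.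
have near_all : \forall r \near (0 : R)^'+, [set: M] `<=` [set q | pair_gap (inf S) r q].
  move/compact_near_coveringP: cM => cM; apply: (cM R (0 : R)^'+ (pair_gap (inf S))) => p _.
  have [r r0 nr] := pair_gap_near m2 gap p.
  exists ([set q | pair_gap (inf S) r q], [set s : R | 0 < s < r]).
    split => //=; exists r => //= s /=; rewrite sub0r normrN => h1 h2.
    by rewrite h2 /=; apply: le_lt_trans (ler_norm _) h1.
  move=> [q s] [/= Pq /andP[s0 sr]] chi v' w' a pr eq.
  by apply: le_trans (Pq chi v' w' a pr eq); rewrite lerD2l ltW.
have nz : \forall r \near (0 : R)^'+, 0 < r by exact: nbhs_right_gt.
near (0 : R)^'+ => r.
have r0 : 0 < r by near: r.
have all_r : [set: M] `<=` [set q | pair_gap (inf S) r q] by near: r.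
have [x [chi [v' [w' [a pr ->]]]] lt] := inf_adherent r0 hS.
have := all_r (chart_inv chi (lsubmx v')) I chi v' w' a pr erefl.
by rewrite leNgt lt.
Unshelve. all: by end_near.
Qed.

End NoPair.

(** * The injectivity radius *)

Section ExponentialMap.
Context {R : realType} {n : nat} (M : kahlerManifold R n).
Local Notation N := (n + n)%N.
Local Notation V := 'rV[R]_(n + n).
Local Notation W := 'rV[R]_((n + n) + (n + n)).
Implicit Types (phi psi : chart R (n + n) M).
Local Notation met := (kmetric M).
Local Notation img := (@chart_img R (n + n) M).

Theorem exp_diffeo_half phi (p : M) : compact [set: M] -> bisectional_in_01 M ->
  katlas M phi -> chart_dom phi p -> exp_diffeo phi p (2^-1).
Proof.
move=> cM hbis a kp.
have [d d0 [gam long]] := geodesic_family cM.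
have oneI : - d < (1 : R) < 2 by rewrite (lt_trans _ ltr01) ?oppr_lt0 //= ltr1n.
pose z0 := chart_map phi p.
have iz0 : img phi z0 by exact: chart_img_map.
pose ini (v : V) : W := row_mx z0 v.
pose E (v : V) : M := gam phi (ini v) 1.
pose B := tangent_ball phi p (2^-1).
have Bsq v : B v -> sq (met phi) (ini v) < 4^-1.
  rewrite /B /tangent_ball /= inner_bf /sq /ini row_mxKl row_mxKr => h.
  by apply: (lt_le_trans h); rewrite expr2 -invfM -natrM.
have B2 v : B v -> sq (met phi) (ini v) <= 2^-1.
  by move=> /Bsq h; apply: le_trans (ltW h) _; rewrite lef_pV2 ?posrE // ler_nat.
have Bdisc v : B v -> disc phi (ini v).
  move=> Bv; split; first by rewrite /geo_dom /= row_mxKl.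
  by apply: (lt_trans (Bsq v Bv)); rewrite invf_lt1 // ltr1n.
have Einj v w : B v -> B w -> E v = E w -> v = w.
  move=> Bv Bw e; apply: contrapT => /eqP vw.
  have pr : geodesic_pair gam phi (ini v) (ini w).
    split; [exact: Bdisc|exact: Bdisc|by rewrite /ini !row_mxKl| |exact: e].
    by apply/eqP => h; move/eqP: vw; apply; have := congr1 rsubmx h; rewrite /ini !row_mxKr.
  have := no_geodesic_pair d0 long hbis cM a pr; rewrite leNgt => /negP; apply.
  have := Bsq v Bv; have := Bsq w Bw; move: (sq _ _) (sq _ _) => x y h1 h2; lra.
have Cini k (U : set V) : open U -> Ck k U ini.
  by move=> oU; apply: (Ck_row_mx oU (Ck_cst k U z0) (Ck_id k U)).
have ini_norm (v u : V) : ini u - ini v = row_mx 0 (u - v) by rewrite /ini row_mxB subrr.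
have near_ini v (r : R) : 0 < r -> forall u, `|u - v| < r -> `|ini u - ini v| < r.
  by move=> r0 u h; rewrite ini_norm; apply: norm_row_mx_lt => //; rewrite normr0.
have [L LP] : exists L : M -> V, forall q, (E @` B) q -> B (L q) /\ E (L q) = q.
  have H (q : M) : exists v : V, (E @` B) q -> B v /\ E v = q.
    by have [[v Bv e]|nq] := pselect ((E @` B) q); [exists v|exists 0 => h].
  by have [L hL] := choice H; exists L.
have LE v : B v -> L (E v) = v.
  move=> Bv; have h : (E @` B) (E v) by exists v.
  by have [h1 h2] := LP _ h; apply: Einj.
have oB : open B.
  suff nB (v : V) : B v -> nbhs v B by rewrite openE => v; exact: nB.
  move=> Bv.
  have hc : {for v, continuous (fun u => bf (met phi z0) u u)}.
    have := Ck_bf (k := 0) openT (Ck_cst 0 _ (met phi z0)) (Ck_id 0 setT) (Ck_id 0 setT).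
    by move=> C; exact: (Ck_cont C (I : setT v)).
  have Bv' : bf (met phi z0) v v < (2^-1) ^+ 2 by rewrite -inner_bf.
  have hh : nbhs v [set u : V | bf (met phi z0) u u < (2^-1) ^+ 2] by exact: (cvgr_lt _ hc _ Bv').
  have [e e0 he] := nbhs_norm_lt hh.
  by apply: (norm_lt_nbhs e0) => u /he; rewrite /B /tangent_ball /= inner_bf.
(* Near a point of the ball, the inverse of the exponential map comes from that of the pair map. *)
have loc k v psi : B v -> katlas M psi -> chart_dom psi (E v) -> exists D : set V,
   [/\ open D, D (chart_map psi (E v)), D `<=` img psi, (forall y, D y -> (E @` B) (chart_inv psi y)) &
    Ck k.+1 D (L \o chart_inv psi)].
  move=> Bv b kv.
  have [D [g [[oD Dv] hD oI gK Cg]]] := pair_inverse d0 long hbis k a b (Bdisc v Bv) (B2 v Bv) kv.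
  pose D1 := [set y : V | (pair_map gam phi psi @` (D `&` [set w | B (rsubmx w)])) (row_mx z0 y)].
  have oBr : open [set w : W | B (rsubmx w)].
    apply: (@open_comp _ _ (rsubmx : W -> V) B) => // w _.
    by apply: Ck_cont (Ck_rsubmx (p := N) openT (Ck_id 0 _)) _.
  (* The origin is frozen at [z0]; the recovered velocity must moreover lie in the ball, since the
     inverse of the pair map may also return longer vectors. *)
  pose D2 := [set y : V | (pair_map gam phi psi @` D) (row_mx z0 y)] `&` [set y : V | B (rsubmx (g (row_mx z0 y)))].
  have oIz : open [set y : V | (pair_map gam phi psi @` D) (row_mx z0 y)].
    apply: (@open_comp _ _ (fun y : V => row_mx z0 y : W)) => // y _.
    exact: (Ck_cont (Cini 0%N setT openT) (I : setT y)).
  have Cgz : Ck k.+1 [set y : V | (pair_map gam phi psi @` D) (row_mx z0 y)] (fun y => rsubmx (g (row_mx z0 y))).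
    have C1 := Ck_comp_mx oIz oI (fun _ h => h) (Cini k.+1 _ oIz) Cg.
    exact: (Ck_rsubmx (p := N) oIz C1).
  have oD2 : open D2.
    rewrite openE => y [Iy By]; rewrite /interior.
    have n1 : nbhs y [set y : V | (pair_map gam phi psi @` D) (row_mx z0 y)] := open_nbhs_nbhs (conj oIz Iy).
    have n2 : nbhs y [set y : V | B (rsubmx (g (row_mx z0 y)))].
      exact: (Ck_cont Cgz Iy) (open_nbhs_nbhs (conj oB By)).
    exact: filterI n1 n2.
  have pt y : D2 y -> [/\ chart_dom psi (E (rsubmx (g (row_mx z0 y)))), B (rsubmx (g (row_mx z0 y))) &
      chart_map psi (E (rsubmx (g (row_mx z0 y)))) = y].
    move=> [[w Dw wE] Bw].
    have gy : g (row_mx z0 y) = w by rewrite -wE gK.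
    rewrite /= gy in Bw; rewrite gy.
    have l0 : lsubmx w = z0 by have := congr1 lsubmx wE; rewrite /pair_map !row_mxKl.
    have ew : ini (rsubmx w) = w by rewrite /ini -l0 hsubmxK.
    have [_ kw] := hD w Dw.
    split; [by rewrite /E ew|exact: Bw|].
    by have := congr1 rsubmx wE; rewrite /pair_map !row_mxKr jet_l /E ew.
  have vI : pair_map gam phi psi (ini v) = row_mx z0 (chart_map psi (E v)).
    by rewrite /pair_map jet_l /ini row_mxKl.
  exists D2; split.
  - exact: oD2.
  - by split; [exists (ini v)|rewrite /= -vI gK // /ini row_mxKr].
  - by move=> y /pt[h1 _ <-]; exact: chart_img_map.
  - move=> y /pt[h1 h2 h3]; exists (rsubmx (g (row_mx z0 y))) => //.
    by rewrite -[RHS](congr1 (chart_inv psi) h3) chart_mapK.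
  have Cg2 : Ck k.+1 D2 (fun y => rsubmx (g (row_mx z0 y))) by apply: Ck_sub Cgz => y [].
  apply: (Ck_eq oD2 _ Cg2) => y /pt[h1 h2 h3] /=.
  by rewrite -{2}h3 chart_mapK // LE.
have Econt v : B v -> {for v, continuous E}.
  move=> Bv; have c1 := Ck_cont (Cini 0%N setT openT) (I : setT v).
  exact: (continuous_comp c1 (exp_continuous d0 long a (Bdisc v Bv))).
exists E, L; split.
- move=> v Bv; have Dv := Bdisc v Bv; exists [set t | - d < t < 2], (gam phi (ini v)); split.
  + rewrite openE => t tI; exact: near_interval.
  + move=> t; rewrite /= in_itv /= => /andP[t0 t1].
    by rewrite (lt_le_trans _ t0) ?oppr_lt0 //= (le_lt_trans t1) // ltr1n.
  + by apply: geod_at_geodesic => t tI; exact: (disc_geod long a Dv).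
  split; [|by rewrite -jet_r (disc_jet0 long a Dv) /ini row_mxKr|by []].
  by rewrite (disc_point0 long a Dv) /ini row_mxKl chart_mapK.
- exact: LE.
- exact: Econt.
- rewrite openE => q [v Bv vq]; rewrite /interior.
  have [psi b kq] := kcovering (E v).
  have [D [oD Dq Di DE _]] := loc 0%N v psi Bv b kq.
  rewrite -vq.
  have n1 : nbhs (E v) (chart_map psi @^-1` D) := chart_map_cont kq (open_nbhs_nbhs (conj oD Dq)).
  have n2 : nbhs (E v) (chart_dom psi) := open_nbhs_nbhs (conj (chart_dom_open psi) kq).
  by apply: filterS2 n1 n2 => x Dx kx; rewrite -(chart_mapK kx); exact: DE.
(* The neighbourhoods provided by the smoothness results depend on the point and on the order
   [k]. *)
move=> psi b; split=> k; apply: Ck_pointwise.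
  move=> v [Bv kv].
  have [r [r0 hr Cr]] := jet_smooth_all d0 long a k (Bdisc v Bv) oneI b kv.
  have ob := @open_norm_lt R _ v r; have ob' := @open_norm_lt R _ (ini v) r.
  have C1 := Ck_comp_mx ob ob' (near_ini v r r0) (Cini k _ ob) (Ck_lsubmx (p := N) ob' Cr).
  apply: (Ck_sub (U := [set u | `|u - v| < r])); first by move=> u /= ->; rewrite subrr normr0.
  by apply: (Ck_eq ob _ C1) => u _ /=; rewrite jet_l.
move=> y [iy [v Bv vy]].
have [ky ey] := chart_invK iy; rewrite -vy in ky ey.
have [D [oD Dq _ _ CL]] := loc k v psi Bv b ky.
rewrite ey in Dq; apply: CkS; apply: Ck_sub CL; by move=> u ->.
Qed.

End ExponentialMap.

Theorem lemma7p1 (R : realType) :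
  exists beta : R, 0 < beta /\
    forall (n : nat) (M : kahlerManifold R n),
      orientable M ->
      compact [set: M] ->
      bisectional_in_01 M ->
      ((beta * pi)%:E <= injectivity_radius M)%E.
Proof.
have p0 : (0 : R) < pi by exact: pi_gt0.
exists (2^-1 / pi); split; first by rewrite divr_gt0 // invr_gt0.
move=> n M _ cM hbis; rewrite divfK ?gt_eqF //.
apply: le_ereal_inf_tmp => _ [p _ <-]; apply: le_ereal_sup_tmp.
exists (2^-1)%:E => //; exists 2^-1 => //; split; first by rewrite invr_gt0.
have [phi a kp] := kcovering p; exists phi; split => //.
exact: exp_diffeo_half.
Qed.
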